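(* Let $p\neq 2$ be a prime. For every integer $n>0$ with $n\equiv 0,3 \pmod 4$, $$ 12\sum_{Q \in \mathcal{Q}_{p,-4n}/\Gamma_0(p)} \frac{2}{|\Gamma_0(p)_Q|} - 24\sum_{Q \in \mathcal{Q}_{p,-n}/\Gamma_0(p)} \frac{2}{|\Gamma_0(p)_Q|} = 4r_3(n)-2\big(r_3(p^2 n) - p\, r_3(n)\big). $$
   Context: For a positive integer $N$ and an integer $n$, let $\mathcal{Q}_{N,n}$ be the set of integral binary quadratic forms $ax^2+bxy+cy^2$ ($a,b,c\in\mathbb{Z}$) with $N\mid a$ and $b^2-4ac=n$ (both positive definite and negative definite forms are included when $n<0$). The group $\Gamma_0(N)=\{\begin{pmatrix}a&b\\c&d\end{pmatrix}\in\mathrm{SL}_2(\mathbb{Z}) : c\equiv 0 \pmod N\}$ acts on $\mathcal{Q}_{N,n}$ by linear substitution of variables; the sums run over the (finitely many) orbits, and $\Gamma_0(N)_Q$ denotes the stabilizer of $Q$ in $\Gamma_0(N)$ (a subgroup of $\mathrm{SL}_2(\mathbb{Z})$, so it contains $\pm I$). $r_3(n)$ is the number of $(x,y,z)\in\mathbb{Z}^3$ with $x^2+y^2+z^2=n$. *)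

(* Defs.v *)
From Stdlib Require Import ClassicalEpsilon.
From mathcomp Require Import all_boot all_order all_algebra.
Set Implicit Arguments. Unset Strict Implicit. Unset Printing Implicit Defensive.
Import Order.TTheory GRing.Theory Num.Theory.
Local Open Scope ring_scope.

(* A binary quadratic form a x^2 + b x y + c y^2 is the triple (a, b, c). *)
Definition qform := (int * int * int)%type.
(* A 2x2 integer matrix [[a, b], [c, d]] is the quadruple (a, b, c, d). *)
Definition mat2 := (int * int * int * int)%type.

Definition qa (Q : qform) : int := Q.1.1.
Definition qb (Q : qform) : int := Q.1.2.
Definition qc (Q : qform) : int := Q.2.

Definition disc (Q : qform) : int := qb Q ^+ 2 - 4 * qa Q * qc Q.

Definition inQ (N : nat) (D : int) (Q : qform) : Prop :=
  (N%:Z %| qa Q)%Z /\ disc Q = D.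

Definition inGamma0 (N : nat) (g : mat2) : Prop :=
  let: (a, b, c, d) := g in a * d - b * c = 1 /\ (N%:Z %| c)%Z.

(* Action by linear substitution: (Q.g)(x, y) = Q(a x + b y, c x + d y). *)
Definition act (Q : qform) (g : mat2) : qform :=
  let: (a, b, c, d) := g in
  let: (A, B, C) := Q in
  (A * a ^+ 2 + B * a * c + C * c ^+ 2,
   2 * A * a * b + B * (a * d + b * c) + 2 * C * c * d,
   A * b ^+ 2 + B * b * d + C * d ^+ 2).

Definition equivQ (N : nat) (Q1 Q2 : qform) : Prop :=
  exists g, inGamma0 N g /\ act Q1 g = Q2.

Definition stab (N : nat) (Q : qform) (g : mat2) : Prop :=
  inGamma0 N g /\ act Q g = Q.

Definition card_is (T : eqType) (P : T -> Prop) (k : nat) : Prop :=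
  exists s : seq T, [/\ uniq s, size s = k & forall x, P x <-> x \in s].

Definition stab_card (N : nat) (Q : qform) : nat :=
  epsilon (inhabits 0%N) (fun k => card_is (stab N Q) k).

Definition orbit_reps (N : nat) (D : int) (L : seq qform) : Prop :=
  [/\ forall Q, Q \in L -> inQ N D Q,
      forall Q, inQ N D Q -> exists2 Q', Q' \in L & equivQ N Q' Q
    & forall i j, (i < size L)%N -> (j < size L)%N ->
        equivQ N (nth (0,0,0) L i) (nth (0,0,0) L j) -> i = j].

Definition orbit_sum (N : nat) (D : int) : rat :=
  \sum_(Q <- epsilon (inhabits [::]) (orbit_reps N D))
     2 / (stab_card N Q)%:R.

Definition r3 (n : nat) : nat :=
  epsilon (inhabits 0%N)
    (fun k => card_is (fun v : int * int * int =>
                 v.1.1 ^+ 2 + v.1.2 ^+ 2 + v.2 ^+ 2 = n%:Z) k).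

(* Main.v *)
(* Let H(m) be the number of SL_2(Z)-classes of positive definite forms of discriminant -m, where a
   class with stabilizer G counts 2/|G|.  Two facts give the theorem.

   Hecke relation.  Counting index p sublattices of forms of discriminant -m, and conversely index p
   overlattices of forms of discriminant -p^2 m, shows that the Gamma_0(p)-count of the forms with
   p | a is (p + 2) H(m) - H(p^2 m).  Every weighted count is turned into a finite sum over reduced
   forms by means of a weight alpha with sum_{g in SL_2(Z)} alpha(Q g) = 24 for all definite Q.

   Gauss: r_3(n) = 12 (H(4n) - 2 H(n)).  Reduced forms of determinant n are the representations
   n = uv + vw + wu with u, v, w >= 0, so that H(4n) - 2 H(n) becomes a signed count of these.  Both
   sides are determined by their convolution with the squares k^2.  On the side of r_3 this is the
   number of representations by four squares, which is computed by the same principle (Jacobi).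
   On the other side it is a signed count of the points of uv + vw + wu + k^2 = n in a cone;
   cutting the cone into pieces and moving them by isometries cancels everything but
   lower-dimensional faces, which are sums over divisors. *)
From Stdlib Require Import ClassicalEpsilon.
Require Import Defs.
From mathcomp Require Import all_boot all_order all_algebra.
From mathcomp Require Import zify ring.
Set Implicit Arguments. Unset Strict Implicit. Unset Printing Implicit Defensive.
Import Order.TTheory GRing.Theory Num.Theory.
Local Open Scope ring_scope.

(** * Sums with finite support *)

(** Adding k^2 is what makes the cancellation possible: uv + vw + wu has signature (1, 2), but with
    k^2 added it becomes the split form sc + yr restricted to a sublattice of index 2, and this form
    has enough integral isometries to move pieces of the cone onto each other. The obstacle is that
    an indefinite form takes the value n infinitely often, so a sum over signs alone has no meaning:
    every piece that is moved must have finite support, and this dictates how the cone is cut. The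
    weight alpha belongs to Gamma(2) rather than SL_2(Z) because its domain is given by u, v >= 0
    for the form (u + w)x^2 - 2w xy + (v + w)y^2 with w >= 0. The total 24 is 2 * 2 * 6: alpha is 2
    inside the domain, the matrices 1 and -1 act alike, and Gamma(2) has index 6. Parity weights
    equal to -1 when two entries are even encode the subtraction of a scaled copy: sigma(n) - 4
    sigma(n/4) for four squares, H(4n) - 2 H(n) for three. *)

Definition support_list (T : eqType) (f : T -> int) (s : seq T) : Prop :=
  uniq s /\ forall x, (f x != 0) = (x \in s).

(** The [epsilon] picks an enumeration of the support. When the support is infinite, the second
    alternative forces the empty list and hence the value 0; with this default [fsum_bij] holds
    without a finiteness hypothesis. *)
Definition fsum (T : eqType) (f : T -> int) : int :=
  \sum_(x <- epsilon (inhabits [::]) (fun s => support_list f s \/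
     s = [::] /\ ~ exists s', support_list f s')) f x.

Definition fin_supp (T : eqType) (f : T -> int) : Prop :=
  exists s : seq T, forall x, f x != 0 -> x \in s.

Section Fsum.
Variables T U : eqType.
Implicit Types (f g : T -> int).

Lemma fin_supp_list f : fin_supp f -> exists s, support_list f s.
Proof.
case=> s hs; exists [seq x <- undup s | f x != 0].
split; first by rewrite filter_uniq ?undup_uniq.
by move=> x; rewrite mem_filter mem_undup; case: eqP => //= /eqP /hs ->.
Qed.

Lemma fsum_list f s : support_list f s -> fsum f = \sum_(x <- s) f x.
Proof.
move=> [us hs]; rewrite /fsum.
set P := (fun s => _); have : P (epsilon (inhabits [::]) P).
  by apply: epsilon_spec; exists s; left.
case=> [[ut ht]|[_ nex]]; last by case: nex; exists s.
by apply: perm_big; apply: uniq_perm => // x; rewrite -ht hs.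
Qed.

Lemma fsum_nfin f : ~ fin_supp f -> fsum f = 0.
Proof.
move=> nf; have nex : ~ exists s, support_list f s.
  by case=> s [_ hs]; apply: nf; exists s => x; rewrite hs.
rewrite /fsum.
set P := (fun s => _); have : P (epsilon (inhabits [::]) P).
  by apply: epsilon_spec; exists [::]; right.
by case=> [h|[-> _]]; [case: nex; eexists; exact: h | rewrite big_nil].
Qed.

Lemma fsumE f s : uniq s -> (forall x, f x != 0 -> x \in s) ->
  fsum f = \sum_(x <- s) f x.
Proof.
move=> us hs; rewrite (@fsum_list f [seq x <- s | f x != 0]); last first.
  split; first exact: filter_uniq.
  by move=> x; rewrite mem_filter; case: eqP => //= /eqP /hs ->.
rewrite big_filter big_mkcond /=; apply: eq_bigr => x _.
by case: eqP => //= ->.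
Qed.

Lemma fin_supp_bij f (g : U -> int) (phi : T -> U) (psi : U -> T) :
  (forall y, g y != 0 -> f (psi y) = g y /\ phi (psi y) = y) ->
  fin_supp f -> fin_supp g.
Proof.
move=> h [s hs]; exists (map phi s) => y gy.
have [e1 e2] := h _ gy; rewrite -e2; apply: map_f; apply: hs; by rewrite e1.
Qed.
End Fsum.

(** The maps are mutually inverse only on the supports and arbitrary elsewhere, so one support is
    finite exactly when the other is. *)
Lemma fsum_bij (T U : eqType) (f : T -> int) (g : U -> int)
    (phi : T -> U) (psi : U -> T) :
  (forall x, f x != 0 -> g (phi x) = f x /\ psi (phi x) = x) ->
  (forall y, g y != 0 -> f (psi y) = g y /\ phi (psi y) = y) ->
  fsum f = fsum g.
Proof.
move=> h1 h2.
have [ff|nf] := excluded_middle_informative (fin_supp f); last first.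
  rewrite !fsum_nfin // => fg; apply: nf; exact: (fin_supp_bij h1 fg).
have [s [us hs]] := fin_supp_list ff.
rewrite (@fsumE _ f s) //; last by move=> x; rewrite hs.
rewrite (@fsumE _ g (map phi s)).
- rewrite big_map; apply: eq_big_seq => x xs.
  by have [->] := h1 x (etrans (hs x) xs).
- rewrite map_inj_in_uniq // => x y xs ys e.
  have [_ <-] := h1 x (etrans (hs x) xs).
  by have [_ <-] := h1 y (etrans (hs y) ys); rewrite e.
- move=> y gy; have [e1 e2] := h2 _ gy; rewrite -e2; apply: map_f.
  by rewrite -hs e1.
Qed.

Section FsumTheory.
Variables T U : eqType.
Implicit Types (f g : T -> int).

Lemma eq_fsum f g : f =1 g -> fsum f = fsum g.
Proof. by move=> e; apply: (@fsum_bij _ _ f g id id) => x _; rewrite e. Qed.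

Lemma fin_supp_sub f g : (forall x, f x != 0 -> g x != 0) ->
  fin_supp g -> fin_supp f.
Proof. by move=> h [s hs]; exists s => x /h /hs. Qed.

Lemma fin_suppD f g : fin_supp f -> fin_supp g -> fin_supp (fun x => f x + g x).
Proof.
move=> [s hs] [t ht]; exists (s ++ t) => x; rewrite mem_cat.
by case: (eqVneq (f x) 0) => [-> | /hs -> //]; rewrite add0r => /ht ->; rewrite orbT.
Qed.

Lemma fin_suppZ c f : fin_supp f -> fin_supp (fun x => c * f x).
Proof. by apply: fin_supp_sub => x; rewrite mulf_eq0 negb_or => /andP[]. Qed.

Lemma fsumD f g : fin_supp f -> fin_supp g ->
  fsum (fun x => f x + g x) = fsum f + fsum g.
Proof.
move=> [s hs] [t ht]; pose r := undup (s ++ t).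
have ur : uniq r by exact: undup_uniq.
have hf x : f x != 0 -> x \in r by move=> /hs h; rewrite mem_undup mem_cat h.
have hg x : g x != 0 -> x \in r by move=> /ht h; rewrite mem_undup mem_cat h orbT.
rewrite !(@fsumE _ _ r) //; first by rewrite big_split.
move=> x; case: (eqVneq (f x) 0) => [-> | /hf -> //]; rewrite add0r; exact: hg.
Qed.

Lemma fsumZ c f : fin_supp f -> fsum (fun x => c * f x) = c * fsum f.
Proof.
move=> /fin_supp_list[s [us hs]]; rewrite !(@fsumE _ _ s) //.
- by rewrite mulr_sumr.
- by move=> x; rewrite hs.
- by move=> x; rewrite mulf_eq0 negb_or hs => /andP[].
Qed.

Lemma fsum0 : fsum (fun _ : T => 0) = 0.
Proof. by rewrite (@fsumE _ _ [::]) ?big_nil // => x; rewrite eqxx. Qed.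

Lemma fin_supp_sum (I : eqType) (s : seq I) (F : I -> T -> int) :
  (forall i, i \in s -> fin_supp (F i)) -> fin_supp (fun x => \sum_(i <- s) F i x).
Proof.
elim: s => [|i s IH] h; first by exists [::] => x; rewrite big_nil eqxx.
have hi : fin_supp (F i) by apply: h; rewrite inE eqxx.
have hs : fin_supp (fun x => \sum_(j <- s) F j x).
  by apply: IH => j js; apply: h; rewrite inE js orbT.
by apply: fin_supp_sub (fin_suppD hi hs) => x; rewrite big_cons.
Qed.

Lemma fsum_sum (I : eqType) (s : seq I) (F : I -> T -> int) :
  (forall i, i \in s -> fin_supp (F i)) ->
  fsum (fun x => \sum_(i <- s) F i x) = \sum_(i <- s) fsum (F i).
Proof.
elim: s => [|i s IH] h.
  by rewrite big_nil -[RHS]fsum0; apply: eq_fsum => x; rewrite big_nil.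
have hi : fin_supp (F i) by apply: h; rewrite inE eqxx.
have h' j : j \in s -> fin_supp (F j) by move=> js; apply: h; rewrite inE js orbT.
rewrite big_cons -IH // -fsumD //; last exact: fin_supp_sum.
by apply: eq_fsum => x; rewrite big_cons.
Qed.

Lemma fsum_pair (F : T * U -> int) : fin_supp F ->
  fsum F = fsum (fun x => fsum (fun y => F (x, y))).
Proof.
move=> [s hs].
pose a := undup (map fst s); pose b := undup (map snd s).
have ha x y : F (x, y) != 0 -> x \in a /\ y \in b.
  move=> /hs h; rewrite !mem_undup; split.
    exact: (map_f fst h).
  exact: (map_f snd h).
have inn x : fsum (fun y => F (x, y)) = \sum_(y <- b) F (x, y).
  by rewrite (@fsumE _ _ b) ?undup_uniq // => y /ha[].
rewrite (eq_fsum inn) (@fsumE _ _ a) ?undup_uniq //; last first.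
  move=> x; apply: contraNT => xa; apply/eqP; rewrite big1 // => y _.
  by apply/eqP; apply: contraNT xa => /ha[].
rewrite (@fsumE _ F [seq (x, y) | x <- a, y <- b]).
- by rewrite big_allpairs.
- by apply: allpairs_uniq; rewrite ?undup_uniq // => -[? ?] [? ?] _ _.
- by move=> [x y] /ha[? ?]; apply: allpairs_f.
Qed.
End FsumTheory.

Definition ibox (B : int) : seq int := [seq i%:Z - `|B|%N%:Z | i <- iota 0 (2 * `|B|%N).+1].

Lemma mem_ibox B x : `|x| <= B -> x \in ibox B.
Proof.
move=> h; apply/mapP; exists (absz (x + B)); last by lia.
by rewrite mem_iota; lia.
Qed.

Lemma fin_supp1 (B : int) (f : int -> int) :
  (forall x, f x != 0 -> `|x| <= B) -> fin_supp f.
Proof. by move=> h; exists (ibox B) => x /h; exact: mem_ibox. Qed.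

Lemma fin_supp2 (B : int) (f : int * int -> int) :
  (forall x y, f (x, y) != 0 -> `|x| <= B /\ `|y| <= B) -> fin_supp f.
Proof.
move=> h; exists [seq (x, y) | x <- ibox B, y <- ibox B].
by move=> [x y] /h[? ?]; apply: allpairs_f; exact: mem_ibox.
Qed.

Lemma fin_supp3 (B : int) (f : int * int * int -> int) :
  (forall x y z, f (x, y, z) != 0 -> [/\ `|x| <= B, `|y| <= B & `|z| <= B]) ->
  fin_supp f.
Proof.
move=> h; exists [seq (t, z) | t <- [seq (x, y) | x <- ibox B, y <- ibox B], z <- ibox B].
by move=> [[x y] z] /h[? ? ?]; do !(apply: allpairs_f || exact: mem_ibox).
Qed.

Lemma fin_supp4 (B : int) (f : int * int * int * int -> int) :
  (forall x y z t, f (x, y, z, t) != 0 ->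
     [/\ `|x| <= B, `|y| <= B, `|z| <= B & `|t| <= B]) -> fin_supp f.
Proof.
move=> h; exists [seq (t, w) | t <- [seq (t, z) | t <- [seq (x, y) | x <- ibox B, y <- ibox B],
   z <- ibox B], w <- ibox B].
by move=> [[[x y] z] w] /h[? ? ? ?]; do !(apply: allpairs_f || exact: mem_ibox).
Qed.

Notation "[! b ]" := (nat_of_bool b)%:Z (at level 0, b at level 99, format "[! b ]").

(** The term k = 0 carries f(n) with a nonzero coefficient and all other terms are values below n,
    so the relations determine f by strong induction. Vanishing at negative arguments makes the sums
    finite. *)
Lemma recursion_unique (P : int -> int -> int) (f g : int -> int) :
  (forall n, 0 < n -> P n 0 != 0) ->
  (forall m, m <= 0 -> f m = g m) -> (forall m, m < 0 -> f m = 0) ->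
  (forall n, 0 < n -> fsum (fun k => P n k * f (n - k ^+ 2)) =
                      fsum (fun k => P n k * g (n - k ^+ 2))) ->
  f =1 g.
Proof.
move=> P0 h0 f0 hs.
have main : forall N : nat, forall n : int, n <= N%:Z -> f n = g n.
  elim=> [|N IH] n hn; first by apply: h0; lia.
  have [hlt|hge] := ltrP n N.+1%:Z; first by apply: IH; lia.
  have n0 : 0 < n by lia.
  have e := hs n n0.
  have g0 m : m < 0 -> g m = 0 by move=> hm; rewrite -h0 ?f0 //; lia.
  have bd (u : int -> int) : (forall m, m < 0 -> u m = 0) ->
      forall k, P n k * u (n - k ^+ 2) != 0 -> `|k| <= n.
    move=> hu k; apply: contraNT; rewrite -ltNge => hk.
    by rewrite hu ?mulr0 //; nia.
  rewrite !(@fsumE _ _ (undup (ibox n))) ?undup_uniq // in e; first last.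
  - by move=> k /(bd _ f0) /mem_ibox; rewrite mem_undup.
  - by move=> k /(bd _ g0) /mem_ibox; rewrite mem_undup.
  have i0 : 0 \in undup (ibox n) by rewrite mem_undup; apply: mem_ibox; lia.
  rewrite !(bigD1_seq 0) ?undup_uniq //= expr0n subr0 in e.
  have rest : \sum_(i <- undup (ibox n) | i != 0) P n i * f (n - i ^+ 2) =
              \sum_(i <- undup (ibox n) | i != 0) P n i * g (n - i ^+ 2).
    by apply: eq_bigr => k k0; rewrite IH //; nia.
  by move: e; rewrite rest => /addIr /(mulfI (P0 _ n0)).
by move=> n; apply: (main `|n|%N); lia.
Qed.

(** * Jacobi's four-square theorem *)

Definition evenz (a : int) : bool := (2 %| a)%Z.
(** For m > 0 this weight turns [sigma_omega m] into sigma(m) - 4 sigma(m/4), the sum of the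
    divisors of m that are not multiples of 4. *)
Definition omega2 (a c : int) : int := 1 - 2 * [! evenz a && evenz c].
Definition sigma_omega (m : int) : int :=
  fsum (fun z : int * int => [! [&& 0 < z.1, 0 < z.2 & z.1 * z.2 == m]] * (omega2 z.1 z.2 * z.1)).
Definition sigma_formula (m : int) : int := [! m == 0] + 8 * sigma_omega m.
Definition four_squares (m : int) : int :=
  fsum (fun z : int * int * int * int =>
    let: (x, y, z, t) := z in [! x ^+ 2 + y ^+ 2 + z ^+ 2 + t ^+ 2 == m]).
Definition nsqrt (n : int) : int := fsum (fun k : int => [! k ^+ 2 == n]).

Lemma b2z_neq0 (b : bool) : ([! b] != 0 :> int) = b.
Proof. by case: b. Qed.

Lemma abs_le_sqr (x m : int) : x ^+ 2 <= m -> `|x| <= m.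
Proof. nia. Qed.

Lemma fsum_range (M : nat) (g : int -> int) :
  fsum (fun c : int => [! 0 < c < M%:Z] * g c) = \sum_(1 <= i < M) g i%:Z.
Proof.
rewrite (@fsumE _ _ (map Posz (index_iota 1 M))).
- rewrite big_map; apply: eq_big_seq => i; rewrite mem_index_iota => h.
  by rewrite (_ : 0 < i%:Z < M%:Z) ?mul1r; lia.
- by rewrite map_inj_uniq ?iota_uniq // => i j [].
- move=> c; rewrite mulf_eq0 negb_or b2z_neq0 => /andP[h _].
  apply/mapP; exists (absz c); last by lia.
  by rewrite mem_index_iota; lia.
Qed.

Section Jacobi.
Variable n : int.
Hypothesis n_gt0 : 0 < n.

Let I3 := (int * (int * int))%type.
Let D (z : I3) : int :=
  let: (k, (a, c)) := z in [! [&& 0 < a, 0 < c & k ^+ 2 + a * c == n]] * omega2 a c.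
Let X (F : int -> int -> int -> int) : int :=
  fsum (fun z : I3 => D z * F z.1 z.2.1 z.2.2).

Let D_neq0 k a c : D (k, (a, c)) != 0 -> [/\ 0 < a, 0 < c & k ^+ 2 + a * c = n].
Proof. by rewrite mulf_eq0 negb_or b2z_neq0 => /andP[/and3P[-> -> /eqP]]. Qed.

Let finX F : fin_supp (fun z : I3 => D z * F z.1 z.2.1 z.2.2).
Proof.
exists [seq (x, z) | x <- ibox n, z <- [seq (y, t) | y <- ibox n, t <- ibox n]].
move=> [k [a c]]; rewrite mulf_eq0 negb_or => /andP[/D_neq0[h1 h2 h3] _].
by do !(apply: allpairs_f || apply: mem_ibox); nia.
Qed.

Let XD F G : X (fun k a c => F k a c + G k a c) = X F + X G.
Proof.
rewrite /X -fsumD; try exact: finX.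
by apply: eq_fsum => z; rewrite mulrDr.
Qed.

Let XZ e F : X (fun k a c => e * F k a c) = e * X F.
Proof. by rewrite /X -fsumZ; [apply: eq_fsum => z; ring | exact: finX]. Qed.

Let eqX F G : (forall k a c, D (k, (a, c)) != 0 -> F k a c = G k a c) -> X F = X G.
Proof.
move=> h; apply: eq_fsum => -[k [a c]].
by case: (eqVneq (D (k, (a, c))) 0) => [->|/h e]; [rewrite !mul0r|congr (_ * _); exact: e].
Qed.

Let X_bij (phi : int -> int -> int -> I3) (psi : int -> int -> int -> I3) F G :
  (forall k a c, 0 < a -> 0 < c -> F k a c != 0 -> let: (k', (a', c')) := phi k a c in
     [/\ 0 < a', 0 < c', k' ^+ 2 + a' * c' = k ^+ 2 + a * c, omega2 a' c' = omega2 a c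
      & G k' a' c' = F k a c] /\ psi k' a' c' = (k, (a, c))) ->
  (forall k a c, 0 < a -> 0 < c -> G k a c != 0 -> let: (k', (a', c')) := psi k a c in
     [/\ 0 < a', 0 < c', k' ^+ 2 + a' * c' = k ^+ 2 + a * c, omega2 a' c' = omega2 a c
      & F k' a' c' = G k a c] /\ phi k' a' c' = (k, (a, c))) ->
  X F = X G.
Proof.
move=> h1 h2.
apply: (@fsum_bij _ _ _ _ (fun z => phi z.1 z.2.1 z.2.2) (fun z => psi z.1 z.2.1 z.2.2)).
- move=> [k [a c]] /=; rewrite mulf_eq0 negb_or => /andP[/D_neq0[ha hc hn] hF].
  have := h1 k a c ha hc hF.
  case: (phi k a c) => k' [a' c'] [[ha' hc' e1 e2 ->] ->] /=.
  by rewrite ha' hc' e1 e2 ha hc.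
- move=> [k [a c]] /=; rewrite mulf_eq0 negb_or => /andP[/D_neq0[ha hc hn] hF].
  have := h2 k a c ha hc hF.
  case: (psi k a c) => k' [a' c'] [[ha' hc' e1 e2 ->] ->] /=.
  by rewrite ha' hc' e1 e2 ha hc.
Qed.

(* H is even under (k, a, c) -> (-k, c, a) and odd under the shear (a - k, a, c + 2k - a), which
   preserves the form k^2 + ac; its average over k -> -k and a <-> c is (a + c)(ac - 4k^2). *)
Let H (k a c : int) : int := (a + c) * (a - 2 * k) * (c + 2 * k).

(** The shear is an involution exchanging c with c + 2k - a, so it preserves this half space; it
    fixes [omega2] and negates [H], and the sum equals its own negative. *)
Let X_pos : X (fun k a c => [! 0 < c + 2 * k - a] * H k a c) = 0.
Proof.
have e : X (fun k a c => [! 0 < c + 2 * k - a] * H k a c) =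
         X (fun k a c => -1 * ([! 0 < c + 2 * k - a] * H k a c)).
  apply: (X_bij (phi := fun k a c => (a - k, (a, c + 2 * k - a)))
                (psi := fun k a c => (a - k, (a, c + 2 * k - a)))) => k a c ha hc.
    rewrite mulf_eq0 negb_or b2z_neq0 => /andP[hk _].
    split; last by congr (_, (_, _)); ring.
    split=> //; [by ring|by rewrite /omega2 /evenz; lia|].
    have -> : 0 < c + 2 * k - a + 2 * (a - k) - a by lia.
    by rewrite hk /H; ring.
  rewrite !mulf_eq0 !negb_or b2z_neq0 => /and3P[_ hk _].
  split; last by congr (_, (_, _)); ring.
  split=> //; [by ring|by rewrite /omega2 /evenz; lia|].
  have -> : 0 < c + 2 * k - a + 2 * (a - k) - a by lia.
  by rewrite hk /H; ring.
by move: e; rewrite XZ; lia.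
Qed.

Let X_neg : X (fun k a c => [! c + 2 * k - a < 0] * H k a c) = 0.
Proof.
rewrite -[RHS]X_pos.
by apply: (X_bij (phi := fun k a c => (- k, (c, a))) (psi := fun k a c => (- k, (c, a))))
  => k a c ha hc _; (split; last by congr (_, (_, _)); ring);
  (split=> //; [by ring|by rewrite /omega2 /evenz; lia|congr ([! _] * _); [lia|rewrite /H; ring]]).
Qed.

(** [L] is kept independent of the upper limit so that induction on [j] goes through. For L = 2j the
    value is j. *)
Let alt_sum (j : nat) (L : int) :
  \sum_(1 <= i < 2 * j) omega2 i%:Z i%:Z * (i%:Z * (L - i%:Z)) = L * j%:Z - j%:Z * (2 * j%:Z - 1).
Proof.
elim: j => [|j IH]; first by rewrite big_geq //; lia.
case: j IH => [_|j IH].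
  by rewrite big_nat1 /omega2 /evenz /=; lia.
have -> : (2 * j.+2 = (2 * j.+1).+2)%N by lia.
by rewrite big_nat_recr 1?big_nat_recr /= ?IH /omega2 /evenz; lia.
Qed.

(** On the wall a = c + 2k the form is a perfect square, n = (k + c)^2. With m = k + c the summand
    is 2m c (2m - c), and [alt_sum] reduces the sum over 0 < c < 2m to 2m * m = 2n for each positive
    root m. *)
Let X_zero : X (fun k a c => [! c + 2 * k - a == 0] * H k a c) = n * nsqrt n.
Proof.
pose g (z : int * int) : int :=
  [! (0 < z.1) && (z.1 ^+ 2 == n)] * (2 * z.1) *
  ([! 0 < z.2 < 2 * z.1] * (omega2 z.2 z.2 * (z.2 * (2 * z.1 - z.2)))).
transitivity (fsum g).
  rewrite /X; apply: (@fsum_bij _ _ _ _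
    (fun z : I3 => (z.1 + z.2.2, z.2.2))
    (fun z : int * int => (z.1 - z.2, (2 * z.1 - z.2, z.2)))).
  - move=> [k [a c]] /=; rewrite !mulf_eq0 !negb_or !b2z_neq0.
    move=> /and3P[/andP[/and3P[ha hc /eqP hn] _] /eqP h1 h2].
    have ea : a = c + 2 * k by lia.
    split; last by congr (_, (_, _)); lia.
    rewrite /g /= /H; subst a.
    have -> : 0 < k + c by lia.
    have -> : ((k + c) ^+ 2 == n) by apply/eqP; rewrite -hn; ring.
    have -> : 0 < c < 2 * (k + c) by lia.
    have -> : c + 2 * k - (c + 2 * k) == 0 by lia.
    have -> : (k ^+ 2 + (c + 2 * k) * c == n) by apply/eqP.
    have -> : omega2 (c + 2 * k) c = omega2 c c by rewrite /omega2 /evenz; lia.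
    by rewrite ha hc /=; ring.
  - move=> [m c]; rewrite /g /=; rewrite !mulf_eq0 !negb_or !b2z_neq0.
    move=> /and3P[/andP[/andP[hm /eqP hn] _] /andP[hc hc2] _].
    split; last by congr (_, _); lia.
    have -> : 0 < 2 * m - c by lia.
    have -> : ((m - c) ^+ 2 + (2 * m - c) * c == n) by apply/eqP; rewrite -hn; ring.
    have -> : c + 2 * (m - c) - (2 * m - c) == 0 by lia.
    have -> : omega2 (2 * m - c) c = omega2 c c by rewrite /omega2 /evenz; lia.
    by rewrite hc hc2 hm hn eqxx /H /=; ring.
have fg : fin_supp g.
  apply: (@fin_supp2 (2 * n)) => x y; rewrite /g /= !mulf_eq0 !negb_or !b2z_neq0.
  by move=> /andP[/andP[/andP[? /eqP ?] _] /andP[? _]]; nia.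
rewrite fsum_pair // {fg}/g /=.
have e m : fsum (fun c : int => [! (0 < m) && (m ^+ 2 == n)] * (2 * m) *
    ([! 0 < c < 2 * m] * (omega2 c c * (c * (2 * m - c))))) =
    n * (2 * [! (0 < m) && (m ^+ 2 == n)]).
  case: (boolP ((0 < m) && (m ^+ 2 == n))) => [/andP[m0 /eqP hn]|_]; last first.
    by rewrite !mulr0 -[RHS](@fsum0 int); apply: eq_fsum => c; rewrite !mul0r.
  have em : m = (absz m)%:Z by lia.
  rewrite fsumZ; last first.
    apply: (@fin_supp1 (2 * m)) => c; rewrite mulf_eq0 negb_or b2z_neq0.
    by move=> /andP[? _]; lia.
  rewrite -hn em; move: (absz m) => j.
  have -> : 2 * j%:Z = (2 * j)%N%:Z by lia.
  rewrite fsum_range alt_sum PoszM; ring.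
rewrite (eq_fsum e) /nsqrt.
have fs b : fin_supp (fun m : int => [! b m && (m ^+ 2 == n)]).
  by apply: (@fin_supp1 n) => m; rewrite b2z_neq0 => /andP[_ /eqP]; nia.
have f1 := fs (fun m => 0 < m); have f2 := fs (fun m => m < 0).
rewrite !fsumZ //; last exact: fin_suppZ.
congr (_ * _).
transitivity (fsum (fun m : int => [! (0 < m) && (m ^+ 2 == n)]) +
              fsum (fun m : int => [! (m < 0) && (m ^+ 2 == n)])).
  rewrite mulr_natl mulr2n; congr (_ + _).
  by apply: (@fsum_bij _ _ _ _ -%R -%R) => m _; split; lia.
rewrite -fsumD //; apply: eq_fsum => m; case: eqP => [hn|]; last by rewrite !andbF.
by rewrite !andbT; nia.
Qed.

(** Where k^2 + ac = n, the factor ac - 4k^2 is n - 5k^2, the origin of the 5. The remaining part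
    2k(a^2 - c^2) of [H] is odd in k and sums to 0, and a and c contribute equally. *)
Lemma sigma_omega_recursion_aux : 2 * X (fun k a c => a * (n - 5 * k ^+ 2)) = n * nsqrt n.
Proof.
have e1 : X H = n * nsqrt n.
  rewrite -X_zero -[RHS]add0r -[X in X + _]X_pos -[RHS]addr0 -[X in _ + X]X_neg -!XD.
  apply: eqX => k a c _; lia.
rewrite -e1.
pose F (k a c : int) := a * (n - 5 * k ^+ 2).
have e2 : X (fun k a c => c * (n - 5 * k ^+ 2)) = X F.
  by apply: (X_bij (phi := fun k a c => (k, (c, a))) (psi := fun k a c => (k, (c, a))))
   => k a c ha hc _; split=> //; split=> //; rewrite /omega2 1?andbC //; ring.
have e3 : X (fun k a c => 2 * k * (a ^+ 2 - c ^+ 2)) = 0.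
  have e : X (fun k a c => 2 * k * (a ^+ 2 - c ^+ 2)) =
           X (fun k a c => -1 * (2 * k * (a ^+ 2 - c ^+ 2))).
    by apply: (X_bij (phi := fun k a c => (- k, (a, c))) (psi := fun k a c => (- k, (a, c))))
      => k a c ha hc _; (split; last by congr (_, _); ring); split=> //; ring.
  by move: e; rewrite XZ; lia.
rewrite mulr_natl mulr2n -[X in _ + X]e2 -[LHS]addr0 -[X in _ + X = _]e3 -!XD.
apply: eqX => k a c /D_neq0[_ _ e]; rewrite /H -e; ring.
Qed.

(** Each root of k^2 = n contributes n - 5n through the indicator in [sigma_formula]; the total -4n
    [nsqrt n] cancels eight times the sum of [sigma_omega_recursion_aux]. *)
Lemma sigma_formula_recursion : fsum (fun k : int => (n - 5 * k ^+ 2) * sigma_formula (n - k ^+ 2)) = 0.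
Proof.
have e k : (n - 5 * k ^+ 2) * sigma_formula (n - k ^+ 2) =
   -4 * n * [! k ^+ 2 == n] + 8 * fsum (fun z : int * int => D (k, z) * (z.1 * (n - 5 * k ^+ 2))).
  rewrite /sigma_formula mulrDr; congr (_ + _).
    by rewrite subr_eq0 eq_sym; case: eqP => [->|_]; rewrite ?mulr0 //=; ring.
  rewrite mulrCA; congr (_ * _); rewrite /sigma_omega -fsumZ; last first.
    apply: (@fin_supp2 n) => x y /=; rewrite mulf_eq0 negb_or b2z_neq0.
    by move=> /andP[/and3P[? ? /eqP ?] _]; nia.
  apply: eq_fsum => -[a c]; rewrite /D /=.
  have -> : (k ^+ 2 + a * c == n) = (a * c == n - k ^+ 2) by lia.
  ring.
rewrite (eq_fsum e) fsumD.
- rewrite !fsumZ.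
  + rewrite -/(nsqrt n) -(fsum_pair (F := fun z : I3 => D z * (z.2.1 * (n - 5 * z.1 ^+ 2)))).
      have := sigma_omega_recursion_aux; rewrite /X /=; lia.
    exact: (@finX (fun k a c => a * (n - 5 * k ^+ 2))).
  + by apply: (@fin_supp1 n) => m; rewrite b2z_neq0 => /eqP; nia.
  + apply: (@fin_supp1 n) => k; apply: contraNT; rewrite -ltNge => hk.
    apply/eqP; rewrite -[RHS](@fsum0 (int * int)%type); apply: eq_fsum => -[a c].
    apply/eqP; apply: contraTT hk; rewrite mulf_eq0 negb_or -leNgt => /andP[/D_neq0[]]; nia.
- apply: fin_suppZ; by apply: (@fin_supp1 n) => m; rewrite b2z_neq0 => /eqP; nia.
- apply: fin_suppZ; apply: (@fin_supp1 n) => k; apply: contraNT; rewrite -ltNge => hk.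
  apply/eqP; rewrite -[RHS](@fsum0 (int * int)%type); apply: eq_fsum => -[a c].
  apply/eqP; apply: contraTT hk; rewrite mulf_eq0 negb_or -leNgt => /andP[/D_neq0[]]; nia.
Qed.

(** The sum runs over representations of n by five squares. The coordinates are interchangeable and
    their squares add up to n, so n - 5k^2 averages to 0. *)
Lemma four_squares_recursion : fsum (fun k : int => (n - 5 * k ^+ 2) * four_squares (n - k ^+ 2)) = 0.
Proof.
pose I5 := (int * (int * int * int * int))%type.
pose W (z : I5) : int := let: (k, (x, y, z, t)) := z in
  [! x ^+ 2 + y ^+ 2 + z ^+ 2 + t ^+ 2 + k ^+ 2 == n].
have fW (F : I5 -> int) : fin_supp (fun z => W z * F z).
  exists [seq (k, z) | k <- ibox n, z <- [seq (t, w) | t <- [seq (t, z) |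
     t <- [seq (x, y) | x <- ibox n, y <- ibox n], z <- ibox n], w <- ibox n]].
  move=> [k [[[x y] z] t]]; rewrite mulf_eq0 negb_or b2z_neq0 => /andP[/eqP h _].
  have := (sqr_ge0 x, sqr_ge0 y, sqr_ge0 z, sqr_ge0 t, sqr_ge0 k) => -[[[[? ?] ?] ?] ?].
  by do !(apply: allpairs_f || apply: mem_ibox); apply: abs_le_sqr; lia.
have e k : (n - 5 * k ^+ 2) * four_squares (n - k ^+ 2) =
   fsum (fun z : int * int * int * int => W (k, z) * (n - 5 * k ^+ 2)).
  rewrite /four_squares -fsumZ; last first.
    apply: (@fin_supp4 n) => x y z t; rewrite b2z_neq0 => /eqP h.
    have := (sqr_ge0 x, sqr_ge0 y, sqr_ge0 z, sqr_ge0 t, sqr_ge0 k) => -[[[[? ?] ?] ?] ?].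
    by split; apply: abs_le_sqr; lia.
  apply: eq_fsum => -[[[x y] z] t]; rewrite /W mulrC; congr ([! _] * _); lia.
rewrite (eq_fsum e) -(fsum_pair (F := fun z : I5 => W z * (n - 5 * z.1 ^+ 2))); last exact: fW.
pose E (F : I5 -> int) := fsum (fun z => W z * F z).
have ED F G : E (fun z => F z + G z) = E F + E G.
  by rewrite /E -fsumD; try exact: fW; apply: eq_fsum => z; ring.
pose q (z : I5) := z.1 ^+ 2.
have sw (phi : I5 -> I5) : (forall z, W (phi z) = W z) -> involutive phi ->
    E (fun z => q (phi z)) = E q.
  move=> h1 h2; apply: (@fsum_bij _ _ _ _ phi phi) => z _; last by rewrite h1 h2.
  by rewrite h1 h2.
have e1 : E (fun z => z.2.1.1.1 ^+ 2) = E q.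
  by rewrite -(sw (fun z => let: (k, (x, y, z, t)) := z in (x, (k, y, z, t)))) //;
   [apply: eq_fsum => -[k [[[x y] z] t]]|move=> [k [[[x y] z] t]]; congr [! _]; lia|move=> [k [[[x y] z] t]]].
have e2 : E (fun z => z.2.1.1.2 ^+ 2) = E q.
  by rewrite -(sw (fun z => let: (k, (x, y, z, t)) := z in (y, (x, k, z, t)))) //;
   [apply: eq_fsum => -[k [[[x y] z] t]]|move=> [k [[[x y] z] t]]; congr [! _]; lia|move=> [k [[[x y] z] t]]].
have e3 : E (fun z => z.2.1.2 ^+ 2) = E q.
  by rewrite -(sw (fun z => let: (k, (x, y, z, t)) := z in (z, (x, y, k, t)))) //;
   [apply: eq_fsum => -[k [[[x y] z] t]]|move=> [k [[[x y] z] t]]; congr [! _]; lia|move=> [k [[[x y] z] t]]].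
have e4 : E (fun z => z.2.2 ^+ 2) = E q.
  by rewrite -(sw (fun z => let: (k, (x, y, z, t)) := z in (t, (x, y, z, k)))) //;
   [apply: eq_fsum => -[k [[[x y] z] t]]|move=> [k [[[x y] z] t]]; congr [! _]; lia|move=> [k [[[x y] z] t]]].
have eZ : E (fun z => -4 * q z) = -4 * E q.
  by rewrite /E -fsumZ; [apply: eq_fsum => z; ring|exact: fW].
transitivity (E (fun z => z.2.1.1.1 ^+ 2 + z.2.1.1.2 ^+ 2 + z.2.1.2 ^+ 2 + z.2.2 ^+ 2 + -4 * q z)).
  apply: eq_fsum => -[k [[[x y] z] t]]; rewrite /W /q /=; case: eqP => [h|_]; last by rewrite !mul0r.
  by rewrite !mul1r; lia.
rewrite !ED e1 e2 e3 e4 eZ; lia.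
Qed.
End Jacobi.

Lemma jacobi_four_squares : four_squares =1 sigma_formula.
Proof.
have sg0 m : m <= 0 -> sigma_omega m = 0.
  move=> hm; rewrite -[RHS](@fsum0 (int * int)%type); apply: eq_fsum => -[a c] /=.
  case: (boolP [&& _, _ & _]) => [/and3P[? ? /eqP ?]|_]; last by rewrite mul0r.
  by nia.
have r40 m : m < 0 -> four_squares m = 0.
  move=> hm; rewrite -[RHS](@fsum0 (int * int * int * int)%type); apply: eq_fsum => -[[[x y] z] t] /=.
  by case: eqP => // ?; nia.
apply: (@recursion_unique (fun n k => n - 5 * k ^+ 2)).
- move=> n; lia.
- move=> m; rewrite le_eqVlt => /orP[/eqP->|hm].
    rewrite /sigma_formula sg0 // mulr0 addr0 /four_squares (@fsumE _ _ [:: (0, 0, 0, 0)]) //.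
      by rewrite big_seq1.
    move=> [[[x y] z] t]; rewrite b2z_neq0 inE => /eqP h.
    have := (sqr_ge0 x, sqr_ge0 y, sqr_ge0 z, sqr_ge0 t) => -[[[? ?] ?] ?].
    have e0 (u : int) : u ^+ 2 <= 0 -> u == 0 by nia.
    by rewrite !xpair_eqE !e0 //; lia.
  by rewrite r40 // /sigma_formula sg0 ?mulr0; lia.
- exact: r40.
- by move=> n n0; rewrite four_squares_recursion // sigma_formula_recursion.
Qed.

(** * Gauss's formula for sums of three squares *)

Definition sg (x : int) : int := [! 0 < x] - [! x < 0].
(** The sign of x + ey for an infinitesimal e > 0. *)
Definition lsg (x y : int) : int :=
  [! (0 < x) || (x == 0) && (0 < y)] - [! (x < 0) || (x == 0) && (y < 0)].

Lemma sg2 x : sg (2 * x) = sg x.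
Proof. by rewrite /sg; lia. Qed.

Lemma lsg_pair_sub (a b : int) : lsg a (b - a) + lsg b (a - b) =
  2 * ([! [&& 0 <= a, 0 <= b & (0 < a) || (0 < b)]] - [! [&& a <= 0, b <= 0 & (a < 0) || (b < 0)]]).
Proof. by rewrite /lsg; lia. Qed.

Lemma lsg_pair (a b : int) : lsg a b + lsg b a =
  2 * ([! [&& 0 <= a, 0 <= b & (0 < a) || (0 < b)]] - [! [&& a <= 0, b <= 0 & (a < 0) || (b < 0)]]).
Proof. by rewrite /lsg; lia. Qed.

(** Since a + q = b + p > 0, a pair in the closed negative quadrant forces the other pair into the
    open positive one, so negative contributions are absorbed and only counts of closed quadrants
    remain. *)
Lemma lsg_pair_count (a b p q : int) : 0 < a + q -> b = a + q - p ->
  [! [&& 0 <= a, 0 <= b & (0 < a) || (0 < b)]] - [! [&& a <= 0, b <= 0 & (a < 0) || (b < 0)]] +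
  ([! [&& 0 <= p, 0 <= q & (0 < p) || (0 < q)]] - [! [&& p <= 0, q <= 0 & (p < 0) || (q < 0)]]) =
  [! [&& 0 <= a, 0 <= b & (0 < p) || (0 < q)]] + [! [&& 0 <= p, 0 <= q & (0 < a) || (0 < b)]].
Proof.
by case: (ltrgtP a 0) => ha; case: (ltrgtP b 0) => hb; case: (ltrgtP p 0) => hp;
  case: (ltrgtP q 0) => hq //= h e; exfalso; lia.
Qed.

Definition I4 := (int * int * int * int)%type.

(* Coordinates s = u + k, c = v + w, y = w - k, r = v - k turn uv + vw + wu + k^2 into sc + yr; the
   weight parity_weight is omega3 u v w on the image of Z^4, and 0 off it. *)
Definition parity_weight (z : I4) : int := let: (s, c, y, r) := z in
  [! evenz (c + y + r)] - 2 * [! [&& evenz (c + y + r), evenz c & evenz (s - y)]].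
Definition quad (z : I4) : int := let: (s, c, y, r) := z in s * c + y * r.

Lemma fsum_count2 (a b : int) : a <= b ->
  fsum (fun j : int => [! a <= 2 * j < b]) = ((b + 1) %/ 2)%Z - ((a + 1) %/ 2)%Z.
Proof.
move=> hab; pose a' := ((a + 1) %/ 2)%Z; pose M := absz (((b + 1) %/ 2)%Z - a').
transitivity (fsum (fun c : int => [! 0 < c < M.+1%:Z] * 1)).
  apply: (@fsum_bij _ _ _ _ (fun j : int => j - a' + 1) (fun c : int => c + a' - 1)) => j _.
    by split; [rewrite mulr1; congr [! _]; rewrite /M /a'; lia|lia].
  by split; [rewrite mulr1; congr [! _]; rewrite /M /a'; lia|lia].
by rewrite fsum_range sumr_const_nat /M /a'; lia.
Qed.

Lemma fsum_alt (q : int) :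
  fsum (fun i : int => [! 0 < i < q] * (1 - 2 * [! evenz i])) = [! (0 < q) && evenz q].
Proof.
case: (ltrP 0 q) => hq; last first.
  rewrite -[RHS](@fsum0 int); apply: eq_fsum => i.
  by rewrite (_ : 0 < i < q = false) ?mul0r //; lia.
have -> : q = (absz q)%:Z by lia.
rewrite fsum_range; have : (0 < absz q)%N by lia.
case: (absz q) => // m _.
elim: m => [|m IH]; first by rewrite big_geq.
by rewrite big_nat_recr //= IH /evenz; lia.
Qed.

(* The positive definite form (u + w) x^2 - 2w xy + (v + w) y^2 has determinant uv + vw + wu; omega3 is
   -1 exactly when both outer coefficients are even. *)
Definition omega3 (u v w : int) : int := 1 - 2 * [! evenz (u - v) && evenz (v - w)].
(** Here u, v, w are the Selling parameters of the form. The weight is written as a sum of signs so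
    that each sign can be replaced separately later on. *)
Definition selling_weight (u v w : int) : int :=
  if [&& 0 < u + v, 0 < u + w & 0 < v + w] then sg u + sg v + sg w - 1 else 0.
Definition uvw_sum (m : int) : int := fsum (fun z : int * int * int =>
  let: (u, v, w) := z in [! u * v + v * w + w * u == m] * (omega3 u v w * selling_weight u v w)).
Definition gauss_sum (m : int) : int := [! m == 0] + 2 * uvw_sum m.

Lemma selling_weight_neq0 (u v w : int) : selling_weight u v w != 0 ->
  [/\ 0 <= u, 0 <= v, 0 <= w & [&& 0 < u + v, 0 < u + w & 0 < v + w]].
Proof. by rewrite /selling_weight; case: ifP => // h; rewrite /sg => h'; split; lia. Qed.

Lemma uvw_bound (u v w m : int) : selling_weight u v w != 0 -> u * v + v * w + w * u <= m ->
  [/\ 0 < m, u <= m, v <= m & w <= m].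
Proof. by move=> /selling_weight_neq0[? ? ? /and3P[? ? ?]] ?; split; nia. Qed.

Lemma fin_uvw (m : int) : fin_supp (fun z : int * int * int =>
  let: (u, v, w) := z in [! u * v + v * w + w * u == m] * (omega3 u v w * selling_weight u v w)).
Proof.
apply: (@fin_supp3 m) => u v w; rewrite !mulf_eq0 !negb_or b2z_neq0.
move=> /and3P[/eqP e _ h]; have [? ? ? _] := selling_weight_neq0 h.
have [|? ? ? ?] := uvw_bound h (m := m); first by rewrite e.
by split; lia.
Qed.

(** * The class number relation: signed count of uv + vw + wu + k^2 = n *)

Section ClassNumberRelation.
Variable n : int.
Hypothesis n_gt0 : 0 < n.

Let wt (z : I4) : int := [! quad z == n] * parity_weight z.
Let X (F : I4 -> int) : int := fsum (fun z => wt z * F z).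
Let fin (F : I4 -> int) := fin_supp (fun z => wt z * F z).

Let wt_neq0 z : wt z != 0 -> quad z = n.
Proof. by rewrite mulf_eq0 negb_or b2z_neq0 => /andP[/eqP]. Qed.

Let fin_box (F : I4 -> int) : (forall s c y r, s * c + y * r = n -> F (s, c, y, r) != 0 ->
  [/\ `|s| <= 9 * n, `|c| <= 9 * n, `|y| <= 9 * n & `|r| <= 9 * n]) -> fin F.
Proof.
move=> h; apply: (@fin_supp4 (9 * n)) => s c y r.
by rewrite mulf_eq0 negb_or => /andP[/wt_neq0 e]; exact: h.
Qed.

Let finD F G : fin F -> fin G -> fin (fun z => F z + G z).
Proof.
move=> h1 h2; rewrite /fin; apply: fin_supp_sub (fin_suppD h1 h2) => z.
by rewrite mulrDr.
Qed.

Let finZ c F : fin F -> fin (fun z => c * F z).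
Proof.
move=> h1; rewrite /fin; apply: fin_supp_sub (fin_suppZ c h1) => z.
by rewrite mulrCA.
Qed.

Let fin_ext F G : (forall s c y r, F (s, c, y, r) = G (s, c, y, r)) -> fin F -> fin G.
Proof. by move=> h; apply: fin_supp_sub => -[[[s c] y] r]; rewrite h. Qed.

Let XD F G : fin F -> fin G -> X (fun z => F z + G z) = X F + X G.
Proof.
move=> h1 h2; rewrite /X -fsumD //.
by apply: eq_fsum => z; rewrite mulrDr.
Qed.

Let XZ e F : fin F -> X (fun z => e * F z) = e * X F.
Proof. by move=> h; rewrite /X -fsumZ //; apply: eq_fsum => z; rewrite mulrCA. Qed.

Let eqX F G : (forall s c y r, F (s, c, y, r) = G (s, c, y, r)) -> X F = X G.
Proof. by move=> h; apply: eq_fsum => -[[[s c] y] r]; rewrite h. Qed.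

Definition isom (phi psi : I4 -> I4) : Prop :=
  [/\ cancel phi psi, cancel psi phi, forall z, quad (phi z) = quad z
    & forall z, parity_weight (phi z) = parity_weight z].

Let X_isom phi psi F : isom phi psi -> X (fun z => F (phi z)) = X F.
Proof.
move=> [h1 h2 h3 h4]; apply: (@fsum_bij _ _ _ _ phi psi) => z _.
  by rewrite /wt h3 h4 h1.
by rewrite /wt -h3 -h4 !h2.
Qed.

Let fin_isom phi psi F : isom phi psi -> fin F -> fin (fun z => F (phi z)).
Proof.
move=> [h1 h2 h3 h4]; apply: (@fin_supp_bij _ _ _ _ psi phi) => z _.
by rewrite /wt h3 h4 h1.
Qed.

(* In terms of (u, v, w, k): G1 exchanges u and w and negates k, sw exchanges v and w, tau exchanges
   u and v, kap negates k, and iota_w negates w and k while fixing u + w and v + w. *)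
Definition G1 (z : I4) : I4 := let: (s, c, y, r) := z in (y, r + s, s, c - y).
Definition G2 (z : I4) : I4 := let: (s, c, y, r) := z in (r, y - s, s, c + r).
Definition G2' (z : I4) : I4 := let: (s, c, y, r) := z in (y, r - s, c + y, s).
Definition sw (z : I4) : I4 := let: (s, c, y, r) := z in (s, c, r, y).
Definition iota_w (z : I4) : I4 := let: (s, c, y, r) := z in (s + 2 * y, c, - y, 2 * c - r).
Definition kap (z : I4) : I4 := let: (s, c, y, r) := z in (s - c + y + r, c, c - r, c - y).
Definition tau (z : I4) : I4 := let: (s, c, y, r) := z in (c - y, s + y, y, s - c + y + r).
Definition chi (z : I4) : I4 := let: (s, c, y, r) := z in (- y, - s - r, s, c - y).
Definition chi' (z : I4) : I4 := let: (s, c, y, r) := z in (y, r - s, - s, - c - y).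
Definition mu (z : I4) : I4 := let: (s, c, y, r) := z in (r, s + y, - s, r - c).
Definition mu' (z : I4) : I4 := let: (s, c, y, r) := z in (- y, s - r, c + y, s).

Ltac isom_tac :=
  split=> -[[[s c] y] r] /=; rewrite ?/evenz;
    solve [reflexivity | congr (_, _, _, _); lia | lia].

Let isomG1 : isom G1 G1. Proof. isom_tac. Qed.
Let isomG2 : isom G2 G2'. Proof. isom_tac. Qed.
Let isom_sw : isom sw sw. Proof. isom_tac. Qed.
Let isom_iota : isom iota_w iota_w. Proof. isom_tac. Qed.
Let isom_kap : isom kap kap. Proof. isom_tac. Qed.
Let isom_tau : isom tau tau. Proof. isom_tac. Qed.
Let isom_chi : isom chi chi'. Proof. isom_tac. Qed.
Let isom_mu : isom mu mu'. Proof. isom_tac. Qed.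

(* P3 says that u + w, v + w and u + v are positive.  Then at most one of u, v, w is <= 0, so hh is 2
   in the open octant, 1 on its faces and 0 elsewhere. *)
Let P3 (z : I4) : bool := let: (s, c, y, r) := z in [&& 0 < s + y, 0 < c & 0 < s + r].
Let hh (z : I4) : int := let: (s, c, y, r) := z in
  if P3 z then sg (2 * s + y - c + r) + sg (c + r - y) + sg (c + y - r) - 1 else 0.
(* The signs of w, u, v are replaced by those of y = w - k, s = u + k and c - y = v + k: the
   difference has finite support and is odd under iota_w up to a permutation of u, v, w.  The
   lexicographic tie-breaking of lsg is needed for this finiteness. *)
Let ew (z : I4) : int := let: (s, c, y, r) := z in sg (c + y - r) - lsg y (c - r).
Let eu (z : I4) : int := let: (s, c, y, r) := z in sg (2 * s + y - c + r) - lsg s (y - c + r).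
Let e_v (z : I4) : int := let: (s, c, y, r) := z in sg (c + r - y) - lsg (c - y) r.
Let gu (z : I4) : int := let: (s, c, y, r) := z in lsg s (y - c + r).
Let gv (z : I4) : int := let: (s, c, y, r) := z in lsg (c - y) r.
Let P3ew (z : I4) : int := if P3 z then ew z else 0.
Let P3eu (z : I4) : int := if P3 z then eu z else 0.
Let P3ev (z : I4) : int := if P3 z then e_v z else 0.
Let acew (z : I4) : int := let: (s, c, y, r) := z in
  if (0 < s + y) && (0 < c) then ew z else 0.
Let Cf (z : I4) : int := let: (s, c, y, r) := z in [! [&& 0 < s + y, 0 < c, s + r <= 0 & y < 0]].
Let Cq (z : I4) : int := let: (s, c, y, r) := z in [! [&& 0 < s, s < y, s < r & 0 <= c]].
Let Jt (z : I4) : int := let: (s, c, y, r) := z in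
  if P3 z then lsg y (c - r) + gu z + gv z - 1 else 0.

Ltac pw := repeat match goal with |- context [if ?b then _ else _] => case: (boolP b) => ? end;
  rewrite ?/sg ?/lsg; lia.

Let fin_sub F G : (forall s c y r, F (s, c, y, r) != 0 -> G (s, c, y, r) != 0) -> fin G -> fin F.
Proof.
move=> h; apply: fin_supp_sub => -[[[s c] y] r]; rewrite !mulf_eq0 !negb_or.
by move=> /andP[-> /h ->].
Qed.

Let fin_acew : fin acew.
Proof.
apply: fin_box => s c y r e; rewrite /acew.
case: ifP => // /andP[ha hc] h.
(* Where [ew] is nonzero, y and r - c are nonzero of the same sign, so both summands are positive
   and bounded by n. *)
have e1 : (s + y) * c + y * (r - c) = n by lia.
have hyr : (0 < y) && (c < r) || (y < 0) && (r < c) by move: h; rewrite /= /sg /lsg; lia.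
have [h1 h2] : s + y <= n /\ c <= n by nia.
have [h3 h4] : `|y| <= n /\ `|r - c| <= n by nia.
by split; lia.
Qed.

Let fin_hh : fin hh.
Proof.
apply: fin_box => s c y r e; rewrite /hh.
case: ifP => // /= /and3P[h1 h2 h3] h.
have bd (u v w k N : int) : 0 <= u -> 0 <= v -> 0 <= w -> 0 < u + v -> 0 < u + w -> 0 < v + w ->
    u * v + v * w + w * u + k ^+ 2 = N -> [/\ u <= N, v <= N, w <= N & `|k| <= N].
  by move=> *; split; nia.
(* The four linear forms are 2u, 2v, 2w and 2k. *)
have e4 : (2 * s + y - c + r) * (c + r - y) + (c + r - y) * (c + y - r) +
  (c + y - r) * (2 * s + y - c + r) + (c - y - r) ^+ 2 = 4 * n by rewrite -e; ring.
have := bd _ _ _ _ _ _ _ _ _ _ _ e4.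
have -> : 0 <= 2 * s + y - c + r by move: h; rewrite /sg; lia.
have -> : 0 <= c + r - y by move: h; rewrite /sg; lia.
have -> : 0 <= c + y - r by move: h; rewrite /sg; lia.
have -> : 0 < 2 * s + y - c + r + (c + r - y) by lia.
have -> : 0 < 2 * s + y - c + r + (c + y - r) by lia.
have -> : 0 < c + r - y + (c + y - r) by lia.
by move=> [] // *; split; lia.
Qed.

(** Permutations of u, v, w carry the three sign errors to each other, so only the error in w has to
    be summed. *)
Let X_P3eu : X P3eu = X P3ew.
Proof. by rewrite -(X_isom P3ew isomG1); apply: eqX => s c y r; rewrite /P3eu /P3ew /=; pw. Qed.

Let X_P3ev : X P3ev = X P3ew.
Proof.
rewrite -(X_isom P3ew isom_sw) -(X_isom (fun z => P3ew (sw z)) isom_kap).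
by apply: eqX => s c y r; rewrite /P3ev /P3ew /=; pw.
Qed.

(** Without the condition u + v > 0 the domain is stable under [iota_w], which negates [ew]. *)
Let X_acew : X acew = 0.
Proof.
have : X acew = X (fun z => -1 * acew z).
  rewrite -(X_isom acew isom_iota).
  by apply: eqX => s c y r; rewrite /acew /=; pw.
by rewrite XZ; [lia|exact: fin_acew].
Qed.

Let X_Cf : X Cf = X Cq.
Proof. by rewrite -(X_isom Cq isom_chi); apply: eqX => s c y r; rewrite /Cf /Cq /=; lia. Qed.

Let fin_P3ew : fin P3ew.
Proof.
apply: fin_sub fin_acew => s c y r; rewrite /P3ew /acew /=.
by case: ifP => // /and3P[-> ->].
Qed.

Let fin_Cf : fin Cf.
Proof.
apply: fin_sub fin_acew => s c y r; rewrite /Cf /acew /ew; pw.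
Qed.

Let fin_Cq : fin Cq.
Proof.
by apply: fin_box => s c y r e; rewrite b2z_neq0 => /and4P[? ? ? ?]; split; nia.
Qed.

Let fin_P3eu : fin P3eu.
Proof.
apply: fin_ext (fin_isom isomG1 fin_P3ew) => s c y r; rewrite /P3eu /P3ew /=; pw.
Qed.

Let fin_P3ev : fin P3ev.
Proof.
apply: fin_ext (fin_isom isom_kap (fin_isom isom_sw fin_P3ew)) => s c y r.
rewrite /P3ev /P3ew /=; pw.
Qed.

(** The points lost by imposing u + v > 0 on [acew] are those with s + r <= 0. There [ew] is 2 when
    y < 0 and 0 otherwise, so the defect is twice the wedge [Cf]. *)
Let X_P3ew : X P3ew = -2 * X Cq.
Proof.
have : X acew = X (fun z => P3ew z + 2 * Cf z).
  by apply: eqX => s c y r; rewrite /acew /P3ew /Cf /=; pw.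
rewrite XD ?XZ //; last exact: finZ.
rewrite X_acew X_Cf; lia.
Qed.

Let fin_Jt : fin Jt.
Proof.
apply: (fin_ext _ (finD fin_hh (finD (finZ (-1) fin_P3ew)
  (finD (finZ (-1) fin_P3eu) (finZ (-1) fin_P3ev))))) => s c y r.
by rewrite /hh /P3ew /P3eu /P3ev /Jt /=; case: ifP => _; ring.
Qed.

Let X_hh : X hh = X Jt - 6 * X Cq.
Proof.
have : X hh = X (fun z => Jt z + (P3ew z + (P3eu z + P3ev z))).
  apply: eqX => s c y r; rewrite /hh /P3ew /P3eu /P3ev /Jt /=; case: ifP => _; ring.
rewrite !XD //; try by do ?apply: finD.
rewrite X_P3eu X_P3ev X_P3ew; lia.
Qed.

(** * Splitting the modified weight by the signs of y and r - c *)

Let J0 (z : I4) : int := let: (s, c, y, r) := z in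
  if (y == 0) && P3 z then 1 + sg (c - r) else 0.
Let J10 (z : I4) : int := let: (s, c, y, r) := z in
  if [&& 0 < y, r == c & P3 z] then gu z else 0.
Let Jm (z : I4) : int := let: (s, c, y, r) := z in
  if [&& 0 < y, c < r & P3 z] then gu z else 0.
Let Jp (z : I4) : int := let: (s, c, y, r) := z in
  if [&& 0 < y, r < c & P3 z] then gu z + gv z else 0.
Let A1 (z : I4) : int := let: (s, c, y, r) := z in [! [&& 0 <= s, 0 < c, 0 < y & c < r]].
Let A2 (z : I4) : int := let: (s, c, y, r) := z in [! [&& 0 < s, 0 < c, 0 < y, 0 < r & r < s]].
Let Da (z : I4) : int := let: (s, c, y, r) := z in
  [! [&& 0 < y, r < c, P3 z, 0 <= s, c <= s + y + r & (y < c) || (0 < r)]].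
Let P1 (z : I4) : int := let: (s, c, y, r) := z in
  [! [&& 0 < y, 0 < r, r < c, 0 <= s & c <= s + y + r]].
Let P2 (z : I4) : int := let: (s, c, y, r) := z in
  [! [&& 0 < y, 0 < r, r < c, y < c, 0 <= s & c <= s + y + r]].

Let fin_J10 : fin J10.
Proof.
apply: fin_box => s c y r e; rewrite /J10 /=.
case: ifP => // /and5P[hy /eqP hr h1 h2 h3] _; subst r.
have e1 : (s + y) * c = n by rewrite -e; ring.
have [? ?] : s + y <= n /\ c <= n by nia.
by split; lia.
Qed.

Let fin_Jm : fin Jm.
Proof.
apply: fin_box => s c y r e; rewrite /Jm /=.
case: ifP => // /and5P[hy hr h1 h2 h3] _.
have e1 : (s + y) * c + y * (r - c) = n by rewrite -e; ring.
have [? ?] : s + y <= n /\ c <= n by nia.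
have [? ?] : y <= n /\ r - c <= n by nia.
by split; lia.
Qed.

Let fin_A1 : fin A1.
Proof. by apply: fin_box => s c y r e; rewrite /A1 b2z_neq0 => /and4P[? ? ? ?]; split; nia. Qed.

Let fin_A2 : fin A2.
Proof. by apply: fin_box => s c y r e; rewrite /A2 b2z_neq0 => /and5P[? ? ? ? ?]; split; nia. Qed.

Let fin_P1 : fin P1.
Proof.
apply: fin_box => s c y r e; rewrite /P1 b2z_neq0 => /and5P[? ? ? ? ?].
have [? ?] : y <= n /\ r <= n by nia.
have ? : s <= n by nia.
by split; lia.
Qed.

Let fin_P2 : fin P2.
Proof. by apply: fin_sub fin_P1 => s c y r; rewrite !b2z_neq0; lia. Qed.

Let fin_Da : fin Da.
Proof.
apply: (fin_ext _ (finD fin_P1 (finD (fin_isom isom_kap fin_P1) (finZ (-1) fin_P2)))) => s c y r.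
by rewrite /Da /P1 /P2 /=; lia.
Qed.

Let fin_J0 : fin J0.
Proof.
apply: fin_box => s c y r e; rewrite /J0 /=.
case: ifP => // /and4P[/eqP hy h1 h2 h3]; subst y; rewrite /sg => h.
have [? ?] : s <= n /\ c <= n by nia.
by split; lia.
Qed.

(** On this region [gu] is 1 for s >= 0 and -1 for s < 0. The isometry [mu] carries the part s < 0
    into [A2], but without the condition s + r > 0; the points with s + r <= 0 are given back by
    [Cf] composed with [kap]. *)
Let X_Jm : X Jm = X A1 - X A2 + X Cq.
Proof.
have -> : X Jm = X (fun z => A1 z + (-1 * A2 (mu z) + Cf (kap z))).
  by apply: eqX => s c y r; rewrite /Jm /A1 /A2 /Cf /=; pw.
rewrite XD //; last first.
  by apply: finD; [apply: finZ; exact: (fin_isom isom_mu)|exact: (fin_isom isom_kap)].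
rewrite XD; [|apply: finZ; exact: (fin_isom isom_mu)|exact: (fin_isom isom_kap)].
rewrite XZ; last exact: (fin_isom isom_mu).
by rewrite (X_isom _ isom_mu) (X_isom _ isom_kap) X_Cf; lia.
Qed.

(** Inclusion and exclusion for the alternatives 0 < r and y < c, which [kap] exchanges. *)
Let X_Da : X Da = 2 * X P1 - X P2.
Proof.
have -> : X Da = X (fun z => P1 z + (P1 (kap z) + -1 * P2 z)).
  by apply: eqX => s c y r; rewrite /Da /P1 /P2 /=; lia.
have f1 := fin_isom isom_kap fin_P1; have f2 := finZ (-1) fin_P2.
by rewrite !XD ?XZ ?(X_isom _ isom_kap) //; [lia|exact: finD].
Qed.

Let Jtau (F : I4 -> int) : fin F -> X (fun z => F z + F (tau z)) = 2 * X F.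
Proof.
move=> f; have g := fin_isom isom_tau f.
by rewrite XD // (X_isom _ isom_tau); lia.
Qed.

Let fin_addtau F : fin F -> fin (fun z => F z + F (tau z)).
Proof. by move=> f; apply: finD => //; exact: (fin_isom isom_tau). Qed.

(** For y < 0 the domain forces s > 0 and c - y > 0, and the signs cancel. For y > 0 the weight is
    [gu] + [gv], and [tau] turns [gu] into [gv]. The two halves may be separated when c <= r, but
    are kept together in [Jp] when r < c, where a half alone need not have finite support. *)
Let Jt_split s c y r : let z := (s, c, y, r) in
  Jt z = J0 z + ((J10 z + J10 (tau z)) + ((Jm z + Jm (tau z)) + Jp z)).
Proof.
rewrite /Jt /J0 /J10 /Jm /Jp /=.
have -> : 0 < c - y + y = (0 < c) by lia.
have -> : 0 < c - y + (s - c + y + r) = (0 < s + r) by lia.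
case: (boolP (0 < s + y)) => h1; last by rewrite !andbF.
case: (boolP (0 < c)) => h2; last by rewrite !andbF.
case: (boolP (0 < s + r)) => h3; last by rewrite !andbF.
have -> : (s - c + y + r == s + y) = (r == c) by lia.
have -> : (s + y < s - c + y + r) = (c < r) by lia.
rewrite !andbT.
by case: (ltrgtP y 0) => hy; case: (ltrgtP r c) => hr /=; rewrite /sg /lsg; lia.
Qed.

(** Finiteness is inherited from [Jt] by subtracting the other pieces. *)
Let fin_Jp : fin Jp.
Proof.
apply: (fin_ext _ (finD fin_Jt (finD (finZ (-1) fin_J0) (finD (finZ (-1) (fin_addtau fin_J10))
  (finZ (-1) (fin_addtau fin_Jm)))))) => s c y r.
by rewrite Jt_split; ring.
Qed.

(** Averaging over k -> -k brings in the signs of all of u + k, u - k, v + k, v - k. As u + v > 0,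
    [lsg_pair_count] turns them into counts of closed cones. *)
Let Jp_kap s c y r : let z := (s, c, y, r) in Jp z + Jp (kap z) = 2 * (Da z + Da (tau z)).
Proof.
rewrite /Jp /Da /=.
rewrite (_ : 0 < c - r = (r < c)); last by lia.
rewrite (_ : c - y < c = (0 < y)); last by lia.
rewrite (_ : 0 < s - c + y + r + (c - r) = (0 < s + y)); last by lia.
rewrite (_ : 0 < s - c + y + r + (c - y) = (0 < s + r)); last by lia.
rewrite (_ : s - c + y + r < s + y = (r < c)); last by lia.
rewrite (_ : 0 < c - y + y = (0 < c)); last by lia.
rewrite (_ : 0 < c - y + (s - c + y + r) = (0 < s + r)); last by lia.
case: (boolP (0 < y)) => h1; last by rewrite !andbF.
case: (boolP (r < c)) => h2; last by [].
case: (boolP (0 < s + y)) => h3; last by rewrite !andbF.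
case: (boolP (0 < c)) => h4; last by [].
case: (boolP (0 < s + r)) => h5; last by [].
rewrite !andTb.
pose b := s - c + y + r.
have -> : lsg s (y - c + r) = lsg s (b - s) by congr lsg; rewrite /b; ring.
have -> : lsg (s - c + y + r) (c - r - c + (c - y)) = lsg b (s - b) by congr lsg; rewrite /b; ring.
have -> : lsg (c - (c - r)) (c - y) = lsg r (c - y) by congr lsg; ring.
rewrite addrACA lsg_pair_sub lsg_pair -mulrDr (@lsg_pair_count s b (c - y) r) //; last by rewrite /b; ring.
congr (2 * ([! _] + [! _])); rewrite /b; lia.
Qed.

Let X_Jp : X Jp = 2 * X Da.
Proof.
have f1 := fin_isom isom_kap fin_Jp.
have f2 : fin (fun z => Da z + Da (tau z)).
  by apply: finD => //; exact: (fin_isom isom_tau).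
have : X (fun z => Jp z + Jp (kap z)) = X (fun z => 2 * (Da z + Da (tau z))).
  by apply: eqX => s c y r; exact: Jp_kap.
rewrite XD // (X_isom _ isom_kap) XZ // Jtau //; lia.
Qed.

Let X_Jt : X Jt = X J0 + 2 * X J10 + 2 * X Jm + X Jp.
Proof.
have -> : X Jt = X (fun z => J0 z + ((J10 z + J10 (tau z)) + ((Jm z + Jm (tau z)) + Jp z))).
  by apply: eqX => s c y r; exact: Jt_split.
have f1 := fin_addtau fin_J10; have f2 := fin_addtau fin_Jm.
have f3 := finD f2 fin_Jp; have f4 := finD f1 f3.
rewrite (XD fin_J0 f4) (XD f1 f3) (XD f2 fin_Jp) !Jtau //; lia.
Qed.

Let X_hh_A : X hh = X J0 + 2 * X J10 + 2 * (X A1 - X A2 - 2 * X Cq + 2 * X P1 - X P2).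
Proof. rewrite X_hh X_Jt X_Jp X_Da X_Jm; lia. Qed.

(** * Cancellation in the open octant s, c, y, r > 0 *)

Let pos (z : I4) : bool := let: (s, c, y, r) := z in [&& 0 < s, 0 < c, 0 < y & 0 < r].
Let B (p : int -> int -> int -> int -> bool) (z : I4) : int :=
  let: (s, c, y, r) := z in [! pos z && p s c y r].

Let fin_B p : fin (B p).
Proof.
apply: fin_box => s c y r e; rewrite b2z_neq0 => /andP[/and4P[? ? ? ?] _].
by split; nia.
Qed.

Let X_B1 : X (B (fun s c y r => (r < c) && (c <= s + y + r))) =
           X (B (fun s c y r => (y < c) && (r <= c))).
Proof.
rewrite -(X_isom _ isom_sw) -[RHS](X_isom _ isomG1).
by apply: eqX => s c y r; rewrite /B /=; lia.
Qed.

Let X_B2 : X (B (fun s c y r => s + y + r < c)) = X (B (fun s c y r => (y < c) && (c < r))).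
Proof. by rewrite -[RHS](X_isom _ isomG1); apply: eqX => s c y r; rewrite /B /=; lia. Qed.

Let X_B3 : X (B (fun s c y r => (s < y) && (s < r))) = X (B (fun s c y r => (y < s) && (s < r))).
Proof. by rewrite -[RHS](X_isom _ isomG2); apply: eqX => s c y r; rewrite /B /=; lia. Qed.

(** The form becomes a product on each of these faces: n = yr where s = 0 or c = 0, n = s(c + r)
    where s = y, and n = c(s + r) where c = y. *)
Let A1z (z : I4) : bool := let: (s, c, y, r) := z in [&& s == 0, 0 < c, 0 < y & c < r].
Let P1z (z : I4) : bool := let: (s, c, y, r) := z in
  [&& s == 0, 0 < y, 0 < r, r < c & c <= y + r].
Let P2z (z : I4) : bool := let: (s, c, y, r) := z in
  [&& s == 0, 0 < y, 0 < r, r < c, y < c & c <= y + r].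
Let Cz (z : I4) : bool := let: (s, c, y, r) := z in [&& c == 0, 0 < s, s < y & s < r].
Let E1 (z : I4) : bool := let: (s, c, y, r) := z in pos z && (s == y).
Let E2 (z : I4) : bool := let: (s, c, y, r) := z in [&& pos z, s == y & y < r].
Let E3 (z : I4) : bool := let: (s, c, y, r) := z in [&& pos z, c == y & y <= r].
Let Xb (b : I4 -> bool) : int := X (fun z => [! b z]).
Let finb (b : I4 -> bool) := fin (fun z => [! b z]).

Let fin_A1z : finb A1z.
Proof. by apply: fin_sub fin_A1 => s c y r; rewrite /A1z /A1 !b2z_neq0; lia. Qed.
Let fin_P1z : finb P1z.
Proof. by apply: fin_sub fin_P1 => s c y r; rewrite /P1z /P1 !b2z_neq0; lia. Qed.
Let fin_P2z : finb P2z.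
Proof. by apply: fin_sub fin_P2 => s c y r; rewrite /P2z /P2 !b2z_neq0; lia. Qed.
Let fin_Cz : finb Cz.
Proof. by apply: fin_sub fin_Cq => s c y r; rewrite /Cz /Cq !b2z_neq0; lia. Qed.
Let fin_E1 : finb E1.
Proof. exact: (fin_ext _ (fin_B (fun s c y r => s == y))). Qed.
Let fin_E2 : finb E2.
Proof. exact: (fin_ext _ (fin_B (fun s c y r => (s == y) && (y < r)))). Qed.
Let fin_E3 : finb E3.
Proof. exact: (fin_ext _ (fin_B (fun s c y r => (c == y) && (y <= r)))). Qed.

Let X_sum F G H : fin F -> fin G -> (forall s c y r, let z := (s, c, y, r) in H z = F z + G z) ->
  X H = X F + X G.
Proof. by move=> f g h; rewrite -XD //; apply: eqX. Qed.

(** If a weight and its mirror image under y <-> r together cover the octant twice, its sum is that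
    of the octant. *)
Let X_half F : fin F ->
  (forall s c y r, let z := (s, c, y, r) in F z + F (sw z) = 2 * B (fun _ _ _ _ => true) z) ->
  X F = X (B (fun _ _ _ _ => true)).
Proof.
move=> f h; have : X (fun z => F z + F (sw z)) = X (fun z => 2 * B (fun _ _ _ _ => true) z).
  by exact: eqX.
rewrite XD ?(X_isom _ isom_sw) //; last exact: (fin_isom isom_sw).
rewrite XZ; last exact: fin_B.
by move: (X F) (X _) => x y; lia.
Qed.

Let sym_pos (s c y r : int) : [&& 0 < s, 0 < c, 0 < r & 0 < y] = [&& 0 < s, 0 < c, 0 < y & 0 < r].
Proof. by rewrite [(0 < r) && _]andbC. Qed.

(** Up to the mirror y <-> r this depends only on how c compares with y and r, and every case adds
    up to 2. [X_cut'] does the same with s in place of c. *)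
Let X_cut : X (B (fun s c y r => c < r)) + 2 * X (B (fun s c y r => (y < c) && (r <= c))) +
    X (B (fun s c y r => (y < c) && (c < r))) + X (B (fun s c y r => (c == y) && (y <= r))) -
    X (B (fun s c y r => (r < c) && (y < c))) = X (B (fun _ _ _ _ => true)).
Proof.
pose b1 := B (fun s c y r => c < r).
pose b2 := B (fun s c y r => (y < c) && (r <= c)).
pose b3 := B (fun s c y r => (y < c) && (c < r)).
pose b4 := B (fun s c y r => (c == y) && (y <= r)).
pose b5 := B (fun s c y r => (r < c) && (y < c)).
have f5 : fin (fun z => -1 * b5 z) by apply: finZ; exact: fin_B.
have f4 := finD (fin_B (fun s c y r => (c == y) && (y <= r))) f5.
have f3 := finD (fin_B (fun s c y r => (y < c) && (c < r))) f4.
have f2 := finD (finZ 2 (fin_B (fun s c y r => (y < c) && (r <= c)))) f3.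
have f1 := finD (fin_B (fun s c y r => c < r)) f2.
rewrite -(X_half f1); last first.
  move=> s c y r; rewrite /b5 /B /= sym_pos; case: [&& _, _, _ & _] => //=.
  by case: (ltrgtP c y) => ?; case: (ltrgtP c r) => ? //=; lia.
rewrite (XD (fin_B _) f2) (XD (finZ 2 (fin_B _)) f3) (XD (fin_B _) f4) (XD (fin_B _) f5).
rewrite (XZ 2 (fin_B _)) (XZ (-1) (fin_B _)) mulN1r.
by rewrite !addrA.
Qed.

Let X_cut' : X (B (fun s c y r => r < s)) + X (B (fun s c y r => (s < y) && (s < r))) +
    X (B (fun s c y r => (y < s) && (s < r))) + X (B (fun s c y r => s == y)) +
    X (B (fun s c y r => (s == y) && (y < r))) = X (B (fun _ _ _ _ => true)).
Proof.
have f4 := finD (fin_B (fun s c y r => s == y)) (fin_B (fun s c y r => (s == y) && (y < r))).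
have f3 := finD (fin_B (fun s c y r => (y < s) && (s < r))) f4.
have f2 := finD (fin_B (fun s c y r => (s < y) && (s < r))) f3.
have f1 := finD (fin_B (fun s c y r => r < s)) f2.
rewrite -(X_half f1); last first.
  move=> s c y r; rewrite /B /= sym_pos; case: [&& _, _, _ & _] => //=.
  by case: (ltrgtP s y) => ?; case: (ltrgtP s r) => ? //=; lia.
rewrite (XD (fin_B _) f2) (XD (fin_B _) f3) (XD (fin_B _) f4) (XD (fin_B _) (fin_B _)).
by rewrite !addrA.
Qed.

Let X_A1_split : X A1 = Xb A1z + X (B (fun s c y r => c < r)).
Proof. by apply: X_sum => // s c y r; rewrite /A1 /A1z /B /=; lia. Qed.

Let X_A2_split : X A2 = X (B (fun s c y r => r < s)).
Proof. by apply: eqX => s c y r; rewrite /A2 /B /=; lia. Qed.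

Let X_Cq_split : X Cq = Xb Cz + X (B (fun s c y r => (s < y) && (s < r))).
Proof. by apply: X_sum => // s c y r; rewrite /Cq /Cz /B /=; lia. Qed.

Let X_P1_split : X P1 = Xb P1z + X (B (fun s c y r => (r < c) && (c <= s + y + r))).
Proof. by apply: X_sum => // s c y r; rewrite /P1 /P1z /B /=; lia. Qed.

Let X_P2_split : X P2 = Xb P2z + X (B (fun s c y r => [&& r < c, y < c & c <= s + y + r])).
Proof. by apply: X_sum => // s c y r; rewrite /P2 /P2z /B /=; lia. Qed.

Let X_B_split : X (B (fun s c y r => (r < c) && (y < c))) =
    X (B (fun s c y r => [&& r < c, y < c & c <= s + y + r])) + X (B (fun s c y r => s + y + r < c)).
Proof. by apply: X_sum => // s c y r; rewrite /B /=; lia. Qed.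

(** Both cuts equal the sum over the whole octant. In their difference the full regions match those
    on the left, after [X_B1], [X_B2] and [X_B3], so only faces survive. *)
Let X_interior : X A1 - X A2 - 2 * X Cq + 2 * X P1 - X P2 =
  Xb A1z - 2 * Xb Cz + 2 * Xb P1z - Xb P2z + (Xb E1 + Xb E2 - Xb E3).
Proof.
have f1 : Xb E1 = X (B (fun s c y r => s == y)) by apply: eqX.
have f2 : Xb E2 = X (B (fun s c y r => (s == y) && (y < r))) by apply: eqX.
have f3 : Xb E3 = X (B (fun s c y r => (c == y) && (y <= r))) by apply: eqX.
have := X_cut; rewrite -X_cut' X_B_split X_B2 -X_B3.
rewrite X_A1_split X_A2_split X_Cq_split X_P1_split X_P2_split X_B1 f1 f2 f3.
move: (X (B _)) (X (B _)) (X (B _)) (X (B _)) (X (B _)) (X (B _)) (X (B _)) (X (B _)).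
move: (Xb A1z) (Xb Cz) (Xb P1z) (Xb P2z) => a1 a2 a3 a4.
by move=> b1 b2 b3 b4 b5 b6 b7 b8; lia.
Qed.

(** * Face contributions as sums over factorizations n = pq *)

Let Y (F : int -> int -> int) : int :=
  fsum (fun z : int * int => [! [&& 0 < z.1, 0 < z.2 & z.1 * z.2 == n]] * F z.1 z.2).

Let finY F : fin_supp (fun z : int * int => [! [&& 0 < z.1, 0 < z.2 & z.1 * z.2 == n]] * F z.1 z.2).
Proof.
apply: (@fin_supp2 n) => p q; rewrite mulf_eq0 negb_or b2z_neq0 /=.
by move=> /andP[/and3P[? ? /eqP ?] _]; nia.
Qed.

Let YD F G : Y (fun p q => F p q + G p q) = Y F + Y G.
Proof.
rewrite /Y -fsumD; [|exact: finY|exact: finY].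
by apply: eq_fsum => z; rewrite mulrDr.
Qed.

Let YZ e F : Y (fun p q => e * F p q) = e * Y F.
Proof. by rewrite /Y -fsumZ; [apply: eq_fsum => z; ring|exact: finY]. Qed.

Let eqY F G : (forall p q, 0 < p -> 0 < q -> p * q = n -> F p q = G p q) -> Y F = Y G.
Proof.
move=> h; apply: eq_fsum => -[p q] /=.
by case: (boolP [&& _, _ & _]) => [/and3P[h1 h2 /eqP h3]|_]; rewrite ?mul0r // h.
Qed.

(** A face is fibred over the factorizations n = pq, with one free parameter i. Only points with c +
    y + r even need a preimage, since [parity_weight] vanishes at the others. *)
Let X_fiber (b : I4 -> bool) (G : int -> int -> int -> bool) (w : int -> int -> int -> int)
    (phi : int -> int -> int -> int -> int * int * int) (psi : int -> int -> int -> I4) :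
  finb b ->
  (forall s c y r, s * c + y * r = n -> evenz (c + y + r) -> b (s, c, y, r) ->
     let: (p, q, i) := phi s c y r in
     [/\ 0 < p, 0 < q, p * q = n, G p q i & psi p q i = (s, c, y, r)]) ->
  (forall p q i, 0 < p -> 0 < q -> p * q = n -> G p q i ->
     let: (s, c, y, r) := psi p q i in
     [/\ s * c + y * r = n, b (s, c, y, r), parity_weight (s, c, y, r) = w p q i
       & phi s c y r = (p, q, i)]) ->
  Xb b = Y (fun p q => fsum (fun i => [! G p q i] * w p q i)).
Proof.
move=> fb h1 h2.
pose g (t : int * int * int) : int :=
  [! [&& 0 < t.1.1, 0 < t.1.2 & t.1.1 * t.1.2 == n]] * ([! G t.1.1 t.1.2 t.2] * w t.1.1 t.1.2 t.2).
pose phi' (z : I4) := let: (s, c, y, r) := z in phi s c y r.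
pose psi' (t : int * int * int) := psi t.1.1 t.1.2 t.2.
have H1 z : wt z * [! b z] != 0 -> g (phi' z) = wt z * [! b z] /\ psi' (phi' z) = z.
  case: z => [[[s c] y] r]; rewrite !mulf_eq0 !negb_or !b2z_neq0 => /andP[/andP[/eqP e t0] hb].
  have hev : evenz (c + y + r) by apply: contraNT t0; rewrite /parity_weight => /negbTE->.
  have := h1 _ _ _ _ e hev hb; rewrite /phi' /psi' /g.
  case: (phi s c y r) => [[p q] i] [hp hq hn hG hpsi] /=.
  have := h2 _ _ _ hp hq hn hG; rewrite hpsi => -[e2 _ ew' _]; split=> //.
  by rewrite hp hq hn hG eqxx -ew' /wt hb e eqxx !mul1r mulr1.
have H2 t : g t != 0 -> wt (psi' t) * [! b (psi' t)] = g t /\ phi' (psi' t) = t.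
  case: t => [[p q] i]; rewrite /g /= !mulf_eq0 !negb_or !b2z_neq0.
  move=> /and3P[/and3P[hp hq /eqP hn] hG _].
  have := h2 _ _ _ hp hq hn hG; rewrite /psi' /=.
  case: (psi p q i) => [[[s c] y] r] [e hb ew' hphi]; split=> //.
  by rewrite hp hq hn hG eqxx /wt /quad /parity_weight e eqxx hb ew' !mul1r mulr1.
rewrite /Xb /X (fsum_bij H1 H2) fsum_pair; last exact: (fin_supp_bij H2 fb).
apply: eq_fsum => -[p q]; rewrite /g /=.
case: [&& _, _ & _]; first by rewrite mul1r; apply: eq_fsum => i; rewrite mul1r.
by rewrite mul0r -[RHS](@fsum0 int); apply: eq_fsum => i; rewrite mul0r.
Qed.

(** The case where the weight is constant along the fibre and the fibre is the set of even numbers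
    of an interval. *)
Let X_fiber2 (b : I4 -> bool) (lo hi : int -> int -> int)
    (phi : int -> int -> int -> int -> int * int * int) (psi : int -> int -> int -> I4) :
  finb b ->
  (forall p q, 0 < p -> 0 < q -> lo p q <= hi p q) ->
  (forall s c y r, s * c + y * r = n -> evenz (c + y + r) -> b (s, c, y, r) ->
     let: (p, q, i) := phi s c y r in
     [/\ 0 < p, 0 < q, p * q = n, lo p q <= 2 * i < hi p q & psi p q i = (s, c, y, r)]) ->
  (forall p q i, 0 < p -> 0 < q -> p * q = n -> lo p q <= 2 * i < hi p q ->
     let: (s, c, y, r) := psi p q i in
     [/\ s * c + y * r = n, b (s, c, y, r), parity_weight (s, c, y, r) = omega2 p q
       & phi s c y r = (p, q, i)]) ->
  Xb b = Y (fun p q => omega2 p q * (((hi p q + 1) %/ 2)%Z - ((lo p q + 1) %/ 2)%Z)).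
Proof.
move=> fb hl h1 h2; rewrite (X_fiber fb h1 h2); apply: eqY => p q hp hq _.
rewrite -fsum_count2 ?hl // -fsumZ; first by apply: eq_fsum => i; rewrite mulrC.
apply: (@fin_supp1 (`|lo p q| + `|hi p q|)) => i; rewrite b2z_neq0; lia.
Qed.

Let X_A1z : Xb A1z =
  Y (fun p q => omega2 p q * (((p + q + 1) %/ 2)%Z - ((p + 1 + 1) %/ 2)%Z)).
Proof.
apply: (@X_fiber2 A1z (fun p q => p + 1) (fun p q => p + q)
  (fun s c y r => (y, r, ((y + r - c) %/ 2)%Z)) (fun p q j => (0, p + q - 2 * j, p, q))) => //.
- by move=> p q; lia.
- move=> s c y r e h /and4P[/eqP hs hc hy hr]; subst s; move: h; rewrite /evenz => h.
  by split; [| | | |congr (_, _, _, _)]; lia.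
- move=> p q j hp hq hn hj; split; [lia|rewrite /A1z; lia|rewrite /parity_weight /omega2 /evenz; lia|congr (_, _, _); lia].
Qed.

Let X_P1z : Xb P1z = Y (fun p q => omega2 p q * (((p + 1) %/ 2)%Z - ((0 + 1) %/ 2)%Z)).
Proof.
apply: (@X_fiber2 P1z (fun p q => 0) (fun p q => p)
  (fun s c y r => (y, r, ((y + r - c) %/ 2)%Z)) (fun p q j => (0, p + q - 2 * j, p, q))) => //.
- by move=> p q; lia.
- move=> s c y r e h /and5P[/eqP hs hc hy hr hd]; subst s; move: h; rewrite /evenz => h.
  by split; [| | | |congr (_, _, _, _)]; lia.
- move=> p q j hp hq hn hj; split; [lia|rewrite /P1z; lia|rewrite /parity_weight /omega2 /evenz; lia|congr (_, _, _); lia].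
Qed.

Let X_P2z : Xb P2z =
  Y (fun p q => omega2 p q * (((Num.min p q + 1) %/ 2)%Z - ((0 + 1) %/ 2)%Z)).
Proof.
apply: (@X_fiber2 P2z (fun p q => 0) (fun p q => Num.min p q)
  (fun s c y r => (y, r, ((y + r - c) %/ 2)%Z)) (fun p q j => (0, p + q - 2 * j, p, q))) => //.
- by move=> p q; lia.
- move=> s c y r e h /and5P[/eqP hs hc hy hr hd]; subst s; move: h; rewrite /evenz => h.
  by split; [| | | |congr (_, _, _, _)]; lia.
- move=> p q j hp hq hn hj; split; [lia|rewrite /P2z; lia|rewrite /parity_weight /omega2 /evenz; lia|congr (_, _, _); lia].
Qed.

Let X_E3 : Xb E3 =
  Y (fun p q => omega2 p q * (((Num.max p q + 1) %/ 2)%Z - ((p + 1) %/ 2)%Z)).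
Proof.
apply: (@X_fiber2 E3 (fun p q => p) (fun p q => Num.max p q)
  (fun s c y r => (y, s + r, (r %/ 2)%Z)) (fun p q j => (q - 2 * j, p, p, 2 * j))) => //.
- by move=> p q; lia.
- move=> s c y r e h /and3P[/and4P[hs hc hy hr] /eqP hcy hd]; subst c; move: h; rewrite /evenz => h.
  by split; [| | | |congr (_, _, _, _)]; lia.
- move=> p q j hp hq hn hj.
  split; [lia|rewrite /E3 /=; lia|rewrite /parity_weight /omega2 /evenz; lia|congr (_, _, _); lia].
Qed.

Let J0a (z : I4) : bool := let: (s, c, y, r) := z in [&& y == 0, P3 z & r <= c].
Let J0b (z : I4) : bool := let: (s, c, y, r) := z in [&& y == 0, P3 z & r < c].
Let J10a (z : I4) : bool := let: (s, c, y, r) := z in [&& 0 < y, r == c, P3 z & 0 <= s].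
Let J10b (z : I4) : bool := let: (s, c, y, r) := z in [&& 0 < y, r == c, P3 z & s < 0].

Let fin_J0a : finb J0a.
Proof. by apply: fin_sub fin_J0 => s c y r; rewrite /J0a /J0 /= b2z_neq0; pw. Qed.
Let fin_J0b : finb J0b.
Proof. by apply: fin_sub fin_J0 => s c y r; rewrite /J0b /J0 /= b2z_neq0; pw. Qed.
Let fin_J10a : finb J10a.
Proof. by apply: fin_sub fin_J10 => s c y r; rewrite /J10a /J10 /= b2z_neq0; pw. Qed.
Let fin_J10b : finb J10b.
Proof. by apply: fin_sub fin_J10 => s c y r; rewrite /J10b /J10 /= b2z_neq0; pw. Qed.

Let X_J0 : X J0 = Xb J0a + Xb J0b.
Proof. by apply: X_sum => // s c y r; rewrite /J0 /J0a /J0b /=; pw. Qed.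

Let X_J10 : X J10 = Xb J10a - Xb J10b.
Proof.
have -> : X J10 = Xb J10a + X (fun z => -1 * [! J10b z]).
  apply: X_sum => [||s c y r]; [exact: fin_J10a|exact: finZ fin_J10b|].
  by rewrite /J10 /J10a /J10b /=; pw.
by rewrite (XZ _ fin_J10b) mulN1r.
Qed.

Let X_J0a : Xb J0a = Y (fun p q => omega2 p q * (((p + q + 1) %/ 2)%Z - ((0 + 1) %/ 2)%Z)).
Proof.
apply: (@X_fiber2 J0a (fun p q => 0) (fun p q => p + q)
  (fun s c y r => (s, c, ((c - r) %/ 2)%Z)) (fun p q j => (p, q, 0, q - 2 * j))) => //.
- by move=> p q; lia.
- move=> s c y r e h /and3P[/eqP hy /and3P[h1 h2 h3] h4]; subst y; move: h; rewrite /evenz => h.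
  by split; [| | | |congr (_, _, _, _)]; lia.
- move=> p q j hp hq hn hj.
  split; [lia|rewrite /J0a /=; lia|rewrite /parity_weight /omega2 /evenz; lia|congr (_, _, _); lia].
Qed.

Let X_J0b : Xb J0b = Y (fun p q => omega2 p q * (((p + q + 1) %/ 2)%Z - ((1 + 1) %/ 2)%Z)).
Proof.
apply: (@X_fiber2 J0b (fun p q => 1) (fun p q => p + q)
  (fun s c y r => (s, c, ((c - r) %/ 2)%Z)) (fun p q j => (p, q, 0, q - 2 * j))) => //.
- by move=> p q; lia.
- move=> s c y r e h /and3P[/eqP hy /and3P[h1 h2 h3] h4]; subst y; move: h; rewrite /evenz => h.
  by split; [| | | |congr (_, _, _, _)]; lia.
- move=> p q j hp hq hn hj.
  split; [lia|rewrite /J0b /=; lia|rewrite /parity_weight /omega2 /evenz; lia|congr (_, _, _); lia].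
Qed.

Let X_J10a : Xb J10a = Y (fun p q => omega2 p q * (((p + 1 + 1) %/ 2)%Z - ((1 + 1) %/ 2)%Z)).
Proof.
apply: (@X_fiber2 J10a (fun p q => 1) (fun p q => p + 1)
  (fun s c y r => (s + y, c, (y %/ 2)%Z)) (fun p q j => (p - 2 * j, q, 2 * j, q))) => //.
- by move=> p q; lia.
- move=> s c y r e h /and4P[hy /eqP hr /and3P[h1 h2 h3] h4]; subst r; move: h; rewrite /evenz => h.
  by split; [| | | |congr (_, _, _, _)]; lia.
- move=> p q j hp hq hn hj.
  split; [lia|rewrite /J10a /=; lia|rewrite /parity_weight /omega2 /evenz; lia|congr (_, _, _); lia].
Qed.

Let X_J10b : Xb J10b = Y (fun p q => omega2 p q * (((p + q + 1) %/ 2)%Z - ((p + 1 + 1) %/ 2)%Z)).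
Proof.
apply: (@X_fiber2 J10b (fun p q => p + 1) (fun p q => p + q)
  (fun s c y r => (s + y, c, (y %/ 2)%Z)) (fun p q j => (p - 2 * j, q, 2 * j, q))) => //.
- by move=> p q; lia.
- move=> s c y r e h /and4P[hy /eqP hr /and3P[h1 h2 h3] h4]; subst r; move: h; rewrite /evenz => h.
  by split; [| | | |congr (_, _, _, _)]; lia.
- move=> p q j hp hq hn hj.
  split; [lia|rewrite /J10b /=; lia|rewrite /parity_weight /omega2 /evenz; lia|congr (_, _, _); lia].
Qed.

Let fsum_altZ e q : fsum (fun i : int => [! 0 < i < q] * (e * (1 - 2 * [! evenz i]))) =
  e * [! (0 < q) && evenz q].
Proof.
rewrite -fsum_alt -fsumZ; first by apply: eq_fsum => i; rewrite mulrCA.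
by apply: (@fin_supp1 q) => i; rewrite mulf_eq0 negb_or b2z_neq0; lia.
Qed.

(** Along this fibre the weight alternates with the parity of i, so the fibre sum collapses to 0 or
    1. *)
Let X_E1 : Xb E1 = Y (fun p q => [! evenz p && evenz q]).
Proof.
rewrite (@X_fiber E1 (fun p q i => 0 < i < q)
  (fun p q i => [! evenz (p + q)] * (1 - 2 * [! evenz i]))
  (fun s c y r => (s, c + r, c)) (fun p q i => (p, i, p, q - i))) //.
- by apply: eqY => p q hp hq _; rewrite fsum_altZ /evenz; lia.
- move=> s c y r e h /andP[/and4P[hs hc hy hr] /eqP hsy]; subst y.
  by split; [| | | |congr (_, _, _, _)]; lia.
- move=> p q i hp hq hn hi.
  by split; [lia|rewrite /E1 /=; lia|rewrite /parity_weight /evenz; lia|congr (_, _, _); lia].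
Qed.

Let X_E2 : Xb E2 = Y (fun p q => [! evenz (p + q) && (p < q)]).
Proof.
rewrite (@X_fiber E2 (fun p q i => 0 < i < q - p)
  (fun p q i => [! evenz (p + q)] * (1 - 2 * [! evenz i]))
  (fun s c y r => (s, c + r, c)) (fun p q i => (p, i, p, q - i))) //.
- by apply: eqY => p q hp hq _; rewrite fsum_altZ /evenz; lia.
- move=> s c y r e h /and3P[/and4P[hs hc hy hr] /eqP hsy hd]; subst y.
  by split; [| | | |congr (_, _, _, _)]; lia.
- move=> p q i hp hq hn hi.
  by split; [lia|rewrite /E2 /=; lia|rewrite /parity_weight /evenz; lia|congr (_, _, _); lia].
Qed.

Let X_Cz : Xb Cz = Y (fun p q => [! evenz p && evenz q]).
Proof.
rewrite (@X_fiber Cz (fun p q i => 0 < i < Num.min p q)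
  (fun p q i => ([! evenz (p + q)] * (2 * [! evenz p] - 1)) * (1 - 2 * [! evenz i]))
  (fun s c y r => (y, r, s)) (fun p q i => (i, 0, p, q))) //.
- by apply: eqY => p q hp hq _; rewrite fsum_altZ /evenz; lia.
- move=> s c y r e h /and4P[/eqP hc h1 h2 h3]; subst c.
  by split; [| | | |congr (_, _, _, _)]; lia.
- move=> p q i hp hq hn hi.
  by split; [lia|rewrite /Cz /=; lia|rewrite /parity_weight /evenz; lia|congr (_, _, _); lia].
Qed.

(** The total of all face contributions, left in the shape in which [X_fiber2] delivers them. *)
Let Phi (p q : int) : int :=
  omega2 p q * (((p + q + 1) %/ 2)%Z - ((0 + 1) %/ 2)%Z) +
  (omega2 p q * (((p + q + 1) %/ 2)%Z - ((1 + 1) %/ 2)%Z) +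
  (2 * (omega2 p q * (((p + 1 + 1) %/ 2)%Z - ((1 + 1) %/ 2)%Z)) +
  (-2 * (omega2 p q * (((p + q + 1) %/ 2)%Z - ((p + 1 + 1) %/ 2)%Z)) +
  (2 * (omega2 p q * (((p + q + 1) %/ 2)%Z - ((p + 1 + 1) %/ 2)%Z)) +
  (4 * (omega2 p q * (((p + 1) %/ 2)%Z - ((0 + 1) %/ 2)%Z)) +
  (-2 * (omega2 p q * (((Num.min p q + 1) %/ 2)%Z - ((0 + 1) %/ 2)%Z)) +
  (-2 * (omega2 p q * (((Num.max p q + 1) %/ 2)%Z - ((p + 1) %/ 2)%Z)) +
  (-2 * [! evenz p && evenz q] + 2 * [! evenz (p + q) && (p < q)])))))))).

Let X_hh_Phi : X hh = Y Phi.
Proof.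
rewrite X_hh_A X_interior X_J0 X_J10 X_A1z X_P1z X_P2z X_E3 X_J0a X_J0b X_J10a X_J10b X_E1 X_E2 X_Cz.
by set lhs := LHS; rewrite /Phi !YD !YZ /lhs; lia.
Qed.

(** Adding the value at (q, p) removes the floors, the minimum and the maximum; only the diagonal
    keeps a correction. *)
Let Phi_sym p q : 0 < p -> 0 < q -> Phi p q + Phi q p = 4 * (omega2 p q * p) + 4 * (omega2 q p * q) - 2 * [! p == q].
Proof.
move=> hp hq; have e : omega2 q p = omega2 p q by rewrite /omega2 andbC.
rewrite /Phi e [q + p]addrC minC maxC.
by case: (boolP (evenz p && evenz q)) => h; rewrite /omega2 ?h ?(negbTE h) /=; move: h; rewrite /evenz; lia.
Qed.

Let Y_diag : 2 * Y (fun p q => [! p == q]) = nsqrt n.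
Proof.
have -> : Y (fun p q => [! p == q]) = fsum (fun k : int => [! (0 < k) && (k ^+ 2 == n)]).
  apply: (@fsum_bij _ _ _ _ fst (fun k => (k, k))) => [[p q]|k] /=.
    rewrite mulf_eq0 negb_or !b2z_neq0 => /andP[/and3P[hp _ hn] /eqP hpq]; subst q.
    by rewrite ?expr2 hp hn eqxx.
  by rewrite eqxx mulr1 b2z_neq0 expr2 => /andP[-> ->].
have fs b : fin_supp (fun m : int => [! b m && (m ^+ 2 == n)]).
  by apply: (@fin_supp1 n) => m; rewrite b2z_neq0 => /andP[_ /eqP]; nia.
have f1 := fs (fun m => 0 < m); have f2 := fs (fun m => m < 0).
transitivity (fsum (fun m : int => [! (0 < m) && (m ^+ 2 == n)]) +
              fsum (fun m : int => [! (m < 0) && (m ^+ 2 == n)])).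
  rewrite mulr_natl mulr2n; congr (_ + _).
  by apply: (@fsum_bij _ _ _ _ -%R -%R) => m _; split; lia.
rewrite -fsumD //; apply: eq_fsum => m; case: eqP => [hn|]; last by rewrite !andbF.
by rewrite !andbT; nia.
Qed.

Let X_hh_sgm : 2 * X hh + nsqrt n = 8 * sigma_omega n.
Proof.
have swY F : Y (fun p q => F q p) = Y F.
  apply: (@fsum_bij _ _ _ _ (fun z => (z.2, z.1)) (fun z => (z.2, z.1))) => -[p q] _ /=.
    by split=> //; congr ([! _] * _); rewrite mulrC andbCA.
  by split=> //; congr ([! _] * _); rewrite mulrC andbCA.
have e1 : 2 * Y Phi = Y (fun p q => 4 * (omega2 p q * p) + (4 * (omega2 q p * q) + -2 * [! p == q])).
  rewrite mulr_natl mulr2n -{2}(swY Phi) -YD; apply: eqY => p q hp hq _.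
  by rewrite Phi_sym //; ring.
move: e1; rewrite !YD !YZ (swY (fun p q => omega2 p q * p)) X_hh_Phi.
have -> : Y (fun p q => omega2 p q * p) = sigma_omega n by [].
have := Y_diag; lia.
Qed.

Let X_hh_uvw : X hh = fsum (fun z : int * (int * int * int) => let: (k, (u, v, w)) := z in
  [! u * v + v * w + w * u == n - k ^+ 2] * (omega3 u v w * selling_weight u v w)).
Proof.
symmetry; apply: (@fsum_bij _ _ _ _
  (fun z : int * (int * int * int) => let: (k, (u, v, w)) := z in (u + k, v + w, w - k, v - k))
  (fun z : I4 => let: (s, c, y, r) := z in let w := ((c + y - r) %/ 2)%Z in
     (w - y, (s - w + y, c - w, w)))) => [[k [[u v] w]]|[[[s c] y] r]].
  move=> _; rewrite /wt /quad; split; last by congr (_, (_, _, _)); lia.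
  rewrite -mulrA; congr ([! _] * (_ * _)); first by lia.
    by rewrite /omega3 /parity_weight /evenz; lia.
  rewrite /hh /selling_weight /P3 /=.
  have -> : [&& 0 < u + k + (w - k), 0 < v + w & 0 < u + k + (v - k)] =
            [&& 0 < u + v, 0 < u + w & 0 < v + w] by lia.
  case: ifP => // _.
  have -> : 2 * (u + k) + (w - k) - (v + w) + (v - k) = 2 * u by ring.
  have -> : v + w + (v - k) - (w - k) = 2 * v by ring.
  have -> : v + w + (w - k) - (v - k) = 2 * w by ring.
  by rewrite !sg2.
rewrite !mulf_eq0 !negb_or => /andP[/andP[_ t0] _].
have : evenz (c + y + r) by apply: contraNT t0; rewrite /parity_weight => /negbTE->.
rewrite /evenz /wt -mulrA => hev /=; split; last by congr (_, _, _, _); lia.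
move: hev; set w := ((c + y - r) %/ 2)%Z => hev.
have hw : r = c + y - 2 * w by rewrite /w; lia.
clearbody w; subst r; congr ([! _] * (_ * _)); first by lia.
  by rewrite /omega3 /evenz; lia.
rewrite /selling_weight.
have -> : [&& 0 < s - w + y + (c - w), 0 < s - w + y + w & 0 < c - w + w] =
          [&& 0 < s + y, 0 < c & 0 < s + (c + y - 2 * w)] by lia.
case: ifP => // _.
have -> : 2 * s + y - c + (c + y - 2 * w) = 2 * (s - w + y) by ring.
have -> : c + (c + y - 2 * w) - y = 2 * (c - w) by ring.
have -> : c + y - (c + y - 2 * w) = 2 * w by ring.
by rewrite !sg2.
Qed.

(** The points k^2 = n enter through the indicator in [gauss_sum] and contribute [nsqrt n], which is
    exactly what the diagonal of [Phi_sym] leaves over. *)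
Lemma gauss_sum_convolution : fsum (fun k : int => gauss_sum (n - k ^+ 2)) = sigma_formula n.
Proof.
have f1 : fin_supp (fun k : int => [! n - k ^+ 2 == 0]).
  by apply: (@fin_supp1 n) => k; rewrite b2z_neq0 => /eqP; nia.
have bd k u v w : [! u * v + v * w + w * u == n - k ^+ 2] * (omega3 u v w * selling_weight u v w) != 0 ->
    [/\ `|k| <= n, `|u| <= n, `|v| <= n & `|w| <= n].
  rewrite !mulf_eq0 !negb_or b2z_neq0 => /and3P[/eqP e _ h].
  have [? ? ? _] := selling_weight_neq0 h; have := sqr_ge0 k.
  have [|? ? ? ?] := uvw_bound h (m := n - k ^+ 2); first by rewrite e.
  by move=> ?; split; [apply: abs_le_sqr| | |]; lia.
have f2 : fin_supp (fun k : int => uvw_sum (n - k ^+ 2)).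
  apply: (@fin_supp1 n) => k; apply: contraNT => hk; apply/eqP.
  rewrite -[RHS](@fsum0 (int * int * int)%type); apply: eq_fsum => -[[u v] w].
  by apply/eqP; apply: contraNT hk => /bd[].
rewrite /gauss_sum fsumD //; last exact: fin_suppZ.
rewrite fsumZ // -(fsum_pair (F := fun z : int * (int * int * int) => let: (k, (u, v, w)) := z in
  [! u * v + v * w + w * u == n - k ^+ 2] * (omega3 u v w * selling_weight u v w))); last first.
  exists [seq (x, z) | x <- ibox n, z <- [seq (t, z) | t <- [seq (x, y) | x <- ibox n, y <- ibox n],
     z <- ibox n]].
  by move=> [k [[u v] w]] /bd[? ? ? ?]; do !(apply: allpairs_f || exact: mem_ibox).
rewrite -X_hh_uvw /sigma_formula -X_hh_sgm.
have -> : n == 0 = false by lia.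
rewrite add0r addrC; congr (_ + _); apply: eq_fsum => k; congr [! _]; lia.
Qed.

End ClassNumberRelation.

(** * Comparison of the two convolutions with squares *)

Definition three_squares (m : int) : int := fsum (fun z : int * int * int =>
  let: (x, y, z) := z in [! x ^+ 2 + y ^+ 2 + z ^+ 2 == m]).

Lemma four_squares_convolution n : fsum (fun k : int => three_squares (n - k ^+ 2)) = four_squares n.
Proof.
transitivity (fsum (fun z : int * (int * int * int) => let: (k, (x, y, z)) := z in
    [! x ^+ 2 + y ^+ 2 + z ^+ 2 == n - k ^+ 2])).
  rewrite fsum_pair //.
  exists [seq (x, z) | x <- ibox n, z <- [seq (t, z) | t <- [seq (x, y) | x <- ibox n, y <- ibox n],
     z <- ibox n]].
  move=> [k [[x y] z]]; rewrite b2z_neq0 => /eqP e.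
  have := (sqr_ge0 x, sqr_ge0 y, sqr_ge0 z, sqr_ge0 k) => -[[[? ?] ?] ?].
  by do !(apply: allpairs_f || apply: mem_ibox); apply: abs_le_sqr; lia.
apply: (@fsum_bij _ _ _ _ (fun z : int * (int * int * int) => let: (k, t) := z in (t, k))
  (fun z => let: (t, k) := z in (k, t))) => [[k [[x y] z]]|[[[x y] z] k]] _;
  by split=> //; congr [! _]; lia.
Qed.

Theorem gauss_three_squares : three_squares =1 gauss_sum.
Proof.
have t0 m : m < 0 -> three_squares m = 0.
  move=> hm; rewrite -[RHS](@fsum0 (int * int * int)%type); apply: eq_fsum => -[[x y] z] /=.
  by case: eqP => // ?; nia.
have u0 m : m <= 0 -> uvw_sum m = 0.
  move=> hm; rewrite -[RHS](@fsum0 (int * int * int)%type); apply: eq_fsum => -[[u v] w].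
  case: (eqVneq (selling_weight u v w) 0) => [->|h]; first by rewrite !mulr0.
  case: eqP => [e|_]; last by rewrite mul0r.
  by have [|? _ _ _] := uvw_bound h (m := m); [rewrite e|lia].
apply: (@recursion_unique (fun _ _ => 1)) => //.
- move=> m; rewrite le_eqVlt => /orP[/eqP->|hm].
    rewrite /gauss_sum u0 // /three_squares (@fsumE _ _ [:: (0, 0, 0)]) //.
      by rewrite big_seq1.
    move=> [[x y] z]; rewrite b2z_neq0 inE => /eqP h.
    have := (sqr_ge0 x, sqr_ge0 y, sqr_ge0 z) => -[[? ?] ?].
    have e0 (u : int) : u ^+ 2 <= 0 -> u == 0 by nia.
    by rewrite !xpair_eqE !e0 //; lia.
  by rewrite t0 // /gauss_sum u0 ?mulr0; lia.
- move=> n n0; transitivity (four_squares n).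
    by rewrite -four_squares_convolution; apply: eq_fsum => k; rewrite mul1r.
  rewrite jacobi_four_squares -gauss_sum_convolution //.
  by apply: eq_fsum => k; rewrite mul1r.
Qed.

(** * Reduction of binary forms modulo Gamma(2) *)

Definition mulm (g h : mat2) : mat2 :=
  let: (a, b, c, d) := g in let: (a', b', c', d') := h in
  (a * a' + b * c', a * b' + b * d', c * a' + d * c', c * b' + d * d').
Definition invm (g : mat2) : mat2 := let: (a, b, c, d) := g in (d, - b, - c, a).
Definition detm (g : mat2) : int := let: (a, b, c, d) := g in a * d - b * c.
Definition onem : mat2 := (1, 0, 0, 1).

Lemma act_mulm Q g h : act (act Q g) h = act Q (mulm g h).
Proof.
case: Q g h => [[A B] C] [[[a b] c] d] [[[a' b'] c'] d'].
by rewrite /act /mulm; congr (_, _, _); ring.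
Qed.

Lemma act_onem Q : act Q onem = Q.
Proof. by case: Q => [[A B] C]; rewrite /act /onem; congr (_, _, _); ring. Qed.

Lemma detm_mulm g h : detm (mulm g h) = detm g * detm h.
Proof. by case: g h => [[[a b] c] d] [[[a' b'] c'] d']; rewrite /detm /mulm; ring. Qed.

Lemma detm_invm g : detm (invm g) = detm g.
Proof. by case: g => [[[a b] c] d]; rewrite /detm /invm; ring. Qed.

Lemma mulmA g h k : mulm g (mulm h k) = mulm (mulm g h) k.
Proof.
case: g h k => [[[a b] c] d] [[[a' b'] c'] d'] [[[x y] z] t].
by rewrite /mulm; congr (_, _, _, _); ring.
Qed.

Lemma mulm1 g : mulm g onem = g.
Proof. by case: g => [[[a b] c] d]; rewrite /mulm /onem; congr (_, _, _, _); ring. Qed.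

Lemma mul1m g : mulm onem g = g.
Proof. by case: g => [[[a b] c] d]; rewrite /mulm /onem; congr (_, _, _, _); ring. Qed.

Lemma mulmV g : detm g = 1 -> mulm g (invm g) = onem.
Proof.
by case: g => [[[a b] c] d]; rewrite /detm /mulm /invm /onem => e; congr (_, _, _, _); rewrite -?e; ring.
Qed.

Lemma mulVm g : detm g = 1 -> mulm (invm g) g = onem.
Proof.
by case: g => [[[a b] c] d]; rewrite /detm /mulm /invm /onem => e; congr (_, _, _, _); rewrite -?e; ring.
Qed.

Lemma disc_act Q g : disc (act Q g) = detm g ^+ 2 * disc Q.
Proof.
case: Q g => [[A B] C] [[[a b] c] d].
by rewrite /disc /act /qa /qb /qc /detm /=; ring.
Qed.

Lemma sum_sqr_bound (x y z t u : int) :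
  4 * x * y = z ^+ 2 + t * u ^+ 2 -> 1 <= t -> `|u| <= 4 * `|x| * `|y|.
Proof.
move=> e ht; apply: abs_le_sqr; apply: (@le_trans _ _ (4 * x * y)).
  have h4 : 0 <= (t - 1) * u ^+ 2 by apply: mulr_ge0; [lia|exact: sqr_ge0].
  by have := sqr_ge0 z; rewrite e; move: h4; rewrite mulrBl mul1r; lia.
by rewrite -!mulrA -normrM ler_pM2l //; exact: ler_norm.
Qed.

Lemma act_bound Q g : disc Q < 0 -> let: (a, b, c, d) := g in let R := act Q g in
  let M := 4 * (`|qa Q| + `|qc Q|) * (`|qa R| + `|qc R|) in
  [/\ `|a| <= M, `|b| <= M, `|c| <= M & `|d| <= M].
Proof.
case: Q g => [[A B] C] [[[a b] c] d]; rewrite /disc /act /qa /qb /qc /= => hD.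
set Ra := A * a ^+ 2 + _ + _; set Rc := A * b ^+ 2 + _ + _.
have hm : 1 <= 4 * A * C - B ^+ 2 by lia.
have ea : 4 * C * Ra = (2 * C * c + B * a) ^+ 2 + (4 * A * C - B ^+ 2) * a ^+ 2 by rewrite /Ra; ring.
have ec : 4 * A * Ra = (2 * A * a + B * c) ^+ 2 + (4 * A * C - B ^+ 2) * c ^+ 2 by rewrite /Ra; ring.
have eb : 4 * C * Rc = (2 * C * d + B * b) ^+ 2 + (4 * A * C - B ^+ 2) * b ^+ 2 by rewrite /Rc; ring.
have ed : 4 * A * Rc = (2 * A * b + B * d) ^+ 2 + (4 * A * C - B ^+ 2) * d ^+ 2 by rewrite /Rc; ring.
have mono (x y x' y' : int) : `|x| <= x' -> `|y| <= y' -> 4 * `|x| * `|y| <= 4 * x' * y'.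
  by move=> hx hy; rewrite -!mulrA ler_pM2l //; apply: ler_pM.
have hAC : `|A| <= `|A| + `|C| /\ `|C| <= `|A| + `|C| by rewrite lerDl lerDr !normr_ge0.
have hR : `|Ra| <= `|Ra| + `|Rc| /\ `|Rc| <= `|Ra| + `|Rc| by rewrite lerDl lerDr !normr_ge0.
case: hAC hR => ? ? [? ?]; split.
- by apply: le_trans (sum_sqr_bound ea hm) (mono _ _ _ _ _ _).
- by apply: le_trans (sum_sqr_bound eb hm) (mono _ _ _ _ _ _).
- by apply: le_trans (sum_sqr_bound ec hm) (mono _ _ _ _ _ _).
- by apply: le_trans (sum_sqr_bound ed hm) (mono _ _ _ _ _ _).
Qed.

(* Twice the indicator of the fundamental domain |Re z| <= 1, |z - 1/2| >= 1/2, |z + 1/2| >= 1/2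
   of Gamma(2), with weight 1/2 on its boundary. *)
Definition alpha (Q : qform) : int :=
  [! (`|qb Q| < 2 * `|qa Q|) && (`|qb Q| < 2 * `|qc Q|)] +
  [! (`|qb Q| <= 2 * `|qa Q|) && (`|qb Q| <= 2 * `|qc Q|)].

Lemma le_sum_prod (x y z : int) : 0 <= x -> 0 <= y -> 0 <= z ->
  0 < x * y + y * z + z * x -> x <= x * y + y * z + z * x.
Proof.
move=> hx hy hz h; have [h0|h1] : y + z = 0 \/ 1 <= y + z by lia.
  have [e1 e2] : y = 0 /\ z = 0 by lia.
  by move: h; rewrite e1 e2; lia.
have : 0 <= x * (y + z - 1) + y * z by apply: addr_ge0; apply: mulr_ge0; lia.
lia.
Qed.

Lemma alpha_bound Q : disc Q < 0 -> alpha Q != 0 ->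
  [/\ `|qa Q| <= - disc Q, `|qb Q| <= - disc Q & `|qc Q| <= - disc Q].
Proof.
case: Q => [[A B] C]; rewrite /alpha /disc /qa /qb /qc /= => hD h.
have [h1 h2] : `|B| <= 2 * `|A| /\ `|B| <= 2 * `|C| by lia.
(* These are Selling parameters: nonnegative, with UV + VW + WU = -disc. *)
pose U := 2 * `|A| - `|B|; pose V := 2 * `|C| - `|B|; pose W := `|B|.
have AC : A * C = `|A| * `|C| by nia.
have e : U * V + V * W + W * U = - (B ^+ 2 - 4 * A * C).
  by rewrite -mulrA AC /U /V /W -[B ^+ 2]real_normK ?num_real //; ring.
have [hU hV hW] : [/\ 0 <= U, 0 <= V & 0 <= W] by rewrite /U /V /W; split; lia.
have hp : 0 < U * V + V * W + W * U by lia.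
have b1 : U <= - (B ^+ 2 - 4 * A * C) by rewrite -e; apply: le_sum_prod.
have b2 : V <= - (B ^+ 2 - 4 * A * C).
  by rewrite -e; have := le_sum_prod hV hW hU; lia.
have b3 : W <= - (B ^+ 2 - 4 * A * C).
  by rewrite -e; have := le_sum_prod hW hU hV; lia.
by move: b1 b2 b3; rewrite /U /V /W; split; lia.
Qed.

Lemma fin_alpha D (F : qform -> int) : D < 0 ->
  fin_supp (fun R => [! disc R == D] * (alpha R * F R)).
Proof.
move=> hD; apply: (@fin_supp3 (- D)) => A B C.
rewrite !mulf_eq0 !negb_or b2z_neq0 => /and3P[/eqP e h _].
by have := @alpha_bound (A, B, C); rewrite e => /(_ hD h).
Qed.

Lemma fin_act Q (F : mat2 -> int) : disc Q < 0 ->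
  fin_supp (fun g => [! detm g == 1] * (alpha (act Q g) * F g)).
Proof.
move=> hD.
apply: (@fin_supp4 (4 * (`|qa Q| + `|qc Q|) * (- disc Q + - disc Q))) => a b c d.
rewrite !mulf_eq0 !negb_or b2z_neq0 => /and3P[/eqP e h _].
have eD : disc (act Q (a, b, c, d)) = disc Q by rewrite disc_act e expr1n mul1r.
have := @act_bound Q (a, b, c, d) hD; have := alpha_bound _ h.
rewrite eD => /(_ hD)[h1 _ h2] /= [? ? ? ?].
have hb : 4 * (`|qa Q| + `|qc Q|) * (`|qa (act Q (a, b, c, d))| + `|qc (act Q (a, b, c, d))|) <=
          4 * (`|qa Q| + `|qc Q|) * (- disc Q + - disc Q).
  by apply: ler_wpM2l; [rewrite mulr_ge0 ?addr_ge0|apply: lerD].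
by split; apply: le_trans hb.
Qed.

Definition gamma2 (g : mat2) : bool := let: (a, b, c, d) := g in
  [&& detm g == 1, ~~ evenz a, evenz b, evenz c & ~~ evenz d].

Lemma gamma2_det g : gamma2 g -> detm g = 1.
Proof. by case: g => [[[a b] c] d] /and5P[/eqP]. Qed.

Lemma evenz_mul a b : evenz (a * b) = evenz a || evenz b.
Proof. by rewrite /evenz !dvdzE abszM Euclid_dvdM. Qed.

Lemma evenz_add a b : evenz (a + b) = (evenz a == evenz b).
Proof. by rewrite /evenz; lia. Qed.

Lemma evenz_opp a : evenz (- a) = evenz a.
Proof. by rewrite /evenz; lia. Qed.

Lemma gamma2_mulm g h : gamma2 g -> gamma2 h -> gamma2 (mulm g h).
Proof.
move=> Gg Gh; have e : detm (mulm g h) == 1 by rewrite detm_mulm !gamma2_det.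
case: g h e Gg Gh => [[[a b] c] d] [[[a' b'] c'] d'] e.
rewrite /gamma2 => /and5P[_ h1 h2 h3 h4] /and5P[_ h5 h6 h7 h8]; rewrite /mulm e /=.
by rewrite !evenz_add !evenz_mul h2 h3 h6 h7 (negbTE h1) (negbTE h4) (negbTE h5) (negbTE h8).
Qed.

Lemma gamma2_invm g : gamma2 g -> gamma2 (invm g).
Proof.
move=> Gg; have e : detm (invm g) == 1 by rewrite detm_invm gamma2_det.
case: g e Gg => [[[a b] c] d] e /and5P[_ h1 h2 h3 h4].
by rewrite /gamma2 e /= !evenz_opp h1 h2 h3 h4.
Qed.

Definition gamma2_mass (Q : qform) : int := fsum (fun g => [! gamma2 g] * alpha (act Q g)).

Lemma gamma2_mass_act Q g : gamma2 g -> gamma2_mass (act Q g) = gamma2_mass Q.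
Proof.
move=> Gg; have d := gamma2_det Gg.
apply: (@fsum_bij _ _ _ _ (mulm g) (mulm (invm g))) => h.
  rewrite mulf_eq0 negb_or b2z_neq0 => /andP[Gh _].
  by rewrite act_mulm mulmA mulVm // mul1m (gamma2_mulm Gg Gh) Gh.
rewrite mulf_eq0 negb_or b2z_neq0 => /andP[Gh _].
by rewrite act_mulm mulmA mulmV // mul1m (gamma2_mulm (gamma2_invm Gg) Gh) Gh.
Qed.

(** With e the sign of B, 2(Q(x, y) - A) = (2A - |B|)(x^2 - 1) + (2C - |B|)y^2 + |B|((x + ey)^2 -
    1), and for x odd and y even no summand is negative. *)
Lemma weak_min (A B C x y : int) : `|B| <= 2 * A -> `|B| <= 2 * C -> ~~ evenz x -> evenz y ->
  A <= A * x ^+ 2 + B * x * y + C * y ^+ 2 /\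
  (A * x ^+ 2 + B * x * y + C * y ^+ 2 = A -> `|B| < 2 * C -> y = 0).
Proof.
move=> h1 h2 hx hy.
have [e [he hB]] : exists e : int, e ^+ 2 = 1 /\ B = e * `|B|.
  by case: (lerP 0 B) => ?; [exists 1|exists (-1)]; split; lia.
have hodd : ~~ evenz (x + e * y) by rewrite evenz_add evenz_mul hy orbT (negbTE hx).
have sq1 (t : int) : ~~ evenz t -> 1 <= t ^+ 2.
  move=> ht; have t0 : t != 0 by apply: contraNneq ht => ->.
  by move: t0; clear; nia.
have q1 := sq1 _ hx; have q2 := sq1 _ hodd.
have E : 2 * (A * x ^+ 2 + B * x * y + C * y ^+ 2 - A) =
  (2 * A - `|B|) * (x ^+ 2 - 1) + (2 * C - `|B|) * y ^+ 2 + `|B| * ((x + e * y) ^+ 2 - 1).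
  rewrite sqrrD exprMn he.
  have -> : `|B| * (x ^+ 2 + x * (e * y) *+ 2 + 1 * y ^+ 2 - 1) =
     `|B| * (x ^+ 2 + y ^+ 2 - 1) + 2 * (e * `|B|) * x * y by ring.
  by rewrite -hB; ring.
have t1 : 0 <= (2 * A - `|B|) * (x ^+ 2 - 1) by apply: mulr_ge0; lia.
have t2 : 0 <= (2 * C - `|B|) * y ^+ 2 by apply: mulr_ge0; [lia|exact: sqr_ge0].
have t3 : 0 <= `|B| * ((x + e * y) ^+ 2 - 1) by apply: mulr_ge0; lia.
split; first by lia.
move=> eA hC; have /eqP : (2 * C - `|B|) * y ^+ 2 = 0 by lia.
by rewrite mulf_eq0 sqrf_eq0 => /orP[/eqP|/eqP //]; lia.
Qed.

Lemma posdef_qc Q : disc Q < 0 -> 0 < qa Q -> 0 < qc Q.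
Proof. by case: Q => [[A B] C]; rewrite /disc /qa /qb /qc /=; nia. Qed.

Lemma posdef_pos (A B C x y : int) : B ^+ 2 - 4 * A * C < 0 -> 0 < A ->
  (x, y) != (0, 0) -> 0 < A * x ^+ 2 + B * x * y + C * y ^+ 2.
Proof.
move=> hD hA nz.
have e : 4 * A * (A * x ^+ 2 + B * x * y + C * y ^+ 2) =
   (2 * A * x + B * y) ^+ 2 + (4 * A * C - B ^+ 2) * y ^+ 2 by ring.
have : 0 < (2 * A * x + B * y) ^+ 2 + (4 * A * C - B ^+ 2) * y ^+ 2.
  case: (eqVneq y 0) => [y0|y0].
    subst y; have x0 : x != 0 by move: nz; rewrite xpair_eqE eqxx andbT.
    rewrite mulr0 addr0 expr0n mulr0 addr0 exprn_even_gt0 //= !mulf_neq0 //.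
    by rewrite gt_eqF.
  apply: ltr_wpDl; [exact: sqr_ge0|apply: mulr_gt0; last by rewrite exprn_even_gt0].
  by move: hD; clear; lia.
by rewrite -e pmulr_rgt0 // mulr_gt0.
Qed.

Lemma posdef_act Q g : disc Q < 0 -> 0 < qa Q -> detm g = 1 -> 0 < qa (act Q g).
Proof.
case: Q g => [[A B] C] [[[a b] c] d] hD hA e; apply: posdef_pos => //.
apply/negP; rewrite xpair_eqE => /andP[/eqP ea /eqP ec].
by move: e; rewrite /detm ea ec mulr0 mul0r subrr.
Qed.

(** Exchanging x and y has determinant -1 but normalizes Gamma(2). *)
Lemma gamma2_mass_swap A B C : gamma2_mass (A, B, C) = gamma2_mass (C, B, A).
Proof.
pose f (g : mat2) : mat2 := let: (a, b, c, d) := g in (d, c, b, a).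
have h P Q R g : gamma2 (f g) = gamma2 g /\ alpha (act (R, Q, P) (f g)) = alpha (act (P, Q, R) g).
  case: g => [[[a b] c] d]; split.
    rewrite /gamma2 /f /detm; apply/and5P/and5P => -[/eqP e -> -> -> ->]; split=> //; apply/eqP; lia.
  have -> : act (R, Q, P) (f (a, b, c, d)) = let: (x, y, z) := act (P, Q, R) (a, b, c, d) in (z, y, x).
    by rewrite /act /f; congr (_, _, _); ring.
  by case: (act _ _) => [[x y] z]; rewrite /alpha /qa /qb /qc /= andbC [X in _ + [! X]]andbC.
have ff : involutive f by move=> [[[a b] c] d].
apply: (@fsum_bij _ _ _ _ f f) => g _; first by have [-> ->] := h A B C g.
by have [-> ->] := h C B A g.
Qed.

(** Descent on A + C: when |B| > 2A or |B| > 2C, a shear by 2 or -2 lowers one outer coefficient and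
    fixes the other. *)
Lemma weak_exists Q : disc Q < 0 -> 0 < qa Q -> exists2 g, gamma2 g & alpha (act Q g) != 0.
Proof.
move: {2}(absz (qa Q + qc Q)) (leqnn (absz (qa Q + qc Q))) => N.
elim: N Q => [|N IH] [[A B] C]; rewrite /disc /qa /qb /qc /= => hN hD hA.
  have hC : 0 < C by nia.
  by lia.
have hC : 0 < C by nia.
have step g : gamma2 g -> qa (act (A, B, C) g) + qc (act (A, B, C) g) < A + C ->
    exists2 h, gamma2 h & alpha (act (A, B, C) h) != 0.
  move=> Gg hlt; have ha := @posdef_act (A, B, C) g hD hA (gamma2_det Gg).
  have dR : disc (act (A, B, C) g) < 0 by rewrite disc_act gamma2_det // expr1n mul1r.
  have hc := posdef_qc dR ha; have [|||h Gh hh] := IH (act (A, B, C) g).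
  - by move: hN hlt ha hc; clear; lia.
  - exact: dR.
  - exact: ha.
  - by exists (mulm g h); [exact: gamma2_mulm|rewrite -act_mulm].
case: (lerP `|B| (2 * A)) => h1; last first.
  by case: (lerP 0 B) => hB; [apply: (step (1, -2, 0, 1))|apply: (step (1, 2, 0, 1))] => //;
    rewrite /act /qa /qc /=; lia.
case: (lerP `|B| (2 * C)) => h2; last first.
  by case: (lerP 0 B) => hB; [apply: (step (1, 0, -2, 1))|apply: (step (1, 0, 2, 1))] => //;
    rewrite /act /qa /qc /=; lia.
exists onem => //; rewrite act_onem /alpha /qa /qb /qc /=; lia.
Qed.

Lemma mulz_eq1 (x y : int) : x * y = 1 -> (x = 1 /\ y = 1) \/ (x = -1 /\ y = -1).
Proof.
move=> e; have ex : (absz x * absz y = 1)%N by rewrite -abszM e.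
have [hx hy] : absz x = 1%N /\ absz y = 1%N.
  by split; apply/eqP; move/eqP: ex; rewrite muln_eq1 => /andP[].
have [] : x = 1 \/ x = -1 by lia.
  by move=> hx'; move: e; rewrite hx' mul1r; left.
by move=> hx'; move: e; rewrite hx' mulN1r; right; lia.
Qed.

(** Minimality applied to g and to its inverse shows that a form of nonzero weight in the orbit has
    the same A, C and |B|. In the interior only 1 and -1 occur, each with weight 2; on the boundary
    |B| = 2C there are four matrices of weight 1. *)
Lemma gamma2_mass_weak A B C (Q := (A, B, C)) : disc Q < 0 -> 0 < qa Q -> alpha Q != 0 ->
  `|B| < 2 * A -> gamma2_mass Q = 4.
Proof.
rewrite /Q => {Q} hD hA hal sA.
have actN : act (A, B, C) (-1, 0, 0, -1) = (A, B, C) by rewrite /act; congr (_, _, _); ring.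
have hC : 0 < C by move: hD hA; rewrite /disc /qa /qb /qc /=; nia.
have [h1 h2] : `|B| <= 2 * A /\ `|B| <= 2 * C.
  by move: hal hA; rewrite /alpha /qa /qb /qc /=; lia.
have nab : ~ (`|B| = 2 * A /\ `|B| = 2 * C).
  case=> e1 e2; have eAC : A = C by lia.
  move: hD; rewrite /disc /qa /qb /qc /= -[B ^+ 2]real_normK ?num_real // e1 eAC; lia.
have key a b c d : gamma2 (a, b, c, d) -> alpha (act (A, B, C) (a, b, c, d)) != 0 ->
   let R := act (A, B, C) (a, b, c, d) in
   [/\ qa R = A, qc R = C, `|qb R| = `|B|, a * d - b * c = 1 & (`|B| < 2 * C -> c = 0) /\
     (`|B| < 2 * A -> b = 0)].
  move=> Gg hR R; have dg := gamma2_det Gg.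
  have eD : disc R = disc (A, B, C) by rewrite /R disc_act dg expr1n mul1r.
  have eQ : act R (invm (a, b, c, d)) = (A, B, C) by rewrite /R act_mulm mulmV // act_onem.
  move: Gg => /and5P[/eqP edet ha hb hc hd].
  have hRa : qa R = A * a ^+ 2 + B * a * c + C * c ^+ 2 by [].
  have hRc : qc R = C * d ^+ 2 + B * d * b + A * b ^+ 2 by rewrite /R /act /qc /=; ring.
  have [m1 m2] := weak_min h1 h2 ha hc; have [m3 m4] := weak_min h2 h1 hd hb.
  rewrite -hRa in m1 m2; rewrite -hRc in m3 m4.
  have pRa : 0 < qa R by exact: lt_le_trans m1.
  have pRc : 0 < qc R by exact: lt_le_trans m3.
  move: eD eQ hR; rewrite -/R; case: (R) m1 m2 m3 m4 pRa pRc => [[A' B'] C'].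
  rewrite /alpha /act /disc /qa /qb /qc /invm /= => m1 m2 m3 m4 pA pC eD [e1 e2 e3] hR.
  have [r1 r2] : `|B'| <= 2 * A' /\ `|B'| <= 2 * C' by move: hR pA pC; clear; lia.
  have [] := @weak_min A' B' C' d (- c) r1 r2 hd; first by rewrite evenz_opp.
  have [] := @weak_min C' B' A' a (- b) r2 r1 ha; first by rewrite evenz_opp.
  move=> n1 _ n2 _; rewrite e1 in n2.
  have eC' : C' * a ^+ 2 + B' * a * - b + A' * (- b) ^+ 2 = C by rewrite -e3; ring.
  rewrite eC' in n1.
  have eA : A' = A by apply/le_anti; rewrite n2 m1.
  have eC : C' = C by apply/le_anti; rewrite n1 m3.
  split=> //; last by split; [apply: m2|apply: m4].
  have /eqP : B' ^+ 2 = B ^+ 2 by move: eD; rewrite eA eC => /addIr.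
  by rewrite eqf_sqr => /orP[] /eqP->; rewrite ?normrN.
have al0 g : gamma2 g -> alpha (act (A, B, C) g) != 0 -> alpha (act (A, B, C) g) = alpha (A, B, C).
  case: g => [[[a b] c] d] Gg h; have [] := key _ _ _ _ Gg h.
  by rewrite /alpha => -> -> -> _ _.
have list_sum (s : seq mat2) : uniq s -> (forall g, gamma2 g -> alpha (act (A, B, C) g) != 0 -> g \in s) ->
    (forall g, g \in s -> gamma2 g && (alpha (act (A, B, C) g) == alpha (A, B, C))) ->
    gamma2_mass (A, B, C) = (size s)%:Z * alpha (A, B, C).
  move=> us hs hal'; rewrite /gamma2_mass (fsumE us); last first.
    by move=> g; rewrite mulf_eq0 negb_or b2z_neq0 => /andP[]; exact: hs.
  under eq_big_seq => g /hal' /andP[-> /eqP->] do rewrite mul1r.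
  by rewrite big_const_seq count_predT iter_addr_0 -mulr_natl natz.
have [hC2|hC2] := ltrP `|B| (2 * C).
  have a2 : alpha (A, B, C) = 2.
    rewrite /alpha /qa /qb /qc /=; move: sA hC2 hA hC; rewrite /qa /=; clear; lia.
  rewrite (list_sum [:: onem; (-1, 0, 0, -1)]) ?a2 //.
    move=> [[[a b] c] d] Gg h; have [_ _ _ e [/(_ hC2) c0 /(_ sA) b0]] := key _ _ _ _ Gg h.
    subst b c; rewrite !inE; have [[-> ->]|[-> ->]] : (a = 1 /\ d = 1) \/ (a = -1 /\ d = -1).
    - by apply: mulz_eq1; move: e; clear; lia.
    - by rewrite eqxx.
    - by rewrite eqxx orbT.
  by move=> g; rewrite !inE => /orP[] /eqP->; rewrite ?act_onem ?actN ?a2.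
have a1 : alpha (A, B, C) = 1.
  rewrite /alpha /qa /qb /qc /=; move: sA hC2 hA hC h2; rewrite /qa /=; clear; lia.
(* The lower triangular shear by [t] glues the two boundary arcs B = 2C and B = -2C. *)
pose t : int := if 0 <= B then -2 else 2.
have ht : B = - t * C by rewrite /t; case: ifP; move: hC2 h2; clear; lia.
have ett : t ^+ 2 = 4 by rewrite /t; case: ifP.
have t0 : t != 0 by rewrite /t; case: ifP.
have evt : evenz t by rewrite /t; case: ifP.
have actt : act (A, B, C) (1, 0, t, 1) = (A, - B, C).
  rewrite /act ht; congr (_, _, _); [|ring|ring].
  have -> : A * 1 ^+ 2 + - t * C * 1 * t + C * t ^+ 2 = A + C * (t ^+ 2 - t ^+ 2) by ring.
  by rewrite subrr mulr0 addr0.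
have an : alpha (A, - B, C) = 1 by rewrite -[RHS]a1 /alpha /qa /qb /qc /= normrN.
have actt' : act (A, B, C) (-1, 0, - t, -1) = (A, - B, C).
  rewrite -actt /act; congr (_, _, _); ring.
rewrite (list_sum [:: onem; (-1, 0, 0, -1); (1, 0, t, 1); (-1, 0, - t, -1)]) ?a1 //.
- rewrite /onem /= !inE !xpair_eqE /=.
  by move: t0; clear; lia.
- move=> [[[a b] c] d] Gg h; have [_ _ eB e [_ /(_ sA) b0]] := key _ _ _ _ Gg h.
  subst b; rewrite !inE.
  have had : (a = 1 /\ d = 1) \/ (a = -1 /\ d = -1) by apply: mulz_eq1; move: e; clear; lia.
  have ecd : c * d = 0 \/ c * d = t.
    move: eB; rewrite /act /qb /=.
    have -> : 2 * A * a * 0 + B * (a * d + 0 * c) + 2 * C * c * d = C * (2 * (c * d) - t).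
      by case: had => -[-> ->]; rewrite ht; ring.
    rewrite ht mulNr normrN mulrC !normrM => e'.
    have : `|2 * (c * d) - t| = `|t|.
      by apply: (@mulIf _ `|C|) => //; rewrite normr_eq0; move: hC; clear; lia.
    by move: ett; rewrite /t; case: ifP => _; clear; lia.
  rewrite /onem !xpair_eqE; case: had => -[ea ed]; subst a d; move: ecd; clear; lia.
- move=> g; rewrite !inE => /or4P[] /eqP->.
  + by rewrite act_onem a1.
  + by rewrite actN a1.
  + rewrite actt an eqxx andbT.
    by rewrite /gamma2 /detm evt /evenz; clear; lia.
  + rewrite actt' an eqxx andbT.
    by rewrite /gamma2 /detm evenz_opp evt /evenz; clear; lia.
Qed.

Lemma gamma2_mass_posdef Q : disc Q < 0 -> 0 < qa Q -> gamma2_mass Q = 4.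
Proof.
move=> hD hA; have [g Gg hg] := weak_exists hD hA.
rewrite -(gamma2_mass_act Q Gg).
have dR : disc (act Q g) < 0 by rewrite disc_act gamma2_det // expr1n mul1r.
have ha := posdef_act hD hA (gamma2_det Gg).
case: (act Q g) hg dR ha => [[A B] C] hal dR ha.
have hc := posdef_qc dR ha.
have [hs|hs] := ltrP `|B| (2 * A); first exact: gamma2_mass_weak.
rewrite gamma2_mass_swap; apply: gamma2_mass_weak => //.
- by move: dR; rewrite /disc /qa /qb /qc /=; lia.
- by move: hal; rewrite /alpha /qa /qb /qc /=; lia.
- by move: dR ha hc hal hs; rewrite /alpha /disc /qa /qb /qc /=; nia.
Qed.

(** * Transporters in Gamma_0(N) *)

Definition negq (Q : qform) : qform := let: (A, B, C) := Q in (- A, - B, - C).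

Lemma negqK : involutive negq.
Proof. by move=> [[A B] C]; rewrite /negq !opprK. Qed.

Lemma act_negq Q g : act (negq Q) g = negq (act Q g).
Proof.
by case: Q g => [[A B] C] [[[a b] c] d]; rewrite /act /negq; congr (_, _, _); ring.
Qed.

Lemma alpha_negq Q : alpha (negq Q) = alpha Q.
Proof. by case: Q => [[A B] C]; rewrite /alpha /qa /qb /qc /= !normrN. Qed.

Lemma disc_negq Q : disc (negq Q) = disc Q.
Proof. by case: Q => [[A B] C]; rewrite /disc /qa /qb /qc /=; ring. Qed.

Definition sl2_mass (Q : qform) : int := fsum (fun g => [! detm g == 1] * alpha (act Q g)).

(** Lifts of the six elements of SL_2(F_2). *)
Definition gamma2_reps : seq mat2 :=
  [:: (1, 0, 0, 1); (0, -1, 1, 0); (1, 1, 0, 1); (1, 0, 1, 1); (0, -1, 1, 1); (1, -1, 1, 0)].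

Lemma gamma2_reps_det k : k \in gamma2_reps -> detm k = 1.
Proof. by rewrite !inE => /or4P[/eqP->|/eqP->|/eqP->|/or3P[/eqP->|/eqP->|/eqP->]]. Qed.

Lemma gamma2_cosets g :
  [! detm g == 1] = \sum_(k <- gamma2_reps) [! gamma2 (mulm (invm k) g)] :> int.
Proof.
case: eqP => e; last first.
  rewrite big_seq big1 // => k hk.
  case: (boolP (gamma2 _)) => // /gamma2_det; rewrite detm_mulm detm_invm (gamma2_reps_det hk) mul1r.
  by move=> /e.
have d k : k \in gamma2_reps -> detm (mulm (invm k) g) == 1.
  by move=> hk; rewrite detm_mulm detm_invm (gamma2_reps_det hk) e.
have hp : let: (x, y, z, t) := g in (evenz x || evenz t) != (evenz y || evenz z).
  case: g e {d} => [[[x y] z] t] e; rewrite -!evenz_mul.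
  have : evenz (x * t - y * z) = false by move: e; rewrite /detm => ->.
  by rewrite evenz_add evenz_opp => ->.
rewrite /gamma2_reps !big_cons big_nil.
case: g d hp {e} => [[[x y] z] t] d.
have E k : k \in gamma2_reps -> gamma2 (mulm (invm k) (x, y, z, t)) =
   let: (a, b, c, d) := mulm (invm k) (x, y, z, t) in [&& ~~ evenz a, evenz b, evenz c & ~~ evenz d].
  by move=> /d; rewrite /gamma2; case: (mulm _ _) => [[[a b] c] d'] ->.
rewrite !E //.
rewrite /mulm /invm !evenz_add !evenz_mul !evenz_opp.
have [e0 e1] : evenz 0 /\ evenz 1 = false by [].
rewrite e0 e1.
by case: (evenz x); case: (evenz y); case: (evenz z); case: (evenz t).
Qed.

Lemma sl2_mass_posdef Q : disc Q < 0 -> 0 < qa Q -> sl2_mass Q = 24.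
Proof.
move=> hD hA.
have coset k : k \in gamma2_reps ->
    fsum (fun g => [! gamma2 (mulm (invm k) g)] * alpha (act Q g)) = 4.
  move=> hk; have dk := gamma2_reps_det hk.
  rewrite -(@gamma2_mass_posdef (act Q k)); first last.
  - exact: posdef_act.
  - by rewrite disc_act dk expr1n mul1r.
  apply: (@fsum_bij _ _ _ _ (mulm (invm k)) (mulm k)) => g _.
    by rewrite act_mulm mulmA mulmV // mul1m.
  by rewrite act_mulm mulmA mulVm // mul1m.
have fk k : k \in gamma2_reps ->
    fin_supp (fun g => [! gamma2 (mulm (invm k) g)] * alpha (act Q g)).
  move=> hk; apply: fin_supp_sub (fin_act (fun=> 1) hD) => g.
  rewrite !mulf_eq0 !negb_or !b2z_neq0 => /andP[/gamma2_det e ->].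
  by move: e; rewrite detm_mulm detm_invm gamma2_reps_det // mul1r => ->; rewrite eqxx.
transitivity (fsum (fun g => \sum_(k <- gamma2_reps) [! gamma2 (mulm (invm k) g)] * alpha (act Q g))).
  by apply: eq_fsum => g; rewrite gamma2_cosets mulr_suml.
by rewrite fsum_sum // (eq_big_seq _ coset) /gamma2_reps !big_cons big_nil.
Qed.

Lemma sl2_mass_definite Q : disc Q < 0 -> sl2_mass Q = 24.
Proof.
move=> hD; have [hA|hA] := ltrP 0 (qa Q); first exact: sl2_mass_posdef.
rewrite -(@sl2_mass_posdef (negq Q)) ?disc_negq //.
  by apply: eq_fsum => g; rewrite act_negq alpha_negq.
case: Q hD hA => [[A B] C]; rewrite /disc /qa /qb /qc /= => hD hA.
have : A != 0 by apply: contraTneq hD => ->; have := sqr_ge0 B; lia.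
by move: hA; clear; lia.
Qed.

(** Connects the cardinals chosen by [epsilon] in the statement with finite sums. *)
Lemma card_is_fsum (T : eqType) (P : T -> Prop) (b : pred T) :
  (forall x, P x <-> b x) -> fin_supp (fun x => [! b x]) ->
  (epsilon (inhabits 0%N) (fun k => card_is P k))%:Z = fsum (fun x => [! b x]).
Proof.
move=> hPb fb; have [s [us hs]] := fin_supp_list fb.
have hs' x : P x <-> x \in s by rewrite hPb -hs b2z_neq0.
have : card_is P (epsilon (inhabits 0%N) (fun k => card_is P k)).
  by apply: epsilon_spec; exists (size s); exists s.
set k := epsilon _ _; case=> t [ut <- ht].
rewrite (@fsumE _ _ t) //; last by move=> x; rewrite b2z_neq0 => /hPb /ht.
rewrite (eq_big_seq (fun=> 1)) ?big_const_seq ?count_predT ?iter_addr_0 ?natz //.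
by move=> x /ht /hPb ->.
Qed.

Lemma r3_three_squares (n : nat) : (r3 n)%:Z = three_squares n%:Z.
Proof.
rewrite /r3 (@card_is_fsum _ _ (fun v => v.1.1 ^+ 2 + v.1.2 ^+ 2 + v.2 ^+ 2 == n%:Z)).
- by apply: eq_fsum => -[[x y] z].
- by move=> v; split=> [/eqP|/eqP].
- apply: (@fin_supp3 n%:Z) => x y z; rewrite b2z_neq0 /= => /eqP e.
  have := (sqr_ge0 x, sqr_ge0 y, sqr_ge0 z) => -[[? ?] ?].
  by split; apply: abs_le_sqr; lia.
Qed.

Definition gamma0 (N : nat) (g : mat2) : bool := let: (a, b, c, d) := g in
  (a * d - b * c == 1) && (N%:Z %| c)%Z.

Lemma gamma0P N g : inGamma0 N g <-> gamma0 N g.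
Proof.
case: g => [[[a b] c] d]; rewrite /inGamma0 /gamma0; split=> [[/eqP-> ->]|/andP[/eqP-> ->]] //.
Qed.

Lemma gamma0_det N g : gamma0 N g -> detm g = 1.
Proof. by case: g => [[[a b] c] d] /andP[/eqP]. Qed.

Lemma gamma0_onem N : gamma0 N onem.
Proof. by rewrite /gamma0 /onem /= dvdz0. Qed.

Lemma gamma0_mulm N g h : gamma0 N g -> gamma0 N h -> gamma0 N (mulm g h).
Proof.
move=> Gg Gh; have e : detm (mulm g h) == 1 by rewrite detm_mulm !(@gamma0_det N).
case: g h e Gg Gh => [[[a b] c] d] [[[a' b'] c'] d'] e /andP[_ h1] /andP[_ h2].
by rewrite /mulm /gamma0; move: e; rewrite /detm /mulm => -> /=; apply: rpredD; [exact: dvdz_mulr|exact: dvdz_mull].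
Qed.

Lemma gamma0_invm N g : gamma0 N g -> gamma0 N (invm g).
Proof.
move=> Gg; have e : detm (invm g) == 1 by rewrite detm_invm (@gamma0_det N).
case: g e Gg => [[[a b] c] d] e /andP[_ h1].
by move: e; rewrite /detm /invm /gamma0 => -> /=; rewrite rpredN.
Qed.

(** This is the order of the stabilizer of Q when R lies in its orbit and 0 otherwise; divided by
    that order it is the indicator of the orbit. *)
Definition transporters (N : nat) (Q R : qform) : int := fsum (fun g => [! gamma0 N g && (act Q g == R)]).

Lemma fin_transporters N Q R : disc Q < 0 -> fin_supp (fun g => [! gamma0 N g && (act Q g == R)]).
Proof.
move=> hD; apply: (@fin_supp4 (4 * (`|qa Q| + `|qc Q|) * (`|qa R| + `|qc R|))) => a b c d.
rewrite b2z_neq0 => /andP[_ /eqP e].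
by have := @act_bound Q (a, b, c, d) hD; rewrite e.
Qed.

Lemma stab_card_transporters N Q : disc Q < 0 -> (stab_card N Q)%:Z = transporters N Q Q.
Proof.
move=> hD; rewrite /stab_card (@card_is_fsum _ _ (fun g => gamma0 N g && (act Q g == Q))) //.
  by move=> g; rewrite /stab gamma0P; split=> [[-> /eqP]|/andP[-> /eqP]].
exact: fin_transporters.
Qed.

Lemma equivQ_refl N Q : equivQ N Q Q.
Proof. by exists onem; split; [apply/gamma0P; exact: gamma0_onem|exact: act_onem]. Qed.

Lemma equivQ_sym N Q R : equivQ N Q R -> equivQ N R Q.
Proof.
case=> g [/gamma0P Gg <-]; exists (invm g); split; first by apply/gamma0P; exact: gamma0_invm.
by rewrite act_mulm mulmV ?act_onem // (@gamma0_det N).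
Qed.

Lemma equivQ_trans N Q R S : equivQ N Q R -> equivQ N R S -> equivQ N Q S.
Proof.
case=> g [/gamma0P Gg <-] [h [/gamma0P Gh <-]]; exists (mulm g h).
by split; [apply/gamma0P; exact: gamma0_mulm|rewrite act_mulm].
Qed.

Lemma equivQ_disc N Q R : equivQ N Q R -> disc R = disc Q.
Proof. by case=> g [/gamma0P /gamma0_det e <-]; rewrite disc_act e expr1n mul1r. Qed.

Lemma transporters_equiv N Q R : equivQ N Q R -> transporters N Q R = transporters N Q Q.
Proof.
case=> h [/gamma0P Gh <-]; have dh := gamma0_det Gh.
apply: (@fsum_bij _ _ _ _ (fun g => mulm g (invm h)) (fun g => mulm g h)) => g.
  rewrite b2z_neq0 => /andP[Gg /eqP e].
  rewrite -mulmA mulVm // mulm1 (gamma0_mulm Gg (gamma0_invm Gh)) Gg e.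
  by rewrite -act_mulm e act_mulm mulmV // act_onem !eqxx.
rewrite b2z_neq0 => /andP[Gg /eqP e].
by rewrite -mulmA mulmV // mulm1 (gamma0_mulm Gg Gh) Gg -act_mulm !e !eqxx.
Qed.

Lemma transporters_nequiv N Q R : ~ equivQ N Q R -> transporters N Q R = 0.
Proof.
move=> h; rewrite -[RHS](@fsum0 mat2); apply: eq_fsum => g.
by case: (boolP (_ && _)) => // /andP[/gamma0P Gg /eqP e]; case: h; exists g.
Qed.

Lemma transporters_refl_neq0 N Q : disc Q < 0 -> transporters N Q Q != 0.
Proof.
move=> hD; have [s [us hs]] := fin_supp_list (fin_transporters N Q hD).
have os : onem \in s by rewrite -hs gamma0_onem act_onem eqxx.
rewrite /transporters (@fsumE _ _ s) //; last by move=> g; rewrite hs.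
rewrite (bigD1_seq onem os us) gamma0_onem act_onem eqxx.
have : 0 <= \sum_(i <- s | i != onem) [! gamma0 N i && (act Q i == Q)] by apply: sumr_ge0.
by case: (\sum_(_ <- _ | _) _) => // m _; rewrite -PoszD.
Qed.

(** * Weighted orbit counts for Gamma_0(p) *)

Lemma Euclid_dvdzM (p : nat) (a b : int) : prime p ->
  (p%:Z %| a * b)%Z = (p%:Z %| a)%Z || (p%:Z %| b)%Z.
Proof. by move=> pp; rewrite !dvdzE abszM Euclid_dvdM. Qed.

Lemma linear_root_count (p : nat) (c d : int) : prime p -> ~~ (p%:Z %| c)%Z ->
  \sum_(j <- iota 0 p) [! (p%:Z %| c * j%:Z + d)%Z] = 1 :> int.
Proof.
move=> pp hc; have p0 : (0 < p)%N := prime_gt0 pp.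
have pz : p%:Z != 0 by lia.
have cop : gcdz c p%:Z = 1.
  have : coprime p (absz c) by rewrite prime_coprime; [move: hc; rewrite dvdzE|].
  by rewrite /gcdz gcdnC /coprime => /eqP /= ->.
have [u [v huv]] := Bezoutz c p%:Z; rewrite cop in huv.
pose j0 := absz ((- d * u) %% p%:Z)%Z.
have ej0 : j0%:Z = ((- d * u) %% p%:Z)%Z by rewrite /j0; have := modz_ge0 (- d * u) pz; lia.
have lj0 : (j0 < p)%N by have := ltz_mod (- d * u) pz; rewrite -ej0; lia.
have dj0 : (p%:Z %| c * j0%:Z + d)%Z.
  have e : - d * u = ((- d * u) %/ p%:Z)%Z * p%:Z + j0%:Z by rewrite ej0 -divz_eq.
  apply/dvdzP; exists (d * v - c * ((- d * u) %/ p%:Z)%Z).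
  move: e; set q := (_ %/ _)%Z => e.
  have ej : j0%:Z = - d * u - q * p%:Z by rewrite e; ring.
  rewrite ej; have -> : c * (- d * u - q * p%:Z) + d = d * (1 - u * c) - c * q * p%:Z by ring.
  by rewrite -huv; ring.
have uni j : (j < p)%N -> (p%:Z %| c * j%:Z + d)%Z = (j == j0).
  move=> lj; apply/idP/eqP => [h|-> //].
  have : (p%:Z %| c * (j%:Z - j0%:Z))%Z.
    have -> : c * (j%:Z - j0%:Z) = (c * j%:Z + d) - (c * j0%:Z + d) by ring.
    exact: rpredB.
  rewrite Euclid_dvdzM // (negbTE hc) /= dvdzE => h2.
  case: (posnP (absz (j%:Z - j0%:Z))) => h0; first by move: h0; clear; lia.
  by have := dvdn_leq h0 h2; move: lj lj0; clear; lia.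
rewrite (eq_big_seq (fun j => [! j == j0])); last first.
  by move=> j; rewrite mem_iota add0n => /andP[_ /uni ->].
rewrite (bigD1_seq j0) ?iota_uniq ?mem_iota //= eqxx big1 ?addr0 //.
by move=> j /negbTE ->.
Qed.

(* The cosets of Gamma_0(p) in SL_2(Z) are indexed by the points of the projective line over F_p:
   the first column of gamma0_rep p j is (j, 1) for j < p and (1, 0) for j = p. *)
Definition gamma0_rep (p j : nat) : mat2 := if j == p then onem else (j%:Z, -1, 1, 0).

Lemma gamma0_rep_det p j : detm (gamma0_rep p j) = 1.
Proof. by rewrite /gamma0_rep /detm /onem; case: ifP => _; lia. Qed.

Lemma sum_P1 (p : nat) (F : nat -> int) :
  \sum_(j <- iota 0 p.+1) F j = \sum_(j <- iota 0 p) F j + F p.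
Proof. by rewrite -addn1 iotaD big_cat big_seq1 add0n. Qed.

Lemma gamma0_rep_lt p j : j \in iota 0 p -> gamma0_rep p j = (j%:Z, -1, 1, 0).
Proof. by rewrite mem_iota /gamma0_rep => h; case: eqP => // e; lia. Qed.

(** For j < p the product has lower left entry cj + d. It has one root modulo p if p does not divide
    c; otherwise the determinant excludes a root and j = p takes its place. *)
Lemma gamma0_cosets p g : prime p ->
  \sum_(j <- iota 0 p.+1) [! gamma0 p (mulm g (gamma0_rep p j))] = [! detm g == 1] :> int.
Proof.
move=> pp; case: (eqVneq (detm g) 1) => e; last first.
  rewrite big1 // => j _; case: (boolP (gamma0 _ _)) => // /gamma0_det.
  by rewrite detm_mulm gamma0_rep_det mulr1 => /eqP; rewrite (negbTE e).
case: g e => [[[a b] c] d] e.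
have e' : a * d - b * c = 1 by [].
rewrite sum_P1 (eq_big_seq (fun j => [! (p%:Z %| c * j%:Z + d)%Z])); last first.
  move=> j /gamma0_rep_lt ->; rewrite /mulm /gamma0.
  have -> : (a * j%:Z + b * 1) * (c * -1 + d * 0) - (a * -1 + b * 0) * (c * j%:Z + d * 1) =
     a * d - b * c by ring.
  by rewrite e' mulr1.
rewrite /gamma0_rep eqxx mulm1 /gamma0 e' eqxx /=.
case: (boolP (p%:Z %| c)%Z) => hc; last by rewrite linear_root_count.
rewrite big_seq big1 // => j _; case: (boolP (_ %| _)%Z) => // h.
have hd : (p%:Z %| d)%Z.
  by have -> : d = (c * j%:Z + d) - c * j%:Z by [ring]; apply: rpredB => //; exact: dvdz_mulr.
have : (p%:Z %| a * d - b * c)%Z by apply: rpredB; [exact: dvdz_mull|exact: dvdz_mull].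
by rewrite e' dvdzE dvdn1 => /eqP /= p1; move: pp; rewrite p1.
Qed.

(** Unfolds the mass 24: each g in SL_2(Z) gives h = g k_j in Gamma_0(p) for exactly one
    representative k_j, and R = Q g satisfies Q h = R k_j. *)
Lemma coset_sum p Q : prime p -> disc Q < 0 ->
  \sum_(j <- iota 0 p.+1) fsum (fun R =>
     [! disc R == disc Q] * (alpha R * transporters p Q (act R (gamma0_rep p j)))) = 24.
Proof.
move=> pp hD.
pose g1 j (g : mat2) : int := [! gamma0 p (mulm g (gamma0_rep p j))] * alpha (act Q g).
have fg j : fin_supp (g1 j).
  apply: fin_supp_sub (fin_act (fun=> 1) hD) => g.
  rewrite !mulf_eq0 !negb_or !b2z_neq0 => /andP[/gamma0_det e ->].
  by move: e; rewrite detm_mulm gamma0_rep_det mulr1 => ->; rewrite eqxx.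
transitivity (\sum_(j <- iota 0 p.+1) fsum (g1 j)).
  apply: eq_bigr => j _.
  pose F (t : qform * mat2) : int := [! disc t.1 == disc Q] *
    (alpha t.1 * [! gamma0 p t.2 && (act Q t.2 == act t.1 (gamma0_rep p j))]).
  pose phi (t : qform * mat2) : mat2 := mulm t.2 (invm (gamma0_rep p j)).
  pose psi (g : mat2) : qform * mat2 := (act Q g, mulm g (gamma0_rep p j)).
  have dk := gamma0_rep_det p j.
  have h1 t : F t != 0 -> g1 j (phi t) = F t /\ psi (phi t) = t.
    case: t => R h; rewrite /F /= !mulf_eq0 !negb_or !b2z_neq0.
    move=> /and3P[hR hal /andP[Gh /eqP e]]; rewrite /phi /psi /g1 /=.
    rewrite -mulmA mulVm // mulm1 -act_mulm e act_mulm mulmV // act_onem Gh hR.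
    by rewrite eqxx !mul1r mulr1.
  have h2 g : g1 j g != 0 -> F (psi g) = g1 j g /\ phi (psi g) = g.
    rewrite !mulf_eq0 !negb_or !b2z_neq0 => /andP[Gg hal]; rewrite /phi /psi /F /g1 /=.
    have := gamma0_det Gg; rewrite detm_mulm gamma0_rep_det mulr1 => dg.
    by rewrite -mulmA mulmV // mulm1 disc_act dg expr1n mul1r Gg act_mulm !eqxx !mul1r mulr1.
  rewrite -(fsum_bij h1 h2) [RHS]fsum_pair; last exact: (fin_supp_bij h1 (fg j)).
  apply: eq_fsum => R; rewrite /F /=.
  rewrite mulrA -fsumZ; last exact: fin_transporters.
  by apply: eq_fsum => h; rewrite mulrA.
rewrite -fsum_sum // -[RHS](sl2_mass_definite hD).
by apply: eq_fsum => g; rewrite /g1 -mulr_suml gamma0_cosets.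
Qed.

Definition reps (N : nat) (Z : qform -> Prop) (L : seq qform) : Prop :=
  [/\ forall Q, Q \in L -> Z Q,
      forall Q, Z Q -> exists2 Q', Q' \in L & equivQ N Q' Q
    & forall i j, (i < size L)%N -> (j < size L)%N ->
        equivQ N (nth (0,0,0) L i) (nth (0,0,0) L j) -> i = j].

Lemma reps_uniq N Z L : reps N Z L ->
  uniq L /\ forall Q R, Q \in L -> R \in L -> equivQ N Q R -> Q = R.
Proof.
move=> [_ _ h]; split.
  apply/(uniqP (0, 0, 0)) => i j; rewrite !inE => hi hj e; apply: h => //.
  rewrite e; exact: equivQ_refl.
move=> Q R hQ hR e; rewrite -(nth_index (0, 0, 0) hQ) -(nth_index (0, 0, 0) hR).
by congr nth; apply: h; rewrite ?index_mem // !nth_index.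
Qed.

Lemma reps_exist N (Z : pred qform) (cv : seq qform) :
  (forall Q R, equivQ N Q R -> Z Q -> Z R) ->
  (forall Q, Z Q -> exists2 Q', Q' \in cv & equivQ N Q' Q) -> exists L, reps N Z L.
Proof.
move=> hZ hcv.
have sub (s : seq qform) : exists L : seq qform, [/\ {subset L <= s}, uniq L,
   forall Q, Q \in s -> exists2 Q', Q' \in L & equivQ N Q' Q
   & forall Q R, Q \in L -> R \in L -> equivQ N Q R -> Q = R].
  elim: s => [|Q s [L [h1 h2 h3 h4]]]; first by exists [::].
  have [[Q' hQ' e]|ne] := excluded_middle_informative (exists2 Q', Q' \in L & equivQ N Q' Q).
    exists L; split=> // [R /h1|R]; first by rewrite inE => ->; rewrite orbT.
    by rewrite inE => /orP[/eqP->|/h3 //]; exists Q'.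
  exists (Q :: L); split.
  - by move=> R; rewrite !inE => /orP[->//|/h1 ->]; rewrite orbT.
  - rewrite /= h2 andbT; apply/negP => hQ; apply: ne; exists Q => //; exact: equivQ_refl.
  - move=> R; rewrite inE => /orP[/eqP->|/h3[Q' hQ' e]].
      by exists Q; [rewrite inE eqxx|exact: equivQ_refl].
    by exists Q' => //; rewrite inE hQ' orbT.
  - move=> R S; rewrite !inE => /orP[/eqP->|hR] /orP[/eqP->|hS] // e; last exact: h4.
      by case: ne; exists S => //; exact: equivQ_sym.
    by case: ne; exists R.
have [L [h1 h2 h3 h4]] := sub [seq Q <- cv | Z Q].
exists L; split.
- by move=> Q /h1; rewrite mem_filter => /andP[].
- move=> Q ZQ; have [Q' hQ' e] := hcv _ ZQ.
  have ZQ' : Z Q' by apply: hZ ZQ; exact: equivQ_sym.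
  have [|R hR eR] := h3 Q'; first by rewrite mem_filter ZQ'.
  by exists R => //; exact: equivQ_trans e.
- move=> i j hi hj /(h4 _ _ (mem_nth _ hi) (mem_nth _ hj)) e.
  by apply/eqP; rewrite -(nth_uniq (0, 0, 0) hi hj h2) e.
Qed.

(** Each form is equivalent to some R k_j with R of nonzero weight, and there are finitely many of
    these. *)
Lemma definite_reps_exist p D (Z : pred qform) : prime p -> D < 0 ->
  (forall Q, Z Q -> disc Q = D) -> (forall Q R, equivQ p Q R -> Z Q -> Z R) ->
  exists L, reps p Z L.
Proof.
move=> pp hD ZD hZ; have [s hs] := fin_alpha (fun=> 1) hD.
apply: (@reps_exist _ _ [seq act R (gamma0_rep p j) | R <- s, j <- iota 0 p.+1]) => // Q ZQ.
have dQ := ZD _ ZQ; have dQ0 : disc Q < 0 by rewrite dQ.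
have [g dg hg] : exists2 g, detm g = 1 & alpha (act Q g) != 0.
  apply: NNPP => ne; have := sl2_mass_definite dQ0.
  suff -> : sl2_mass Q = 0 by [].
  rewrite -[RHS](@fsum0 mat2); apply: eq_fsum => g.
  case: eqP => dg; last by rewrite mul0r.
  by apply/eqP; rewrite mul1r; apply/negPn/negP => hg; apply: ne; exists g.
have [j hj Gj] : exists2 j, j \in iota 0 p.+1 & gamma0 p (mulm g (gamma0_rep p j)).
  apply/hasP; apply: contraT => /hasPn h; have := gamma0_cosets g pp.
  by rewrite dg eqxx big_seq big1 // => j /h /negbTE ->.
exists (act (act Q g) (gamma0_rep p j)).
  apply: allpairs_f => //; apply: hs.
  by rewrite disc_act dg expr1n mul1r dQ eqxx mulr1 mul1r.
by apply: equivQ_sym; exists (mulm g (gamma0_rep p j)); split; [exact/gamma0P|rewrite act_mulm].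
Qed.

Definition coset_mass (p : nat) (D : int) (Z : pred qform) : int :=
  \sum_(j <- iota 0 p.+1) fsum (fun R =>
     [! disc R == D] * (alpha R * [! Z (act R (gamma0_rep p j))])).

(** Replace 24 by [coset_sum] and exchange the sums: for fixed R and j, the transporters divided by
    the stabilizer orders add up to the indicator of Z. *)
Lemma mass_formula p D (Z : pred qform) L : prime p -> D < 0 ->
  (forall Q, Z Q -> disc Q = D) -> (forall Q R, equivQ p Q R -> Z Q -> Z R) ->
  reps p Z L ->
  \sum_(Q <- L) 24 / (stab_card p Q)%:R = (coset_mass p D Z)%:~R :> rat.
Proof.
move=> pp hD ZD hZ hL; have [uL injL] := reps_uniq hL; case: hL => LZ cov _.
have [s [us hs]] := fin_supp_list (fin_alpha (fun=> 1) hD).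
have fE (F : qform -> int) : fsum (fun R => [! disc R == D] * (alpha R * F R)) =
    \sum_(R <- s) [! disc R == D] * (alpha R * F R).
  apply: fsumE => // R; rewrite -hs !mulf_eq0 !negb_or => /and3P[-> -> _].
  by rewrite oner_eq0.
have dL Q : Q \in L -> disc Q = D by move=> /LZ /ZD.
have orb R : \sum_(Q <- L) (transporters p Q R)%:~R / (stab_card p Q)%:R = [! Z R]%:~R :> rat.
  case: (boolP (Z R)) => ZR; last first.
    rewrite big_seq big1 // => Q hQ; rewrite transporters_nequiv ?mul0r //.
    by move=> e; move: ZR; rewrite (hZ _ _ e) // LZ.
  have [Q0 hQ0 e0] := cov _ ZR.
  rewrite (bigD1_seq Q0) //= transporters_equiv // -stab_card_transporters ?dL // pmulrn divff; last first.
    have := @transporters_refl_neq0 p Q0; rewrite -stab_card_transporters ?dL // => /(_ hD).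
    by rewrite pnatr_eq0.
  rewrite big_seq_cond big1 ?addr0 // => Q /andP[hQ ne].
  rewrite transporters_nequiv ?mul0r // => e; move: ne; rewrite (injL Q Q0) ?eqxx //.
  exact: equivQ_trans e (equivQ_sym e0).
transitivity (\sum_(Q <- L) \sum_(j <- iota 0 p.+1) \sum_(R <- s)
   ([! disc R == D] * alpha R)%:~R * ((transporters p Q (act R (gamma0_rep p j)))%:~R / (stab_card p Q)%:R) : rat).
  apply: eq_big_seq => Q hQ; have dQ : disc Q < 0 by rewrite dL.
  have -> : 24 = (24 : int)%:~R :> rat by [].
  rewrite -(coset_sum pp dQ) rmorph_sum /= mulr_suml; apply: eq_bigr => j _.
  rewrite dL // fE rmorph_sum /= mulr_suml; apply: eq_bigr => R _.
  by rewrite mulrA rmorphM /= mulrA.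
rewrite exchange_big /= /coset_mass rmorph_sum /=; apply: eq_bigr => j _.
rewrite exchange_big /= fE rmorph_sum /=; apply: eq_bigr => R _.
by rewrite -mulr_sumr orb -intrM -mulrA.
Qed.

(** * The Fricke involution and the Hecke relation *)

Section Fricke.
Variable p : nat.
Hypothesis p_prime : prime p.

(* The Fricke involution (0, -1; p, 0) normalizes Gamma_0(p): frm is the induced conjugation. *)
Definition frq (Q : qform) : qform := act Q (0, -1, p%:Z, 0).
Definition frm (g : mat2) : mat2 :=
  let: (a, b, c, d) := g in (d, - (c %/ p%:Z)%Z, - (p%:Z * b), a).

Let p_neq0 : p%:Z != 0.
Proof. by have := prime_gt0 p_prime; lia. Qed.

Lemma frm_spec g : gamma0 p g ->
  [/\ gamma0 p (frm g), frm (frm g) = g & mulm (0, -1, p%:Z, 0) (frm g) = mulm g (0, -1, p%:Z, 0)].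
Proof.
case: g => [[[a b] c] d] /andP[/eqP e /dvdzP[q ec]]; subst c.
have -> : frm (a, b, q * p%:Z, d) = (d, - q, - (p%:Z * b), a) by rewrite /frm mulzK.
split.
- rewrite /gamma0; apply/andP; split; first by apply/eqP; rewrite -e; ring.
  by rewrite rpredN; exact: dvdz_mulr.
- rewrite /frm; congr (_, _, _, _); last by ring.
  by rewrite -mulrN mulrC mulzK ?opprK.
- by rewrite /mulm; congr (_, _, _, _); ring.
Qed.

Lemma act_frq Q g : gamma0 p g -> act (frq Q) g = frq (act Q (frm g)).
Proof.
move=> /frm_spec[Gf ff _]; have [_ _ e] := frm_spec Gf.
by rewrite /frq !act_mulm -e ff.
Qed.

Lemma frqE A B C : frq (A, B, C) = (p%:Z ^+ 2 * C, - (p%:Z * B), A).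
Proof. by rewrite /frq /act; congr (_, _, _); ring. Qed.

Lemma frq_inj : injective frq.
Proof.
move=> [[A B] C] [[A' B'] C']; rewrite !frqE => -[e1 /oppr_inj /(mulfI p_neq0) -> ->].
by congr (_, _, _); apply: (mulfI _ e1); rewrite expf_neq0.
Qed.

Lemma equivQ_frq Q R : equivQ p (frq Q) (frq R) <-> equivQ p Q R.
Proof.
split=> -[g [/gamma0P Gg e]].
  exists (frm g); have [Gf _ _] := frm_spec Gg; split; first exact/gamma0P.
  by apply: frq_inj; rewrite -act_frq.
exists (frm g); have [Gf ff _] := frm_spec Gg; split; first exact/gamma0P.
by rewrite act_frq // ff e.
Qed.

Lemma transporters_frq Q : transporters p (frq Q) (frq Q) = transporters p Q Q.
Proof.
apply: (@fsum_bij _ _ _ _ frm frm) => g; rewrite b2z_neq0 => /andP[Gg /eqP e].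
  have [Gf -> _] := frm_spec Gg; split=> //; rewrite Gf Gg e eqxx.
  by have -> : act Q (frm g) = Q by [apply: frq_inj; rewrite -act_frq]; rewrite eqxx.
have [Gf ff _] := frm_spec Gg; split=> //.
by rewrite Gf Gg e act_frq // ff e !eqxx.
Qed.

Variable m : int.
Hypothesis m_gt0 : 0 < m.
Hypothesis p_odd : p != 2%N.

Definition Zall (Q : qform) : bool := disc Q == - m.
(** The image under [frq] of all forms of discriminant -m. *)
Definition Zfr (Q : qform) : bool :=
  [&& disc Q == - (p%:Z ^+ 2 * m), (p%:Z ^+ 2 %| qa Q)%Z & (p%:Z %| qb Q)%Z].
Definition Zlevel (Q : qform) : bool := (p%:Z %| qa Q)%Z && (disc Q == - m).

Lemma Zall_equiv Q R : equivQ p Q R -> Zall Q -> Zall R.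
Proof. by move=> e; rewrite /Zall (equivQ_disc e). Qed.

Lemma Zlevel_equiv Q R : equivQ p Q R -> Zlevel Q -> Zlevel R.
Proof.
move=> e; rewrite /Zlevel (equivQ_disc e) => /andP[h ->]; rewrite andbT.
case: e => g [/gamma0P Gg <-]; case: Q g h Gg => [[A B] C] [[[a b] c] d].
rewrite /qa /= => /dvdzP[A' ->] /andP[_ /dvdzP[c' ->]]; apply/dvdzP.
by exists (A' * a ^+ 2 + B * a * c' + C * c' ^+ 2 * p%:Z); ring.
Qed.

Lemma Zfr_equiv Q R : equivQ p Q R -> Zfr Q -> Zfr R.
Proof.
move=> e; rewrite /Zfr (equivQ_disc e) => /and3P[-> h1 h2] /=.
case: e => g [/gamma0P Gg <-]; case: Q g h1 h2 Gg => [[A B] C] [[[a b] c] d].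
rewrite /qa /qb /= => /dvdzP[A' ->] /dvdzP[B' ->] /andP[_ /dvdzP[c' ->]].
apply/andP; split; apply/dvdzP.
  by exists (A' * a ^+ 2 + B' * a * c' + C * c' ^+ 2); ring.
by exists (2 * A' * p%:Z * a * b + B' * (a * d + b * (c' * p%:Z)) + 2 * C * c' * d); ring.
Qed.

Lemma reps_frq L : reps p Zall L -> reps p Zfr (map frq L).
Proof.
move=> [h1 h2 h3]; split.
- move=> _ /mapP[[[A B] C] hQ ->]; move/h1: hQ; rewrite frqE /Zall /Zfr /disc /qa /qb /qc /=.
  move=> /eqP e; apply/and3P; split; last by rewrite rpredN dvdz_mulr.
    by apply/eqP; rewrite -[RHS]mulrN -e; ring.
  exact: dvdz_mulr.
- move=> [[A B] C] /and3P[]; rewrite /disc /qa /qb /qc /= => /eqP e /dvdzP[A' eA] /dvdzP[B' eB].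
  have eQ : (A, B, C) = frq (C, - B', A').
    by rewrite frqE eA eB; congr (_, _, _); ring.
  have [|Q' hQ' e'] := h2 (C, - B', A').
    rewrite /Zall /disc /qa /qb /qc /=; apply/eqP; apply: (@mulfI _ (p%:Z ^+ 2)).
      by rewrite expf_neq0.
    by rewrite mulrN -e eA eB; ring.
  by exists (frq Q'); [exact: map_f|rewrite eQ; apply/equivQ_frq].
- move=> i j; rewrite size_map => hi hj.
  rewrite !(nth_map (0, 0, 0)) // => /equivQ_frq; exact: h3.
Qed.

(** For k > 0 this is 24 H(k), as forms of both signs are counted. *)
Definition alpha_mass (k : int) : int := fsum (fun R => [! disc R == - k] * (alpha R * 1)).

Let pm_gt0 : 0 < p%:Z ^+ 2 * m.
Proof. by rewrite mulr_gt0 // exprn_even_gt0. Qed.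

Lemma coset_mass_all : coset_mass p (- m) Zall = (p%:Z + 1) * alpha_mass m.
Proof.
rewrite /coset_mass (eq_bigr (fun=> alpha_mass m)).
  by rewrite big_const_seq count_predT iter_addr_0 size_iota -mulr_natl natz -addn1 PoszD.
move=> j _; apply: eq_fsum => R; rewrite /Zall disc_act gamma0_rep_det expr1n mul1r.
by case: eqP => // _; rewrite !mul0r.
Qed.

(** The Fricke map matches orbits and preserves stabilizer orders, so [mass_formula] gives the same
    value on both sides. *)
Lemma coset_mass_fricke : coset_mass p (- (p%:Z ^+ 2 * m)) Zfr = coset_mass p (- m) Zall.
Proof.
have m1 : - m < 0 by lia.
have m2 : - (p%:Z ^+ 2 * m) < 0 by rewrite oppr_lt0.
have [L hL] : exists L, reps p Zall L.
  by apply: (definite_reps_exist p_prime m1) Zall_equiv => Q /eqP.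
have := mass_formula p_prime m2 _ Zfr_equiv (reps_frq hL).
have := mass_formula p_prime m1 _ Zall_equiv hL.
move=> e1 e2; apply/eqP; rewrite -(eqr_int rat).
rewrite -e1; last by move=> Q /eqP.
rewrite -e2; last by move=> Q /and3P[/eqP].
rewrite big_map; apply/eqP; apply: eq_big_seq => Q hQ; congr (_ / _).
have dQ : disc Q = - m by case: hL => h _ _; have /eqP := h _ hQ.
have dF : disc (frq Q) < 0.
  rewrite /frq disc_act dQ /detm.
  have -> : 0 * 0 - -1 * p%:Z = p%:Z by ring.
  by rewrite mulrN oppr_lt0.
apply/eqP; rewrite eqr_nat -eqz_nat !stab_card_transporters ?dQ ?transporters_frq //.
Qed.

Definition dvdq (R : qform) : bool := let: (A, B, C) := R in
  [&& (p%:Z %| A)%Z, (p%:Z %| B)%Z & (p%:Z %| C)%Z].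
Definition scaleq (k : int) (R : qform) : qform := let: (A, B, C) := R in (k * A, k * B, k * C).

Lemma act_scaleq k R g : act (scaleq k R) g = scaleq k (act R g).
Proof.
by case: R g => [[A B] C] [[[a b] c] d]; rewrite /act /scaleq; congr (_, _, _); ring.
Qed.

Lemma disc_scaleq k R : disc (scaleq k R) = k ^+ 2 * disc R.
Proof. by case: R => [[A B] C]; rewrite /disc /qa /qb /qc /=; ring. Qed.

Lemma alpha_scaleq k R : 0 < k -> alpha (scaleq k R) = alpha R.
Proof.
move=> hk; case: R => [[A B] C]; rewrite /alpha /qa /qb /qc /= !normrM (gtr0_norm hk).
by rewrite ![2 * (k * _)]mulrCA !ltr_pM2l // !ler_pM2l.
Qed.

(* A form of discriminant divisible by p^2 that is nonzero modulo p has exactly one root modulo p,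
   which is a double root. *)
Lemma Zfr_kp_ndvd R : disc R = - (p%:Z ^+ 2 * m) -> ~~ dvdq R ->
  \sum_(j <- iota 0 p.+1) [! Zfr (act R (gamma0_rep p j))] = 1 :> int.
Proof.
move=> hD hnd.
have dR g : detm g = 1 -> disc (act R g) == - (p%:Z ^+ 2 * m).
  by move=> e; rewrite disc_act e expr1n mul1r hD.
case: R hD hnd dR => [[A B] C]; rewrite {1}/disc {1}/qa {1}/qb {1}/qc /= => hD hnd dR.
rewrite sum_P1 {2}/gamma0_rep eqxx act_onem.
have := dR onem (erefl _); rewrite act_onem => dR1.
rewrite {2}/Zfr dR1 /qa /qb /=.
rewrite (eq_big_seq (fun j => [! (p%:Z ^+ 2 %| A * j%:Z ^+ 2 + B * j%:Z + C)%Z &&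
   (p%:Z %| 2 * A * j%:Z + B)%Z])); last first.
  move=> j hj; have := dR _ (gamma0_rep_det p j); rewrite /Zfr => ->; rewrite (gamma0_rep_lt hj) /act /qa /qb /=.
  congr [! _ && _]; first by congr (_ %| _)%Z; ring.
  by rewrite -rpredN; congr (_ %| _)%Z; ring.
have pd : (p%:Z %| B ^+ 2 - 4 * A * C)%Z.
  by rewrite hD rpredN expr2 -mulrA dvdz_mulr.
have p2 : ~~ (p%:Z %| 2%:Z)%Z.
  rewrite dvdzE /= dvdn_prime2 //.
(* If p divides A, the double root is the point at infinity, that is, j = p. *)
case: (boolP (p%:Z %| A)%Z) => hA.
  have hB : (p%:Z %| B)%Z.
    have : (p%:Z %| B ^+ 2)%Z.
      have -> : B ^+ 2 = (B ^+ 2 - 4 * A * C) + A * (4 * C) by ring.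
      by apply: rpredD => //; exact: dvdz_mulr.
    by rewrite expr2 Euclid_dvdzM // orbb.
  have hC : ~~ (p%:Z %| C)%Z by move: hnd; rewrite /dvdq hA hB.
  have hA2 : (p%:Z ^+ 2 %| A)%Z.
    case/dvdzP: hA => A' eA; case/dvdzP: hB => B' eB.
    have : (p%:Z %| A' * (2 * (2 * C)))%Z.
      apply/dvdzP; exists (B' ^+ 2 + m); apply: (mulfI p_neq0).
      have -> : p%:Z * (A' * (2 * (2 * C))) = 4 * A * C by rewrite eA; ring.
      have -> : 4 * A * C = B ^+ 2 - (B ^+ 2 - 4 * A * C) by ring.
      by rewrite hD eB; ring.
    rewrite !Euclid_dvdzM // (negbTE hC) (negbTE p2) !orbF => /dvdzP[A'' eA''].
    by apply/dvdzP; exists A''; rewrite eA eA''; ring.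
  rewrite hA2 hB /= big_seq big1 ?add0r // => j _.
  case: (boolP (_ %| _)%Z) => //= h; exfalso; move: hC; rewrite (_ : C = (A * j%:Z ^+ 2 + B * j%:Z + C)
      - (A * j%:Z ^+ 2 + B * j%:Z)); last by ring.
  rewrite rpredB //; last by rewrite rpredD // dvdz_mulr.
  by case/dvdzP: h => x ->; rewrite expr2 mulrA dvdz_mull.
have -> : (p%:Z ^+ 2 %| A)%Z = false.
  by apply: contraNF hA => /dvdzP[x ->]; rewrite expr2 mulrA dvdz_mull.
rewrite /= addr0 -(@linear_root_count p (2 * A) B) //; last first.
  by rewrite Euclid_dvdzM // negb_or p2.
apply: eq_bigr => j _; congr [! _].
apply/andP/idP => [[]//|h]; split=> //.
(* As 4A f(j) = (2Aj + B)^2 - disc, a root of the derivative modulo p is a root of f modulo p^2. *)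
have : (p%:Z ^+ 2 %| (A * j%:Z ^+ 2 + B * j%:Z + C) * (2 * 2 * A))%Z.
  have -> : (A * j%:Z ^+ 2 + B * j%:Z + C) * (2 * 2 * A) =
     (2 * A * j%:Z + B) ^+ 2 - (B ^+ 2 - 4 * A * C) by ring.
  rewrite hD; case/dvdzP: h => x ->; apply/dvdzP; exists (x ^+ 2 + m); ring.
rewrite Gauss_dvdzl // coprimez_pexpl // coprimezE prime_coprime //.
by rewrite -[X in (X %| _)%N]/(absz p%:Z) -dvdzE !Euclid_dvdzM // !negb_or p2 hA.
Qed.

Lemma Zfr_kp_scale R :
  \sum_(j <- iota 0 p.+1) [! Zfr (act (scaleq p%:Z R) (gamma0_rep p j))] =
  \sum_(j <- iota 0 p.+1) [! Zlevel (act R (gamma0_rep p j))] :> int.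
Proof.
apply: eq_bigr => j _; rewrite act_scaleq; case: (act R _) => [[A B] C]; congr [! _].
rewrite /Zfr /Zlevel disc_scaleq /scaleq /qa /qb /= -mulrN (inj_eq (mulfI _)) ?expf_neq0 //.
by rewrite expr2 dvdz_mul2l // (dvdz_mulr _ (dvdzz _)) andbT andbC.
Qed.

(** Every form of discriminant -p^2 m counts once, except the multiples pR: these count once for
    each root of R modulo p, and R runs over the forms of discriminant -m. *)
Lemma coset_mass_Zfr :
  coset_mass p (- (p%:Z ^+ 2 * m)) Zfr = alpha_mass (p%:Z ^+ 2 * m) - alpha_mass m + coset_mass p (- m) Zlevel.
Proof.
have m1 : - m < 0 by lia.
have m2 : - (p%:Z ^+ 2 * m) < 0 by rewrite oppr_lt0.
have ex D (Z : pred qform) : D < 0 -> coset_mass p D Z =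
    fsum (fun R => [! disc R == D] * (alpha R * \sum_(j <- iota 0 p.+1) [! Z (act R (gamma0_rep p j))])).
  move=> hD; rewrite /coset_mass -fsum_sum; last by move=> j _; exact: fin_alpha.
  by apply: eq_fsum => R; rewrite !mulr_sumr.
pose N1 R : int := \sum_(j <- iota 0 p.+1) [! Zlevel (act R (gamma0_rep p j))].
pose N2 R : int := \sum_(j <- iota 0 p.+1) [! Zfr (act R (gamma0_rep p j))].
have e3 : fsum (fun R => [! disc R == - (p%:Z ^+ 2 * m)] * (alpha R * ([! dvdq R] * (N2 R - 1)))) =
    fsum (fun R => [! disc R == - m] * (alpha R * (N1 R - 1))).
  symmetry.
  apply: (@fsum_bij _ _ _ _ (scaleq p%:Z) (fun R => let: (A, B, C) := R in
     ((A %/ p%:Z)%Z, (B %/ p%:Z)%Z, (C %/ p%:Z)%Z))) => [R _|[[A B] C]].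
    split; last by case: R => [[A B] C]; rewrite /scaleq !mulKz.
    rewrite alpha_scaleq ?disc_scaleq -?mulrN ?(inj_eq (mulfI _)) ?expf_neq0 //; last by lia.
    rewrite /N1 /N2 Zfr_kp_scale.
    have -> : dvdq (scaleq p%:Z R) by case: R => [[A B] C]; rewrite /dvdq /scaleq !dvdz_mulr.
    by rewrite mul1r.
  rewrite !mulf_eq0 !negb_or !b2z_neq0 => /and4P[_ _ /and3P[/dvdzP[A' ->] /dvdzP[B' ->] /dvdzP[C' ->]] _].
  rewrite !mulzK //.
  have -> : (A' * p%:Z, B' * p%:Z, C' * p%:Z) = scaleq p%:Z (A', B', C').
    by rewrite /scaleq; congr (_, _, _); ring.
  split=> //.
  rewrite alpha_scaleq ?disc_scaleq -?mulrN ?(inj_eq (mulfI _)) ?expf_neq0 //; last by lia.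
  rewrite /N1 /N2 Zfr_kp_scale.
  have -> : dvdq (scaleq p%:Z (A', B', C')) by rewrite /dvdq /scaleq !dvdz_mulr.
  by rewrite mul1r.
have e1 : coset_mass p (- (p%:Z ^+ 2 * m)) Zfr = alpha_mass (p%:Z ^+ 2 * m) +
    fsum (fun R => [! disc R == - (p%:Z ^+ 2 * m)] * (alpha R * ([! dvdq R] * (N2 R - 1)))).
  rewrite ex // /alpha_mass -fsumD; [|exact: fin_alpha|exact: fin_alpha].
  apply: eq_fsum => R; case: eqP => [hD|_]; last by rewrite !mul0r.
  rewrite !mul1r -mulrDr; congr (_ * _); rewrite -/(N2 R).
  case: (boolP (dvdq R)) => hd; first by rewrite mul1r addrC subrK.
  by rewrite /N2 Zfr_kp_ndvd // mul0r.
have e2 : coset_mass p (- m) Zlevel = alpha_mass m + fsum (fun R => [! disc R == - m] * (alpha R * (N1 R - 1))).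
  rewrite ex // /alpha_mass -fsumD; [|exact: fin_alpha|exact: fin_alpha].
  by apply: eq_fsum => R; rewrite -!mulrDr addrC subrK.
by rewrite e1 e3 e2; ring.
Qed.

(** Comparing [coset_mass_Zfr] with the value (p + 1) [alpha_mass m] obtained through the Fricke map
    and solving for the mass of [Zlevel]. *)
Lemma orbit_sum_alpha_mass : 12 * orbit_sum p (- m) = ((p%:Z + 2) * alpha_mass m - alpha_mass (p%:Z ^+ 2 * m))%:~R :> rat.
Proof.
have m1 : - m < 0 by lia.
have ZD Q : Zlevel Q -> disc Q = - m by move=> /andP[_ /eqP].
have [L hL] := definite_reps_exist p_prime m1 ZD Zlevel_equiv.
have hZ Q : inQ p (- m) Q <-> Zlevel Q.
  by rewrite /inQ /Zlevel; split=> [[-> /eqP]|/andP[-> /eqP]].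
have : orbit_reps p (- m) (epsilon (inhabits [::]) (orbit_reps p (- m))).
  apply: epsilon_spec; exists L; case: hL => h1 h2 h3; split=> //.
    by move=> Q /h1 /hZ.
  by move=> Q /hZ /h2.
rewrite /orbit_sum; set L' := epsilon _ _ => -[h1 h2 h3].
have hL' : reps p Zlevel L' by split=> // [Q /h1 /hZ|Q /hZ /h2].
have := mass_formula p_prime m1 ZD Zlevel_equiv hL'.
have -> : coset_mass p (- m) Zlevel = (p%:Z + 2) * alpha_mass m - alpha_mass (p%:Z ^+ 2 * m).
  have := coset_mass_Zfr; rewrite coset_mass_fricke coset_mass_all.
  by move=> e; apply: (addrI (alpha_mass (p%:Z ^+ 2 * m) - alpha_mass m)); rewrite -e; ring.
move=> <-; rewrite mulr_sumr; apply: eq_bigr => Q _.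
by rewrite mulrA -natrM.
Qed.
End Fricke.

(** * Forms of discriminant -4n and sums of three squares *)

Lemma alpha_mass_three_squares (n : int) : 0 < n -> alpha_mass (4 * n) - 2 * alpha_mass n = 2 * three_squares n.
Proof.
move=> n0; rewrite gauss_three_squares /gauss_sum.
have -> : n == 0 = false by lia.
rewrite add0r.
have m1 : - n < 0 by lia.
have m2 : - (4 * n) < 0 by lia.
pose e2 (R : qform) : bool := let: (A, B, C) := R in evenz A && evenz C.
(* Doubling a form of discriminant -n gives exactly the forms of discriminant -4n with even outer
   coefficients, as the middle one is then even. *)
have s1 : alpha_mass n = fsum (fun R => [! disc R == - (4 * n)] * (alpha R * [! e2 R])).
  apply: (@fsum_bij _ _ _ _ (scaleq 2) (fun R => let: (A, B, C) := R in
     ((A %/ 2)%Z, (B %/ 2)%Z, (C %/ 2)%Z))) => [R _|[[A B] C]].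
    split; last by case: R => [[A B] C]; rewrite /scaleq !mulKz.
    rewrite alpha_scaleq // disc_scaleq.
    have -> : e2 (scaleq 2 R) by case: R => [[A B] C]; rewrite /e2 /scaleq !evenz_mul.
    by congr ([! _] * _); lia.
  rewrite !mulf_eq0 !negb_or !b2z_neq0 => /and3P[/eqP hD _ /andP[hA hC]].
  have hB : evenz B.
    have : evenz (B ^+ 2).
      have -> : B ^+ 2 = disc (A, B, C) + 4 * A * C by rewrite /disc /qa /qb /qc /=; ring.
      by rewrite hD evenz_add evenz_opp !evenz_mul.
    by rewrite expr2 evenz_mul orbb.
  case/dvdzP: hA => A' ->; case/dvdzP: hB => B' ->; case/dvdzP: hC => C' ->.
  rewrite !mulzK //.
  have -> : (A' * 2, B' * 2, C' * 2) = scaleq 2 (A', B', C').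
    by rewrite /scaleq; congr (_, _, _); ring.
  split=> //; rewrite alpha_scaleq // disc_scaleq.
  have -> : e2 (scaleq 2 (A', B', C')) by rewrite /e2 /scaleq !evenz_mul.
  by congr ([! _] * _); move: (disc _) => D; clear; lia.
pose w (R : qform) : int := 1 - 2 * [! e2 R].
have s2 : alpha_mass (4 * n) - 2 * alpha_mass n = fsum (fun R => [! disc R == - (4 * n)] * (alpha R * w R)).
  rewrite s1 -mulNr -fsumZ; last exact: fin_alpha.
  rewrite /alpha_mass -fsumD; [|exact: fin_alpha|apply: fin_suppZ; exact: fin_alpha].
  by apply: eq_fsum => R; rewrite /w; ring.
pose K (b : pred qform) := fsum (fun R => [! disc R == - (4 * n)] * (alpha R * (w R * [! b R]))).
have Kbij (f : qform -> qform) (b c : pred qform) : involutive f ->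
    (forall R, [/\ disc (f R) = disc R, alpha (f R) = alpha R, w (f R) = w R & b (f R) = c R]) ->
    K c = K b.
  move=> ff h; apply: (@fsum_bij _ _ _ _ f f) => R _.
    by have [-> -> -> ->] := h R.
  by have := h (f R); rewrite ff => -[-> -> -> ->].
pose b1 (R : qform) := (0 < qa R) && (qb R < 0).
pose b2 (R : qform) := (0 < qa R) && (0 < qb R).
pose b0 (R : qform) := (0 < qa R) && (qb R == 0).
pose c1 (R : qform) := (qa R < 0) && (0 < qb R).
pose c2 (R : qform) := (qa R < 0) && (qb R < 0).
pose c0 (R : qform) := (qa R < 0) && (qb R == 0).
(* Changing the sign of B, or of the whole form, reduces to A > 0 and B <= 0. *)
have s3 : alpha_mass (4 * n) - 2 * alpha_mass n = 4 * K b1 + 2 * K b0.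
  have k1 : K b2 = K b1.
    apply: (Kbij (fun R => let: (A, B, C) := R in (A, - B, C))) => [[[A B] C]|[[A B] C]].
      by rewrite opprK.
    by rewrite /disc /alpha /w /b1 /b2 /qa /qb /qc /= normrN sqrrN oppr_lt0.
  have kneg (R : qform) : [/\ disc (negq R) = disc R, alpha (negq R) = alpha R & w (negq R) = w R].
    rewrite disc_negq alpha_negq; split=> //.
    by case: R => [[A B] C]; rewrite /w /e2 /= !evenz_opp.
  have k2 : K c1 = K b1.
    apply: (Kbij negq) negqK _ => R; have [-> -> ->] := kneg R; split=> //.
    by case: R => [[A B] C]; rewrite /b1 /c1 /qa /qb /= oppr_gt0 oppr_lt0.
  have k3 : K c2 = K b2.
    apply: (Kbij negq) negqK _ => R; have [-> -> ->] := kneg R; split=> //.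
    by case: R => [[A B] C]; rewrite /b2 /c2 /qa /qb /= !oppr_gt0.
  have k4 : K c0 = K b0.
    apply: (Kbij negq) negqK _ => R; have [-> -> ->] := kneg R; split=> //.
    by case: R => [[A B] C]; rewrite /b0 /c0 /qa /qb /= oppr_gt0 oppr_eq0.
  transitivity (K b1 + (K b2 + (K b0 + (K c1 + (K c2 + K c0))))); last by rewrite k4 k3 k2 k1; ring.
  have fK (b : pred qform) : fin_supp (fun R => [! disc R == - (4 * n)] * (alpha R * (w R * [! b R]))).
    exact: (fin_alpha (fun R => w R * [! b R])).
  have f5 := fin_suppD (fK c2) (fK c0); have f4 := fin_suppD (fK c1) f5.
  have f3 := fin_suppD (fK b0) f4; have f2 := fin_suppD (fK b2) f3.
  rewrite s2 /K -(fsumD (fK c2) (fK c0)) -(fsumD (fK c1) f5) -(fsumD (fK b0) f4).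
  rewrite -(fsumD (fK b2) f3) -(fsumD (fK b1) f2).
  apply: eq_fsum => R; case: eqP => [hD|_]; last by rewrite !mul0r.
  rewrite !mul1r -!mulrDr; congr (_ * _); rewrite -[LHS]mulr1; congr (_ * _).
  have : qa R != 0.
    apply/eqP => h; move: hD; rewrite /disc h mulr0 mul0r subr0.
    by have := sqr_ge0 (qb R); move: m2; clear; lia.
  by rewrite /b1 /b2 /b0 /c1 /c2 /c0; clear; lia.
have s4' : 2 * K b1 + K b0 = 2 * uvw_sum n.
  pose U (b : int -> bool) := fsum (fun z : int * int * int => let: (u, v, w) := z in
    [! u * v + v * w + w * u == n] * (omega3 u v w * selling_weight u v w) * [! b w]).
  have fU b : fin_supp (fun z : int * int * int => let: (u, v, w) := z in
      [! u * v + v * w + w * u == n] * (omega3 u v w * selling_weight u v w) * [! b w]).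
    by apply: fin_supp_sub (fin_uvw n) => -[[u v] w']; apply: contraNneq => ->; rewrite mul0r.
  have u1 : uvw_sum n = U (fun w => 0 < w) + U (fun w => w == 0).
    rewrite /U -fsumD //; apply: eq_fsum => -[[u v] w'].
    rewrite -mulrDr; case: (eqVneq (selling_weight u v w') 0) => [->|/selling_weight_neq0[_ _ hw _]].
      by rewrite !mulr0 mul0r.
    by rewrite -[LHS]mulr1; congr (_ * _); move: hw; clear; lia.
  have hev (A B C : int) : disc (A, B, C) = - (4 * n) -> exists t, B = - (2 * t).
    move=> hD; have : evenz (B ^+ 2).
      have -> : B ^+ 2 = disc (A, B, C) + 4 * A * C by rewrite /disc /qa /qb /qc /=; ring.
      by rewrite hD evenz_add evenz_opp !evenz_mul.
    by rewrite expr2 evenz_mul orbb => /dvdzP[t ->]; exists (- t); ring.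
  pose phi (R : qform) : int * int * int := let: (A, B, C) := R in
    let w := (- B %/ 2)%Z in (A - w, C - w, w).
  pose psi (z : int * int * int) : qform := let: (u, v, w) := z in (u + w, - (2 * w), v + w).
  have phiK A t C : phi (A, - (2 * t), C) = (A - t, C - t, t).
    by rewrite /phi opprK mulKz.
  have psiD u v t : disc (psi (u, v, t)) = - (4 * (u * v + v * t + t * u)).
    by rewrite /disc /qa /qb /qc /=; ring.
  have wom u v t : w (psi (u, v, t)) = omega3 u v t by rewrite /w /omega3 /e2 /evenz /=; clear; lia.
  have al1 u v t : 0 < t -> 0 < u + t -> u * v + v * t + t * u = n ->
      alpha (psi (u, v, t)) = selling_weight u v t.
    move=> ht hu e; have hv : 0 < v + t by move: e n0 ht hu; clear; nia.
    have nz : ~ (u = 0 /\ v = 0) by case=> u0 v0; move: e n0; rewrite u0 v0; clear; lia.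
    rewrite /alpha /selling_weight /sg /qa /qb /qc /=; case: ifP; move: ht hu hv nz; clear; lia.
  (* On the face w = 0 [alpha] does not see a boundary while [selling_weight] does, hence the factor
     2; it compensates for B = 0 having no mirror image. *)
  have al0 u v : 0 < u -> u * v = n -> alpha (psi (u, v, 0)) = 2 * selling_weight u v 0.
    move=> hu e; have hv : 0 < v by move: e n0 hu; clear; nia.
    rewrite /alpha /selling_weight /sg /qa /qb /qc /=; case: ifP; move: hu hv; clear; lia.
  have psiK u v t : phi (psi (u, v, t)) = (u, v, t) by rewrite /psi phiK !addrK.
  have toD u v t : disc (psi (u, v, t)) = - (4 * n) -> u * v + v * t + t * u = n.
    by rewrite psiD; clear; lia.
  have surj R : disc R = - (4 * n) -> exists z, R = psi z.
    case: R => [[A B] C] /hev[t ->]; exists (A - t, C - t, t).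
    by rewrite /psi !subrK.
  have core1 u v t : 0 < t -> 0 < u + t -> u * v + v * t + t * u = n ->
      [! u * v + v * t + t * u == n] * (omega3 u v t * selling_weight u v t) * [! 0 < t] =
      [! disc (psi (u, v, t)) == - (4 * n)] *
        (alpha (psi (u, v, t)) * (w (psi (u, v, t)) * [! b1 (psi (u, v, t))])).
    move=> ht hu e; rewrite psiD e al1 // wom /b1 /qa /qb /= hu ht oppr_lt0 mulr_gt0 // !eqxx /=.
    by ring.
  have core0 u v t : t = 0 -> 0 < u -> u * v + v * t + t * u = n ->
      2 * ([! u * v + v * t + t * u == n] * (omega3 u v t * selling_weight u v t) * [! t == 0]) =
      [! disc (psi (u, v, t)) == - (4 * n)] *
        (alpha (psi (u, v, t)) * (w (psi (u, v, t)) * [! b0 (psi (u, v, t))])).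
    move=> t0 hu e; have e' : u * v = n by move: e; rewrite t0; clear; lia.
    rewrite psiD e wom /b0 t0 al0 // /qa /qb /= addr0 hu mulr0 oppr0 !eqxx /=; ring.
  have e1 : K b1 = U (fun w => 0 < w).
    apply: (@fsum_bij _ _ _ _ phi psi) => [R|[[u v] t]].
      rewrite !mulf_eq0 !negb_or !b2z_neq0 => /and4P[/eqP hD _ _ hb].
      have [[[u v] t] eR] := surj _ hD; subst R; rewrite psiK; split=> //.
      have [hu ht] : 0 < u + t /\ 0 < t.
        by move: hb; rewrite /b1 /qa /qb /= oppr_lt0 pmulr_rgt0 // => /andP[].
      by apply: core1 => //; exact: toD.
    rewrite !mulf_eq0 !negb_or !b2z_neq0 => /andP[/and3P[/eqP e _ /selling_weight_neq0[hu _ _ _]] ht].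
    by rewrite psiK core1 //; move: hu ht; clear; lia.
  have e0 : K b0 = 2 * U (fun w => w == 0).
    rewrite -fsumZ //; apply: (@fsum_bij _ _ _ _ phi psi) => [R|[[u v] t]].
      rewrite !mulf_eq0 !negb_or !b2z_neq0 => /and4P[/eqP hD _ _ hb].
      have [[[u v] t] eR] := surj _ hD; subst R; rewrite psiK; split=> //.
      have [hu ht] : 0 < u + t /\ t = 0.
        by move: hb; rewrite /b0 /qa /qb /= oppr_eq0 mulf_eq0 /= => /andP[? /eqP].
      by apply: core0 => //; [move: hu; rewrite ht addr0|exact: toD].
    rewrite !mulf_eq0 !negb_or !b2z_neq0 => /and3P[_ /and3P[/eqP e _ /selling_weight_neq0[hu _ _ h]] /eqP ht].
    by rewrite psiK core0 //; move: hu h; rewrite ht; clear; lia.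
  by rewrite u1 e1 e0; ring.
by rewrite s3 -s4'; ring.
Qed.

Theorem theorem1p1 (p n : nat) :
  prime p -> p != 2%N -> (0 < n)%N -> (n %% 4 == 0)%N || (n %% 4 == 3)%N ->
  12 * orbit_sum p (- (4 * n)%:Z) - 24 * orbit_sum p (- n%:Z)
  = 4 * (r3 n)%:R - 2 * ((r3 (p ^ 2 * n))%:R - p%:R * (r3 n)%:R) :> rat.
Proof.
move=> pp p2 n0 _.
have n0' : 0 < n%:Z by lia.
have h4 : (4 * n)%N%:Z = 4 * n%:Z by rewrite PoszM.
have -> : 24 * orbit_sum p (- n%:Z) = 2 * (12 * orbit_sum p (- n%:Z)).
  by rewrite mulrA -natrM.
rewrite h4 !orbit_sum_alpha_mass //; last by lia.
have q0 : 0 < p%:Z ^+ 2 * n%:Z by rewrite mulr_gt0 // exprn_even_gt0 //; have := prime_gt0 pp; lia.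
(* The Hecke relation for m = 4n and m = n involves the masses at 4n, n, 4p^2 n and p^2 n, which
   pair up into Gauss's formula at n and at p^2 n. *)
have t1 := alpha_mass_three_squares n0'; have t2 := alpha_mass_three_squares q0.
rewrite [4 * (_ * _)]mulrCA in t2.
have e2 : p%:Z ^+ 2 * n%:Z = (p ^ 2 * n)%N%:Z by rewrite PoszM -mulnn PoszM expr2.
rewrite !pmulrn !r3_three_squares -e2.
rewrite -!intrM -!rmorphB -!intrM -!rmorphB; congr (_%:~R).
have t1' : alpha_mass (4 * n%:Z) = 2 * three_squares n%:Z + 2 * alpha_mass n%:Z by rewrite -t1 subrK.
have t2' : alpha_mass (p%:Z ^+ 2 * (4 * n%:Z)) =
    2 * three_squares (p%:Z ^+ 2 * n%:Z) + 2 * alpha_mass (p%:Z ^+ 2 * n%:Z) by rewrite -t2 subrK.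
by rewrite t1' t2'; ring.
Qed.
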